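(* There is an absolute constant $C>0$ and a randomized algorithm with the following guarantee. Let $n$ be a positive integer, let $H\in\mathbb{R}^{n\times n}$ be a positive semidefinite Hankel matrix, let $E\in\mathbb{R}^{n\times n}$ be an arbitrary (not necessarily Hankel) matrix, and let $\epsilon>0$. Given $n$, $\epsilon$ and query access to individual entries of $B=H+E$, the algorithm runs in $\mathrm{polylog}(n,1/\epsilon)$ time and returns a factored representation of a Hankel matrix $\widehat{H}\in\mathbb{R}^{n\times n}$ of rank $O(\log n\log(1/\epsilon))$ such that, with probability at least $9/10$, $$\|H-\widehat{H}\|_F\le C\|E\|_F+\epsilon\|H\|_F.$$
   Context: A matrix $A\in\mathbb{R}^{n\times n}$ is Hankel if $A_{i,j}=A_{k,l}$ whenever $i+j=k+l$ (it is constant along anti-diagonals). $\|\cdot\|_F$ denotes the Frobenius norm. The algorithm only reads entries of $H+E$ it queries; running time is measured in this query model. *)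

(* Defs.v *)
From HB Require Import structures.
From mathcomp Require Import all_boot all_order all_algebra.
From mathcomp Require Import reals exp.

Set Implicit Arguments.
Unset Strict Implicit.
Unset Printing Implicit Defensive.

Import Order.TTheory GRing.Theory Num.Theory.
Local Open Scope ring_scope.

Definition hankel (R : realType) (n : nat) (A : 'M[R]_n) : Prop :=
  forall i j k l : 'I_n, (i + j = k + l)%N -> A i j = A k l.

Definition psd (R : realType) (n : nat) (A : 'M[R]_n) : Prop :=
  A^T = A /\ forall x : 'cV[R]_n, 0 <= (x^T *m A *m x) 0 0.

Definition frob (R : realType) (n : nat) (A : 'M[R]_n) : R :=
  Num.sqrt (\sum_i \sum_j A i j ^+ 2).

(* Randomized real RAM with an entry oracle. The memory consists of natural
   number cells N[0], N[1], ... and real cells X[0], X[1], ...; the arguments of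
   the instructions are addresses. Programs contain no real constants, and
   neither integer multiplication nor rounding of reals is primitive: after t
   steps every N-cell has O(t + log(inputs and program constants)) bits, so unit
   cost is not a way to hide long computations. *)
Inductive instr : Type :=
| NConst (a c : nat)          (* N[a] := c *)
| NAdd (a b c : nat)          (* N[a] := N[b] + N[c] *)
| NSub (a b c : nat)          (* N[a] := N[b] - N[c], truncated at 0 *)
| NHalf (a b : nat)           (* N[a] := floor (N[b] / 2) *)
| NLoad (a b : nat)           (* N[a] := N[N[b]] *)
| NStore (a b : nat)          (* N[N[a]] := N[b] *)
| RNat (x a : nat)            (* X[x] := N[a] *)
| RAdd (x y z : nat)          (* X[x] := X[y] + X[z] *)
| RSub (x y z : nat)          (* X[x] := X[y] - X[z] *)
| RMul (x y z : nat)          (* X[x] := X[y] * X[z] *)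
| RDiv (x y z : nat)          (* X[x] := X[y] / X[z], 0 if X[z] = 0 *)
| RLoad (x a : nat)           (* X[x] := X[N[a]] *)
| RStore (a x : nat)          (* X[N[a]] := X[x] *)
| Query (x a b : nat)         (* X[x] := entry (N[a], N[b]) of the input *)
| Flip (a : nat).             (* N[a] := fair random bit *)

Inductive test : Type :=
| NLt (a b : nat)             (* N[a] < N[b] *)
| RLt (x y : nat).            (* X[x] < X[y] *)

Inductive cmd : Type :=
| Skip
| Do of instr
| Seq of cmd & cmd
| If of test & cmd & cmd
| While of test & cmd.

(* [coins] is the number of random bits consumed so far. *)
Record state (R : realType) : Type := State {
  nmem : nat -> nat;
  rmem : nat -> R;
  coins : nat }.

Definition upd (V : Type) (f : nat -> V) (a : nat) (v : V) : nat -> V :=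
  fun b => if b == a then v else f b.

Definition setN (R : realType) (s : state R) (a v : nat) : state R :=
  State (upd (nmem s) a v) (rmem s) (coins s).

Definition setX (R : realType) (s : state R) (x : nat) (v : R) : state R :=
  State (nmem s) (upd (rmem s) x v) (coins s).

Definition step (R : realType) (B : nat -> nat -> R) (w : nat -> bool)
    (i : instr) (s : state R) : state R :=
  let N := nmem s in
  let X := rmem s in
  match i with
  | NConst a c => setN s a c
  | NAdd a b c => setN s a (N b + N c)%N
  | NSub a b c => setN s a (N b - N c)%N
  | NHalf a b => setN s a (N b)./2
  | NLoad a b => setN s a (N (N b))
  | NStore a b => setN s (N a) (N b)
  | RNat x a => setX s x (N a)%:R
  | RAdd x y z => setX s x (X y + X z)
  | RSub x y z => setX s x (X y - X z)
  | RMul x y z => setX s x (X y * X z)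
  | RDiv x y z => setX s x (X y / X z)
  | RLoad x a => setX s x (X (N a))
  | RStore a x => setX s (N a) (X x)
  | Query x a b => setX s x (B (N a) (N b))
  | Flip a => State (upd N a (w (coins s) : nat)) X (coins s).+1
  end.

Definition holds (R : realType) (b : test) (s : state R) : bool :=
  match b with
  | NLt a b => (nmem s a < nmem s b)%N
  | RLt x y => rmem s x < rmem s y
  end.

(* [exec B w c s t s']: with input oracle [B] and coin tosses [w], command [c]
   started in [s] halts in [s'] after [t] steps. Every instruction, every query,
   every coin toss and every evaluation of a test is one step. *)
Inductive exec (R : realType) (B : nat -> nat -> R) (w : nat -> bool) :
    cmd -> state R -> nat -> state R -> Prop :=
| ExecSkip s : exec B w Skip s 1 s
| ExecDo i s : exec B w (Do i) s 1 (step B w i s)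
| ExecSeq c1 c2 s s1 s2 t1 t2 :
    exec B w c1 s t1 s1 -> exec B w c2 s1 t2 s2 ->
    exec B w (Seq c1 c2) s (t1 + t2)%N s2
| ExecIf b c1 c2 s s' t :
    exec B w (if holds b s then c1 else c2) s t s' ->
    exec B w (If b c1 c2) s t.+1 s'
| ExecWhileF b c s : ~~ holds b s -> exec B w (While b c) s 1 s
| ExecWhileT b c s s1 s2 t1 t2 :
    holds b s -> exec B w c s t1 s1 -> exec B w (While b c) s1 t2 s2 ->
    exec B w (While b c) s (t1 + t2).+1 s2.

Lemma exec_det (R : realType) (B : nat -> nat -> R) (w : nat -> bool)
    (c : cmd) (s s1 s2 : state R) (t1 t2 : nat) :
  exec B w c s t1 s1 -> exec B w c s t2 s2 -> t1 = t2 /\ s1 = s2.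
Proof.
move=> h; elim: h t2 s2 => {c s t1 s1}.
- by move=> s t s' h; inversion h.
- by move=> i s t s' h; inversion h.
- move=> c1 c2 s s1 s2 t1 t2 _ IH1 _ IH2 t s' h.
  inversion h as [| |? ? ? u1 ? v1 v2 h1 h2| | |]; subst.
  case: (IH1 _ _ h1) => e1 e2; subst.
  by case: (IH2 _ _ h2) => -> ->.
- move=> b c1 c2 s s' t _ IH t' s'' h.
  inversion h as [| | |? ? ? ? ? ? h1| |]; subst.
  by case: (IH _ _ h1) => -> ->.
- move=> b c s nb t' s' h.
  inversion h as [| | | | |? ? ? ? ? ? ? hb]; subst => //.
  by rewrite hb in nb.
- move=> b c s s1 s2 t1 t2 hb _ IH1 _ IH2 t' s' h.
  inversion h as [| | | |? ? ? nb|? ? ? u1 ? v1 v2 ? h1 h2]; subst.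
    by rewrite hb in nb.
  case: (IH1 _ _ h1) => e1 e2; subst.
  by case: (IH2 _ _ h2) => -> ->.
Qed.

Definition halts_within (R : realType) (B : nat -> nat -> R) (w : nat -> bool)
    (T : nat) (c : cmd) (s s' : state R) : Prop :=
  exists2 t : nat, (t <= T)%N & exec B w c s t s'.

Definition oracle (R : realType) (n : nat) (B : 'M[R]_n) (i j : nat) : R :=
  match insub i : option 'I_n, insub j : option 'I_n with
  | Some i', Some j' => B i' j'
  | _, _ => 0
  end.

Definition init (R : realType) (n : nat) (eps : R) : state R :=
  State (upd (fun _ => 0%N) 0%N n) (upd (fun _ => 0) 0%N eps) 0.

(* Within polylogarithmic time one cannot write down n x r factors, so a
   factored representation is implicit: the memory [s] left by the algorithm,
   with the number r of columns in N[0], such that the programs [cU] and [cV],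
   given a row index in N[1] and a column index in N[2], compute in at most [T]
   steps any entry of U and V, where A = U V^T. These programs run
   deterministically and without access to the input: every query is answered
   by 0 and every coin toss by false. *)
Definition width (R : realType) (s : state R) : nat := nmem s 0.

Definition computes_entries (R : realType) (c : cmd) (T : nat) (s : state R)
    (n r : nat) (U : 'M[R]_(n, r)) : Prop :=
  forall (i : 'I_n) (l : 'I_r), exists2 s' : state R,
    halts_within (fun _ _ => 0) (fun _ => false) T c
      (setN (setN s 1 i) 2 l) s' &
    rmem s' 0 = U i l.

Definition factored_rep (R : realType) (cU cV : cmd) (T : nat) (s : state R)
    (n : nat) (A : 'M[R]_n) : Prop :=
  exists U V : 'M[R]_(n, width s),
    [/\ A = U *m V^T, computes_entries cU T s U & computes_entries cV T s V].

(* The logarithms in O(.) and polylog(.) are shifted by 1, and log (1/eps) is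
   cut off at 0, so that the bounds are meaningful for n = 1 and eps near or
   above 1. *)
Definition log_n (R : realType) (n : nat) : R := 1 + ln n%:R.

Definition log_eps (R : realType) (eps : R) : R := 1 + Num.max 0 (ln eps^-1).

Definition polylog (R : realType) (T : nat -> R -> nat) : Prop :=
  exists (K : R) (p : nat), forall (n : nat) (eps : R), (0 < n)%N -> 0 < eps ->
    (T n eps)%:R <= K * (log_n R n * log_eps eps) ^+ p.

(* A run of at most T steps tosses at most T coins, so T uniform bits determine
   it and give its exact distribution. *)
Definition coin_prob (R : realType) (T : nat) (P : pred (T.-tuple bool)) : R :=
  #|[set w | P w]|%:R / 2 ^+ T.

(* Main.v *)
(* A positive semidefinite Hankel matrix is, up to a perturbation, a moment
   matrix: H_ij is a positive combination of terms lam^(i+j) with lam real.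
   Interpolating x |-> x^k at d points of each shell
   1 - (4/5)^j <= x <= 1 - (4/5)^(j+1) has an error bounded by a binomial
   probability, so O(log n log(1/eps)) fixed nodes x_a (with their opposites and
   inverses) span a space S of Hankel matrices that contains H up to eps |H|_F.
   It remains to project B = H + E onto S approximately from few entries. The
   Gram matrix of the nodes consists of squared geometric sums, hence the
   reproducing kernel of S is computable in polylogarithmic time, and a stochastic
   iteration (randomized Kaczmarz) contracts the expected squared distance to the
   projection P B down to the order of |B - P B|_F^2, provided entries are sampled
   in proportion to their leverage. The leverage of (i, j) is at most
   4 rank / (1 + min(i+j, 2n-2-i-j))^2, because S is invariant under shifts and the
   average leverage in an s x s window is at most rank / s^2; so it suffices to
   draw a dyadic scale and then an entry uniformly on that scale. Markov's
   inequality gives probability 9/10. *)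
Require Import Defs.
From mathcomp Require Import all_boot all_order all_algebra.
From mathcomp Require Import boolp functions reals exp.
From mathcomp Require Import spectral complex.
From mathcomp Require Import ring lra zify.

Set Implicit Arguments.
Unset Strict Implicit.
Unset Printing Implicit Defensive.

Import Order.TTheory GRing.Theory Num.Theory.
Local Open Scope ring_scope.

(** * Orthogonal projections *)

Section InnerProduct.
Variables (R : realFieldType) (I : finType).
Implicit Types (f g h : I -> R) (s : R).

Definition dot f g : R := \sum_p f p * g p.

Definition sqnorm f : R := dot f f.

Lemma dotC f g : dot f g = dot g f.
Proof. by apply: eq_bigr => p _; rewrite mulrC. Qed.

Lemma dotDr f g h : dot f (g + h) = dot f g + dot f h.
Proof. by rewrite -big_split; apply: eq_bigr => p _; rewrite mulrDr. Qed.

Lemma dotNr f g : dot f (- g) = - dot f g.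
Proof. by rewrite -sumrN; apply: eq_bigr => p _; rewrite mulrN. Qed.

Lemma dotBr f g h : dot f (g - h) = dot f g - dot f h.
Proof. by rewrite dotDr dotNr. Qed.

Lemma dotBl f g h : dot (f - g) h = dot f h - dot g h.
Proof. by rewrite dotC dotBr !(dotC h). Qed.

Lemma dotZr s f g : dot f (s \*o g) = s * dot f g.
Proof. by rewrite mulr_sumr; apply: eq_bigr => p _; rewrite mulrCA. Qed.

Lemma sqnormE f : sqnorm f = \sum_p f p ^+ 2.
Proof. by []. Qed.

Lemma sqnorm_ge0 f : 0 <= sqnorm f.
Proof. by apply: sumr_ge0 => p _; rewrite -expr2 sqr_ge0. Qed.

Lemma sqnorm_eq0 f : sqnorm f = 0 -> f = 0.
Proof.
rewrite sqnormE => /eqP; rewrite psumr_eq0 => [/allP f0|p _]; last exact: sqr_ge0.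
by apply/funext => p; apply/eqP; rewrite -sqrf_eq0; apply: f0; rewrite mem_index_enum.
Qed.

Lemma sqnormD f g : sqnorm (f + g) = sqnorm f + 2 * dot f g + sqnorm g.
Proof.
by rewrite /sqnorm /dot mulr_sumr -!big_split; apply: eq_bigr => p _; rewrite fctE /=; ring.
Qed.

Lemma sqnormZ s f : sqnorm (s \*o f) = s ^+ 2 * sqnorm f.
Proof. by rewrite /sqnorm dotZr dotC dotZr mulrA. Qed.

Lemma sqnormN f : sqnorm (- f) = sqnorm f.
Proof. by rewrite /sqnorm dotNr dotC dotNr opprK. Qed.

Lemma sqnormB f g : sqnorm (f - g) = sqnorm f - 2 * dot f g + sqnorm g.
Proof. by rewrite sqnormD sqnormN dotNr mulrN. Qed.

Lemma dot_CauchySchwarz f g : dot f g ^+ 2 <= sqnorm f * sqnorm g.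
Proof.
have [g0|gn0] := eqVneq (sqnorm g) 0.
  by rewrite g0 mulr0 (sqnorm_eq0 g0) /dot big1 ?expr0n // => p _; rewrite mulr0.
have g_gt0 : 0 < sqnorm g by rewrite lt_neqAle eq_sym gn0 sqnorm_ge0.
have := sqnorm_ge0 ((sqnorm g \*o f) - (dot f g \*o g)).
rewrite sqnormB !sqnormZ dotZr (dotC (_ \*o _)) dotZr (dotC g).
set a := sqnorm f; set b := dot f g; set c := sqnorm g => ge0.
by rewrite -subr_ge0 -(pmulr_rge0 _ g_gt0) -/c; move: ge0; congr (_ <= _); ring.
Qed.

End InnerProduct.

Section GramSchmidt.
Variables (F : fieldType) (r : nat) (G : nat -> nat -> F).

(* With [K] the coefficients of the orthogonal projection onto the span of
   u_0, ..., u_(l-1), the vector u_l minus its projection is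
   [\sum_a gs_coef K l a * u_a], and [gs_sqnorm K l] is its squared norm. *)
Definition gs_coef (K : nat -> nat -> F) (l a : nat) : F :=
  (a == l)%:R - \sum_(b < r) K a b * G b l.

Definition gs_sqnorm (K : nat -> nat -> F) (l : nat) : F :=
  \sum_(a < r) gs_coef K l a * G a l.

(* A vector that depends on its predecessors has [gs_sqnorm = 0] and contributes
   nothing, since [x / 0 = 0]. *)
Fixpoint gram_kernel (l : nat) : nat -> nat -> F :=
  if l is l'.+1 then
    let K := gram_kernel l' in
    fun a b => K a b + gs_coef K l' a * gs_coef K l' b / gs_sqnorm K l'
  else fun _ _ => 0.

Lemma gram_kernelC l a b : gram_kernel l a b = gram_kernel l b a.
Proof. by elim: l a b => //= l IH a b; rewrite IH [X in _ + X / _]mulrC. Qed.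

Lemma gram_kernel_eq0 l a b : (l <= a)%N -> gram_kernel l a b = 0.
Proof.
elim: l a b => //= l IH a b la.
rewrite IH 1?ltnW // {1}/gs_coef gtn_eqF // big1 => [|c _]; last by rewrite IH 1?ltnW ?mul0r.
by rewrite subrr !mul0r addr0.
Qed.

End GramSchmidt.

Lemma eq_gram_kernel (F : fieldType) (r : nat) (G G' : nat -> nat -> F) (l : nat) :
  (l <= r)%N -> (forall a b, (a < r)%N -> (b < r)%N -> G a b = G' a b) ->
  forall a b, (a < r)%N -> (b < r)%N -> gram_kernel r G l a b = gram_kernel r G' l a b.
Proof.
move=> lr eqG; elim: l lr => [|l IH] lr a b ar br //=.
have {}IH := IH (ltnW lr).
have eq_coef c : (c < r)%N ->
    gs_coef r G (gram_kernel r G l) l c = gs_coef r G' (gram_kernel r G' l) l c.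
  by move=> cr; congr (_ - _); apply: eq_bigr => b' _; rewrite IH ?eqG.
rewrite IH // !eq_coef //; congr (_ + _ / _).
by apply: eq_bigr => c _; rewrite eq_coef ?eqG.
Qed.

Section Projection.
Variables (R : realFieldType) (I : finType) (r : nat) (u : nat -> I -> R).
Implicit Types (f g : I -> R) (c : nat -> R) (p q : I) (l a : nat).

Definition lincomb c p : R := \sum_(a < r) c a * u a p.

Lemma dot_lincombr c f : dot f (lincomb c) = \sum_(a < r) c a * dot f (u a).
Proof.
rewrite /dot; under eq_bigr => p _ do rewrite mulr_sumr.
rewrite exchange_big; apply: eq_bigr => a _; rewrite mulr_sumr.
by apply: eq_bigr => p _; rewrite mulrCA.
Qed.

Definition gram a b : R := dot (u a) (u b).

Definition kernel l p q : R :=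
  \sum_(a < r) \sum_(b < r) gram_kernel r gram l a b * u a p * u b q.

Definition kernel_op l f p : R := dot (kernel l p) f.

Lemma kernelC l p q : kernel l p q = kernel l q p.
Proof.
rewrite /kernel exchange_big; apply: eq_bigr => a _; apply: eq_bigr => b _.
by rewrite gram_kernelC mulrAC.
Qed.

Lemma dot_kernel_op l f g : dot (kernel_op l f) g = dot f (kernel_op l g).
Proof.
rewrite /dot; under eq_bigr => p _ do rewrite mulr_suml.
rewrite exchange_big; apply: eq_bigr => q _; rewrite mulr_sumr.
by apply: eq_bigr => p _; rewrite kernelC mulrCA mulrA.
Qed.

Definition kernel_op_coef l f a : R := \sum_(b < r) gram_kernel r gram l a b * dot (u b) f.

Lemma kernel_opE l f : kernel_op l f = lincomb (kernel_op_coef l f).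
Proof.
apply/funext => p; rewrite /kernel_op /dot /kernel /lincomb.
under eq_bigr => q _ do rewrite mulr_suml.
rewrite exchange_big; apply: eq_bigr => a _; under eq_bigr => q _ do rewrite mulr_suml.
rewrite exchange_big /= mulr_suml; apply: eq_bigr => b _.
by rewrite mulr_sumr mulr_suml; apply: eq_bigr => q _; ring.
Qed.

Let coef l := gs_coef r gram (gram_kernel r gram l) l.

Definition gs_vector l : I -> R := lincomb (coef l).

Lemma gs_vectorE l : (l < r)%N -> gs_vector l = u l - kernel_op l (u l).
Proof.
move=> lr; apply/funext => p; rewrite kernel_opE fctE /gs_vector /lincomb.
under eq_bigr => a _ do rewrite mulrBl.
rewrite sumrB; congr (_ - _).
rewrite (bigD1 (Ordinal lr)) //= eqxx mul1r big1 ?addr0 // => a.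
by rewrite -val_eqE /= => /negPf ->; rewrite mul0r.
Qed.

Lemma gs_sqnormE l : gs_sqnorm r gram (gram_kernel r gram l) l = dot (gs_vector l) (u l).
Proof. by rewrite dotC dot_lincombr; apply: eq_bigr => a _; rewrite (dotC (u l)). Qed.

Lemma kernelS l p q : kernel l.+1 p q =
  kernel l p q + gs_vector l p * gs_vector l q / dot (gs_vector l) (u l).
Proof.
rewrite -gs_sqnormE /kernel /gs_vector /lincomb !mulr_suml -big_split; apply: eq_bigr => a _.
by rewrite mulr_sumr mulr_suml -big_split; apply: eq_bigr => b _ /=; rewrite /coef; ring.
Qed.

Lemma kernel_opS l f : kernel_op l.+1 f =
  kernel_op l f + (dot (gs_vector l) f / dot (gs_vector l) (u l)) \*o gs_vector l.
Proof.
apply/funext => p; rewrite fctE /= {2}/dot !mulr_suml -big_split; apply: eq_bigr => q _ /=.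
by rewrite kernelS; ring.
Qed.

Definition reproducing l := forall a, (a < l)%N -> kernel_op l (u a) = u a.

Lemma dot_gs_vector l a : (l < r)%N -> reproducing l -> (a < l)%N -> dot (gs_vector l) (u a) = 0.
Proof. by move=> lr rep al; rewrite gs_vectorE // dotBl dot_kernel_op rep ?subrr. Qed.

Lemma sqnorm_gs_vector l : (l < r)%N -> reproducing l ->
  sqnorm (gs_vector l) = dot (gs_vector l) (u l).
Proof.
move=> lr rep; rewrite /sqnorm {2}gs_vectorE // dotBr kernel_opE dot_lincombr.
rewrite big1 ?subr0 // => a _; have [al|la] := ltnP a l.
  by rewrite dot_gs_vector ?mulr0.
by rewrite /kernel_op_coef big1 ?mul0r // => b _; rewrite gram_kernel_eq0 ?mul0r.
Qed.

Lemma kernel_reproducing l : (l <= r)%N -> reproducing l.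
Proof.
elim: l => [|l IH] lr a; first by rewrite ltn0.
have rep := IH (ltnW lr).
rewrite kernel_opS ltnS leq_eqVlt => /orP[/eqP ->|al]; last first.
  by rewrite rep // dot_gs_vector // mul0r; apply/funext => p; rewrite fctE /= mul0r addr0.
have [v0|vn0] := eqVneq (dot (gs_vector l) (u l)) 0.
  have gs0 : gs_vector l = 0 by apply: sqnorm_eq0; rewrite sqnorm_gs_vector.
  have -> : kernel_op l (u l) = u l by apply/esym/eqP; rewrite -subr_eq0 -gs_vectorE // gs0.
  by apply/funext => p; rewrite v0 mul0r fctE /= mul0r addr0.
apply/funext => p; rewrite fctE /= divff // mul1r gs_vectorE // fctE.
by rewrite addrC subrK.
Qed.

Lemma kernel_trace l : (l <= r)%N -> \sum_p kernel l p p <= l%:R.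
Proof.
elim: l => [|l IH] lr.
  rewrite big1 // => p _; rewrite /kernel big1 // => a _; rewrite big1 // => b _.
  by rewrite !mul0r.
under eq_bigr => p _ do rewrite kernelS.
rewrite big_split /= -natr1; apply: lerD; first exact: IH (ltnW lr).
rewrite -mulr_suml -/(dot _ _) -/(sqnorm _) sqnorm_gs_vector //; last first.
  exact: kernel_reproducing (ltnW lr).
by have [->|n0] := eqVneq (dot (gs_vector l) (u l)) 0; rewrite ?mul0r ?divff.
Qed.

Definition rkernel : I -> I -> R := kernel r.

Definition proj : (I -> R) -> I -> R := kernel_op r.

Definition proj_coef : (I -> R) -> nat -> R := kernel_op_coef r.

Lemma projE f : proj f = lincomb (proj_coef f).
Proof. exact: kernel_opE. Qed.

Lemma proj_lincomb c : proj (lincomb c) = lincomb c.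
Proof.
apply/funext => p; rewrite /proj /kernel_op dot_lincombr; apply: eq_bigr => a _.
by rewrite -[dot _ _]/(kernel_op r (u a) p) kernel_reproducing.
Qed.

Lemma proj_proj f : proj (proj f) = proj f.
Proof. by rewrite (projE f) proj_lincomb. Qed.

Lemma dot_proj f g : dot (proj f) g = dot f (proj g).
Proof. exact: dot_kernel_op. Qed.

Lemma projD f g : proj (f + g) = proj f + proj g.
Proof. by apply/funext => p; exact: dotDr. Qed.

Lemma projB f g : proj (f - g) = proj f - proj g.
Proof. by apply/funext => p; exact: dotBr. Qed.

Lemma projZ s f : proj (s \*o f) = s \*o proj f.
Proof. by apply/funext => p; exact: dotZr. Qed.

Lemma sqnorm_projB f : sqnorm (f - proj f) = sqnorm f - sqnorm (proj f).
Proof. by rewrite sqnormB -[in dot _ _]proj_proj -dot_proj -/(sqnorm _); ring. Qed.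

Lemma sqnorm_proj_le f : sqnorm (proj f) <= sqnorm f.
Proof. by rewrite -subr_ge0 -sqnorm_projB sqnorm_ge0. Qed.

Lemma sqnorm_projB_le f : sqnorm (f - proj f) <= sqnorm f.
Proof. by rewrite sqnorm_projB lerBlDr lerDl sqnorm_ge0. Qed.

Lemma sqnorm_projB_lincomb_le f c : sqnorm (f - proj f) <= sqnorm (f - lincomb c).
Proof.
apply: le_trans (sqnorm_projB_le _); rewrite projB proj_lincomb.
by rewrite opprB addrA subrK.
Qed.

Lemma rkernelE p : rkernel p = lincomb (fun a => \sum_(b < r) gram_kernel r gram r a b * u b p).
Proof.
apply/funext => q; rewrite /rkernel kernelC /kernel; apply: eq_bigr => a _; rewrite mulr_suml.
by apply: eq_bigr => b _; rewrite mulrAC.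
Qed.

Lemma sqnorm_rkernel p : sqnorm (rkernel p) = rkernel p p.
Proof. by rewrite -[LHS]/(proj (rkernel p) p) {1}rkernelE proj_lincomb -rkernelE. Qed.

Lemma rkernel_ge0 p : 0 <= rkernel p p.
Proof. by rewrite -sqnorm_rkernel sqnorm_ge0. Qed.

Lemma sqr_lincomb_le c p : lincomb c p ^+ 2 <= rkernel p p * sqnorm (lincomb c).
Proof. by rewrite -{1}proj_lincomb -sqnorm_rkernel dot_CauchySchwarz. Qed.

Lemma rkernel_trace : \sum_p rkernel p p <= r%:R.
Proof. exact: kernel_trace. Qed.

Lemma rkernel_le_average : (0 < #|I|)%N -> exists p, #|I|%:R * rkernel p p <= r%:R.
Proof.
move=> I0; apply/existsP; rewrite -[X in is_true X]negbK negb_exists; apply/negP => /forallP gt_r.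
have /card_gt0P[p0 _] := I0.
have : \sum_(p : I) r%:R < \sum_p #|I|%:R * rkernel p p.
  apply: ltr_sum => [|p _]; last by rewrite ltNge.
  by apply/hasP; exists p0; rewrite ?mem_index_enum.
rewrite sumr_const -[ltLHS]mulr_natl -mulr_sumr ltr_pM2l ?ltr0n //.
by rewrite ltNge rkernel_trace.
Qed.

End Projection.

(** * Leverage of exponential sums *)

Section NonnegativeSums.
Variables (R : numDomainType) (I J : finType) (h : I -> J) (F : J -> R).
Hypothesis F_ge0 : forall q, 0 <= F q.

Lemma ler_sum_fiber (m : nat) :
  (forall q, #|[set p | h p == q]| <= m)%N -> \sum_p F (h p) <= m%:R * \sum_q F q.
Proof.
move=> fiber_le; rewrite (partition_big h predT) //= mulr_sumr.
apply: ler_sum => q _; rewrite (eq_bigr (fun=> F q)) => [|p /eqP -> //].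
rewrite sumr_const -[leLHS]mulr_natl ler_wpM2r // ler_nat.
by apply: leq_trans (fiber_le q); apply/eq_leq/eq_card => p; rewrite !inE.
Qed.

Lemma ler_sum_inj : injective h -> \sum_p F (h p) <= \sum_q F q.
Proof.
move=> h_inj; rewrite -[leRHS]mul1r; apply: (@ler_sum_fiber 1) => q.
by apply/card_le1_eqP => p p'; rewrite !inE => /eqP <- /eqP /h_inj ->.
Qed.

End NonnegativeSums.

Section ExponentialSums.
Variable R : realFieldType.
Implicit Types (x c : nat -> R) (n r s k : nat).

Definition degree n (p : 'I_n * 'I_n) : nat := (p.1 + p.2)%N.

Definition expfun n x a (p : 'I_n * 'I_n) : R := x a ^+ degree p.

Definition expsum r x c k : R := \sum_(a < r) c a * x a ^+ k.

Lemma lincomb_expfun n r x c : lincomb r (@expfun n x) c = expsum r x c \o @degree n.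
Proof. by []. Qed.

Lemma sum_subwindow_le n s (alpha beta : nat) (F : nat -> R) :
  (forall k, 0 <= F k) -> (alpha + s <= n)%N -> (beta + s <= n)%N ->
  \sum_(q : 'I_s * 'I_s) F (alpha + beta + degree q)%N <= \sum_(p : 'I_n * 'I_n) F (degree p).
Proof.
move=> F_ge0 alpha_le beta_le.
have row_lt (i : 'I_s) : (alpha + i < n)%N by have := ltn_ord i; lia.
have col_lt (j : 'I_s) : (beta + j < n)%N by have := ltn_ord j; lia.
pose h (q : 'I_s * 'I_s) := (Ordinal (row_lt q.1), Ordinal (col_lt q.2)).
rewrite (eq_bigr (fun q => F (degree (h q)))) => [|q _]; last first.
  by congr F; rewrite /degree /=; lia.
apply: (ler_sum_inj (h := h) (F := fun p => F (degree p))) => [q //|[i j] [i' j']] [].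
by move=> /eqP; rewrite eqn_add2l => /eqP /val_inj -> /eqP; rewrite eqn_add2l => /eqP /val_inj ->.
Qed.

(* The span of the exponentials is invariant under shifts, so the s x s window
   can be placed such that k falls on a position of at most average leverage. *)
Lemma sqr_expsum_le n s k r x c :
  (0 < s <= n)%N -> (2 * s.-1 <= k <= 2 * (n - s))%N ->
  (s ^ 2)%:R * expsum r x c k ^+ 2 <= r%:R * sqnorm (lincomb r (@expfun n x) c).
Proof.
move=> /andP[s_gt0 sn] /andP[sk kn].
have card_window : #|{: 'I_s * 'I_s}| = (s ^ 2)%N by rewrite card_prod card_ord.
have [|[i0 j0]] := @rkernel_le_average R _ r (@expfun s x).
  by rewrite card_window expn_gt0 s_gt0.
rewrite card_window => leverage_le.
have i0_lt := ltn_ord i0; have j0_lt := ltn_ord j0; set q0 := (i0, j0) in leverage_le *.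
pose e := (k - degree q0)%N; pose alpha := minn e (n - s); pose beta := (e - alpha)%N.
have eE : (e + degree q0 = k)%N by rewrite /e /degree /=; lia.
pose c' a := c a * x a ^+ e.
have shiftE k' : expsum r x c' k' = expsum r x c (e + k').
  by apply: eq_bigr => a _; rewrite /c' -mulrA -exprD.
have := sqr_lincomb_le r (@expfun s x) c' q0; rewrite lincomb_expfun /= shiftE eE.
move=> /(ler_wpM2l (ler0n R (s ^ 2))) /le_trans; apply; rewrite mulrA.
apply: le_trans (_ : _ <= r%:R * sqnorm (expsum r x c' \o @degree s)) _.
  by rewrite ler_wpM2r ?sqnorm_ge0.
rewrite ler_wpM2l // !sqnormE.
rewrite (eq_bigr (fun q => expsum r x c (alpha + beta + degree q) ^+ 2)) => [|q _]; last first.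
  by rewrite /= shiftE /beta /alpha; congr (expsum _ _ _ _ ^+ 2); lia.
apply: (sum_subwindow_le (F := fun k => expsum r x c k ^+ 2)) => [k'||]; first exact: sqr_ge0.
  by rewrite /alpha; lia.
by rewrite /beta /alpha; lia.
Qed.

Definition depth n k : nat := (minn k (2 * n - 2 - k)).+1.

Lemma rkernel_expfun_le n r x (p : 'I_n * 'I_n) :
  rkernel r (@expfun n x) p p * (depth n (degree p))%:R ^+ 2 <= 4 * r%:R.
Proof.
set tau := rkernel _ _ p p; set k := degree p.
have i_lt := ltn_ord p.1; have j_lt := ltn_ord p.2.
have tau_ge0 : 0 <= tau by exact: rkernel_ge0.
have [-> |tau_neq0] := eqVneq tau 0; first by rewrite mul0r mulr_ge0.
have tau_gt0 : 0 < tau by rewrite lt_neqAle eq_sym tau_neq0.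
pose s := (minn k (2 * n - 2 - k))./2.+1.
have [c kernE] : exists c, rkernel r (@expfun n x) p = lincomb r (@expfun n x) c.
  by eexists; exact: rkernelE.
have : (s ^ 2)%:R * expsum r x c k ^+ 2 <= r%:R * sqnorm (lincomb r (@expfun n x) c).
  by apply: sqr_expsum_le; rewrite /s /k /degree; lia.
have -> : expsum r x c k = tau by rewrite /tau kernE.
rewrite -kernE sqnorm_rkernel -/tau expr2 mulrA ler_pM2r // => window_le.
have depth_le : ((depth n k)%:R : R) ^+ 2 <= 4 * (s ^ 2)%:R.
  rewrite -natrX -[4]/(4%:R) -natrM ler_nat (_ : 4 * s ^ 2 = (2 * s) ^ 2)%N; last by rewrite expnMn.
  by rewrite leq_exp2r // /depth /s; lia.
apply: le_trans (ler_wpM2l tau_ge0 depth_le) _.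
by rewrite mulrCA (mulrC tau) ler_wpM2l.
Qed.

End ExponentialSums.

(** * Coin tosses and sampling *)

Section BitAverages.
Variable R : numFieldType.
Implicit Types (F G : seq bool -> R) (g : nat -> bool) (s t : seq bool) (a b c m : nat).

Fixpoint avg m F : R :=
  if m is m'.+1 then (avg m' (fun s => F (false :: s)) + avg m' (fun s => F (true :: s))) / 2
  else F [::].

Lemma eq_avg m F G : (forall s, size s = m -> F s = G s) -> avg m F = avg m G.
Proof.
elim: m F G => [|m IH] F G eqFG /=; first exact: eqFG.
by congr ((_ + _) / 2); apply: IH => s sz; apply: eqFG; rewrite /= sz.
Qed.

Lemma ler_avg m F G : (forall s, size s = m -> F s <= G s) -> avg m F <= avg m G.
Proof.
elim: m F G => [|m IH] F G leFG /=; first exact: leFG.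
rewrite ler_pM2r ?invr_gt0 ?ltr0n //.
by apply: lerD; apply: IH => s sz; apply: leFG; rewrite /= sz.
Qed.

Lemma avg_cat a b F : avg (a + b) F = avg a (fun s => avg b (fun t => F (s ++ t))).
Proof. by elim: a F => //= a IH F; rewrite !IH. Qed.

Lemma avgD m F G : avg m (fun s => F s + G s) = avg m F + avg m G.
Proof. by elim: m F G => //= m IH F G; rewrite !IH; field. Qed.

Lemma avgZ m (x : R) F : avg m (fun s => x * F s) = x * avg m F.
Proof. by elim: m F => //= m IH F; rewrite !IH; field. Qed.

Lemma avg_const m (x : R) : avg m (fun=> x) = x.
Proof. by elim: m => //= m IH; rewrite !IH; field. Qed.

Lemma avg_prefix a b F : (forall s t, size s = a -> F (s ++ t) = F s) -> avg (a + b) F = avg a F.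
Proof.
move=> prefixF; rewrite avg_cat; apply: eq_avg => s sz.
by rewrite (eq_avg (G := fun=> F s)) ?avg_const // => t _; exact: prefixF.
Qed.

Lemma avg_tuple m F : avg m F = (\sum_(w : m.-tuple bool) F w) / 2 ^+ m.
Proof.
elim: m F => [|m IH] F.
  rewrite expr0 divr1 (bigD1 [tuple]) //= big1 ?addr0 // => w /eqP[].
  exact: tuple0.
rewrite /= !IH -mulrDl -mulrA -invfM -exprSr; congr (_ / _).
pose cons_pair (p : bool * m.-tuple bool) : m.+1.-tuple bool := [tuple of p.1 :: p.2].
rewrite (reindex cons_pair) /=; last first.
  exists (fun w : m.+1.-tuple bool => (thead w, [tuple of behead w])) => [[x w] _|w _].
    by rewrite /cons_pair /=; congr (_, _); exact: val_inj.
  by rewrite [RHS]tuple_eta; exact: val_inj.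
by rewrite -(pair_bigA _ (fun (x : bool) (w : m.-tuple bool) => F (x :: w))) big_bool addrC.
Qed.

Fixpoint bits_val c g : nat :=
  if c is c'.+1 then (bits_val c' g + bits_val c' g + g c')%N else 0%N.

Lemma eq_bits_val c g g' : (forall k, (k < c)%N -> g k = g' k) -> bits_val c g = bits_val c g'.
Proof.
elim: c => //= c IH eqg; rewrite IH => [|k kc]; first by rewrite eqg.
by apply: eqg; rewrite ltnW.
Qed.

Lemma bits_val_cat c s t : (c <= size s)%N ->
  bits_val c (nth false (s ++ t)) = bits_val c (nth false s).
Proof.
by move=> cs; apply: eq_bits_val => k kc; rewrite nth_cat (leq_trans kc cs).
Qed.

Lemma sum_even_odd n (f : nat -> R) :
  \sum_(v < n + n) f v = \sum_(v < n) (f (v + v)%N + f (v + v + 1)%N).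
Proof.
elim: n => [|n IH]; first by rewrite !big_ord0.
by rewrite addnS addSn !big_ord_recr /= IH -addrA addn1.
Qed.

Lemma avg_bits_val c b (f : nat -> R) : (c <= b)%N ->
  avg b (fun s => f (bits_val c (nth false s))) = (\sum_(v < 2 ^ c) f v) / 2 ^+ c.
Proof.
move=> /subnKC <-; rewrite avg_prefix => [|s t sz]; last by rewrite bits_val_cat ?sz.
elim: c f => [|c IH] f; first by rewrite big_ord_recl big_ord0 addr0 divr1.
pose f2 v := (f (v + v)%N + f (v + v + 1)%N) / 2.
rewrite -{1}addn1 avg_cat (eq_avg (G := fun s => f2 (bits_val c (nth false s)))) => [|s sz].
  by rewrite IH expnS mul2n -addnn sum_even_odd -mulr_suml exprSr invfM mulrAC mulrA.
rewrite /= !nth_cat sz ltnn subnn /= !bits_val_cat ?sz // !addn0.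
by [].
Qed.

Definition skip a g k : bool := g (a + k)%N.

Lemma skip_cat a s t : size s = a -> skip a (nth false (s ++ t)) = nth false t.
Proof. by move=> <-; apply/funext => k; rewrite /skip nth_cat ltnNge leq_addr addKn. Qed.

Lemma skipD a b g : skip (a + b) g = skip b (skip a g).
Proof. by apply/funext => k; rewrite /skip addnA. Qed.

End BitAverages.

Section Sampling.
Variables (n L Lam : nat).
Implicit Types (g : nat -> bool) (m i j : nat) (side : bool).

Definition draw c g : nat := bits_val (minn c L) g.

Definition draw_scale g : nat := draw Lam g.
Definition draw_row m g : nat := draw m (skip L g).
Definition draw_col m g : nat := draw m (skip (L + L) g).
Definition draw_side g : bool := skip (L + L + L) g 0.

Definition sample_bits : nat := (L + (L + (L + 1)))%N.

Definition near_corner side i j : bool := (i + j + 1 + side <= n)%N.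

(* Scale m is responsible for the antidiagonals k with 2^(m-1) <= k < 2^m,
   counted from the corner that [side] selects. *)
Definition accept m i j side : bool :=
  [&& (m <= L)%N, (i + j < 2 ^ m)%N, (2 ^ m < 2 * (i + j + 1))%N & near_corner side i j].

Definition mirror side i : nat := if side then (n - 1 - i)%N else i.

Definition sampled (T : Type) g (F : nat -> nat -> nat -> T) (z : T) : T :=
  let m := draw_scale g in
  let i := draw_row m g in
  let j := draw_col m g in
  let side := draw_side g in
  if accept m i j side then F m (mirror side i) (mirror side j) else z.

Lemma mirror_lt side i j : near_corner side i j -> (mirror side i < n)%N /\ (mirror side j < n)%N.
Proof. by rewrite /near_corner /mirror; case: side => /=; lia. Qed.

Lemma eq_sampled (T : Type) g g' (F : nat -> nat -> nat -> T) z :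
  (forall k, (k < sample_bits)%N -> g k = g' k) -> sampled g F z = sampled g' F z.
Proof.
rewrite /sample_bits => eqg; rewrite /sampled.
have eq_scale : draw_scale g = draw_scale g'.
  by apply: eq_bits_val => k; rewrite leq_min => /andP[_ kL]; apply: eqg; lia.
have eq_row m : draw_row m g = draw_row m g'.
  by apply: eq_bits_val => k; rewrite leq_min => /andP[_ kL]; apply: eqg; lia.
have eq_col m : draw_col m g = draw_col m g'.
  by apply: eq_bits_val => k; rewrite leq_min => /andP[_ kL]; apply: eqg; lia.
have -> : draw_side g = draw_side g' by apply: eqg; lia.
by rewrite eq_scale !eq_row !eq_col.
Qed.

End Sampling.

Section AverageSample.
Variables (R : numFieldType) (n L Lam : nat).
Hypotheses (Lam_le : (Lam <= L)%N) (L_lt : (L < 2 ^ Lam)%N) (n_le : (n <= 2 ^ L)%N).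

Lemma avg_draw c (f : nat -> R) :
  avg L (fun s => f (draw L c (nth false s))) = (\sum_(v < 2 ^ minn c L) f v) / 2 ^+ minn c L.
Proof. by rewrite avg_bits_val // geq_minr. Qed.

Lemma avg_sample (F : nat -> nat -> nat -> bool -> R) :
  (forall m i j side, (L < m)%N -> F m i j side = 0) ->
  avg (sample_bits L) (fun s => let g := nth false s in let m := draw_scale L Lam g in
     F m (draw_row L m g) (draw_col L m g) (draw_side L g)) =
  (\sum_(m < 2 ^ Lam) (\sum_(i < 2 ^ m) \sum_(j < 2 ^ m) (F m i j false + F m i j true)) / 4 ^+ m)
    / (2 * 2 ^+ Lam).
Proof.
move=> F0.
pose F1 m := (\sum_(i < 2 ^ m) \sum_(j < 2 ^ m) (F m i j false + F m i j true)) / 4 ^+ m / 2.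
pose F2 m i := (\sum_(j < 2 ^ m) (F m i j false + F m i j true)) / 2 ^+ m / 2.
pose F3 m i j := (F m i j false + F m i j true) / 2.
have F1_large m : (L < m)%N -> F1 m = 0.
  by move=> Lm; rewrite /F1 big1 ?mul0r // => i _; rewrite big1 // => j _; rewrite !F0 ?addr0.
rewrite avg_cat (eq_avg (G := fun s => F1 (draw_scale L Lam (nth false s)))) => [|s s_sz].
  by rewrite avg_draw (minn_idPl Lam_le) /F1 -mulr_suml invfM mulrA.
have scaleE t : draw_scale L Lam (nth false (s ++ t)) = draw_scale L Lam (nth false s).
  by rewrite /draw_scale /draw bits_val_cat // s_sz geq_minr.
set m := draw_scale _ _ (nth false s) in scaleE *.
under [in LHS]eq_avg do rewrite /= scaleE.
have [mL|Lm] := leqP m L; last first.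
  by rewrite F1_large // (eq_avg (G := fun=> 0)) ?avg_const // => t _; rewrite F0.
rewrite avg_cat (eq_avg (G := fun t => F2 m (draw L m (nth false t)))) => [|t t_sz].
  rewrite avg_draw (minn_idPl mL) /F2 /F1 -!mulr_suml (_ : 4 = 2 * 2); last by ring.
  by rewrite exprMn invfM; ring.
rewrite avg_cat (eq_avg (G := fun v => F3 m (draw L m (nth false t)) (draw L m (nth false v)))).
  by rewrite avg_draw (minn_idPl mL) /F3 -!mulr_suml mulrAC.
move=> v v_sz /=; rewrite /draw_row /draw_col /draw_side.
have bits_cat w w' : size w = L -> draw L m (nth false (w ++ w')) = draw L m (nth false w).
  by move=> w_sz; rewrite /draw bits_val_cat // w_sz geq_minr.
by rewrite !skipD !skip_cat // !bits_cat.
Qed.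

Lemma dyadic_scaleE k m : (0 < k)%N -> (k <= 2 ^ m)%N && (2 ^ m < 2 * k)%N = (m == up_log 2 k).
Proof.
move=> k0; apply/andP/eqP => [[k_le k_gt]|->].
  apply/eqP; rewrite eqn_leq (up_log_min _ k_le) // andbT leqNgt; apply/negP => log_lt.
  have : (2 * 2 ^ up_log 2 k <= 2 ^ m)%N by rewrite -expnS leq_pexp2l.
  by have := up_logP k (isT : 1 < 2)%N; lia.
split; first exact: up_logP.
have [k1|k_gt1] := leqP k 1; first by have -> : k = 1%N by lia.
have := up_log_gtn (isT : 1 < 2)%N k_gt1; rewrite -(ltn_pmul2l (isT : 0 < 2)%N) -expnS prednK //.
by rewrite up_log_gt0.
Qed.

Lemma sum_square_widen k N (P : nat -> nat -> bool) (h : nat -> nat -> R) :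
  (k <= N)%N -> (forall i j, P i j -> (i < k)%N && (j < k)%N) ->
  \sum_(i < k) \sum_(j < k | P i j) h i j = \sum_(i < N) \sum_(j < N | P i j) h i j.
Proof.
move=> kN P_lt.
rewrite (big_ord_widen N (fun i => \sum_(j < k | P i j) h i j) kN) big_mkcond.
apply: eq_bigr => i _.
case: ltnP => [ik|ki]; last first.
  by rewrite big1 // => j /P_lt /andP[]; rewrite ltnNge ki.
rewrite (big_ord_widen_cond N (P i) (h i) kN); apply: eq_bigl => j.
by apply: andb_idr => /P_lt /andP[].
Qed.

Lemma sum_scales side (h : nat -> nat -> R) :
  \sum_(m < L.+1) \sum_(i < 2 ^ m) \sum_(j < 2 ^ m | accept n L m i j side) h i j =
  \sum_(i < n) \sum_(j < n | near_corner n side i j) h i j.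
Proof.
under eq_bigr => m _.
  rewrite (@sum_square_widen _ (2 ^ L) (fun i j => accept n L m i j side)); last first.
  - by move=> i j /and4P[_ ij _ _]; lia.
  - by rewrite leq_pexp2l // -ltnS.
  over.
rewrite exchange_big [RHS](@sum_square_widen _ (2 ^ L) (near_corner n side)) //; last first.
  by rewrite /near_corner => i j; lia.
apply: eq_bigr => i _; rewrite (exchange_big_dep xpredT) //= [RHS]big_mkcond; apply: eq_bigr => j _.
case: ifP => [near|far]; last by rewrite big1 // => m; rewrite /accept far !andbF.
have log_lt : (up_log 2 (i + j + 1) < L.+1)%N.
  by rewrite ltnS up_log_min //; move: near n_le; rewrite /near_corner; lia.
rewrite (big_pred1 (Ordinal log_lt)) // => m.
by rewrite /= -val_eqE /= -dyadic_scaleE ?addn1 // /accept near andbT -ltnS ltn_ord /= addn1.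
Qed.

Lemma sum_mirror (h : nat -> nat -> R) :
  \sum_(i < n) \sum_(j < n | near_corner n true i j) h (mirror n true i) (mirror n true j) =
  \sum_(i < n) \sum_(j < n | ~~ near_corner n false i j) h i j.
Proof.
rewrite (reindex_inj rev_ord_inj); apply: eq_bigr => i _.
rewrite (reindex_inj rev_ord_inj); apply: eq_big => [j|j _].
  by have := ltn_ord i; have := ltn_ord j; rewrite /near_corner /=; lia.
by have i_lt := ltn_ord i; have j_lt := ltn_ord j; rewrite /mirror /=; congr (h _ _); lia.
Qed.

Lemma avg_sampled (h : nat -> nat -> R) :
  avg (sample_bits L) (fun s => sampled n L Lam (nth false s) (fun m i j => 4 ^+ m * h i j) 0) =
  (\sum_(i < n) \sum_(j < n) h i j) / (2 * 2 ^+ Lam).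
Proof.
pose F m i j side :=
  if accept n L m i j side then 4 ^+ m * h (mirror n side i) (mirror n side j) else 0.
have F0 m i j side : (L < m)%N -> F m i j side = 0 by move=> Lm; rewrite /F /accept leqNgt Lm.
rewrite [LHS](avg_sample F0); congr (_ / _).
pose S side m := \sum_(i < 2 ^ m) \sum_(j < 2 ^ m | accept n L m i j side)
  h (mirror n side i) (mirror n side j).
have S0 side m : (L < m)%N -> S side m = 0.
  by move=> Lm; rewrite /S big1 // => i _; rewrite big_pred0 // => j; rewrite /accept leqNgt Lm.
have unweight m : (\sum_(i < 2 ^ m) \sum_(j < 2 ^ m) (F m i j false + F m i j true)) / 4 ^+ m =
    S false m + S true m.
  have pow_neq0 : 4 ^+ m != 0 :> R by rewrite expf_neq0 // pnatr_eq0.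
  rewrite /S -big_split mulr_suml; apply: eq_bigr => i _ /=.
  rewrite [X in _ = X + _]big_mkcond [X in _ = _ + X]big_mkcond -big_split mulr_suml.
  apply: eq_bigr => j _; rewrite /F mulrDl.
  by congr (_ + _); case: ifP => _; rewrite ?mul0r // mulrAC divff ?mul1r.
under eq_bigr => m _ do rewrite unweight.
rewrite -(subnKC L_lt) big_split_ord /= [X in _ + X]big1 ?addr0 => [|m _]; last first.
  by rewrite !S0 ?addr0 // leq_addr.
rewrite big_split /= (sum_scales false).
rewrite (sum_scales true (fun i j => h (mirror n true i) (mirror n true j))) sum_mirror.
rewrite -big_split; apply: eq_bigr => i _.
by rewrite [RHS](bigID (fun j : 'I_n => near_corner n false i j)).
Qed.

End AverageSample.

Section Markov.
Variables (R : realType) (T : nat).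

Lemma coin_prob_markov (F : seq bool -> R) (A : R) :
  (forall s, 0 <= F s) -> avg T F <= A ->
  9 / 10 <= coin_prob R (fun w : T.-tuple bool => F w <= 10 * A).
Proof.
move=> F_ge0; rewrite avg_tuple /coin_prob.
have pow_gt0 : 0 < 2 ^+ T :> R by rewrite exprn_gt0.
rewrite ler_pdivrMr // => sum_le; rewrite ler_pdivlMr //.
set good := [set w | _].
have goodE : #|good|%:R = (2 ^ T)%:R - #|~: good|%:R :> R.
  have <- : (#|good| + #|~: good| = 2 ^ T)%N by rewrite cardsC card_tuple card_bool.
  by rewrite natrD addrK.
suff : 10 * #|~: good|%:R <= 2 ^+ T :> R by rewrite goodE natrX; lra.
rewrite leNgt; apply/negP => many_bad.
have [w0 w0_bad] : exists w, w \in ~: good.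
  by apply/set0Pn; apply: contraTneq many_bad => ->; rewrite cards0 mulr0 -leNgt ltW.
have : \sum_(w in ~: good) 10 * A < \sum_(w in ~: good) F w.
  apply: ltr_sum => [|w]; first by apply/hasP; exists w0; rewrite ?mem_index_enum.
  by rewrite !inE -ltNge.
have : \sum_(w in ~: good) F w <= \sum_(w : T.-tuple bool) F w.
  by rewrite [leRHS](bigID (mem (~: good))) /= lerDl sumr_ge0.
have A_ge0 : 0 <= A.
  by rewrite -(pmulr_lge0 _ pow_gt0) (le_trans _ sum_le) // sumr_ge0.
rewrite sumr_const -mulr_natl; move: (ler_wpM2l A_ge0 (ltW many_bad)) sum_le; lra.
Qed.

Lemma coin_prob_le (P Q : pred (T.-tuple bool)) :
  (forall w, P w -> Q w) -> coin_prob R P <= coin_prob R Q.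
Proof.
move=> PQ; rewrite ler_pM2r ?invr_gt0 ?exprn_gt0 // ler_nat subset_leq_card //.
by apply/subsetP => w; rewrite !inE; exact: PQ.
Qed.

End Markov.

(** * Stochastic projection *)

Section MatrixFunctions.
Variables (R : realType) (n : nat).
Implicit Types (A : 'M[R]_n) (p : 'I_n * 'I_n).

Definition matfun A p : R := A p.1 p.2.

Lemma oracleE A (i j : 'I_n) : oracle A i j = A i j.
Proof. by rewrite /oracle !valK. Qed.

Lemma frobE A : frob A = Num.sqrt (sqnorm (matfun A)).
Proof. by rewrite sqnormE /frob (pair_bigA _ (fun i j => A i j ^+ 2)). Qed.

End MatrixFunctions.

Section StochasticDescent.
Variables (R : realType) (n r L Lam : nat) (x : nat -> R) (B : nat -> nat -> R).
Implicit Types (c : nat -> R) (m i j a t : nat) (p : 'I_n * 'I_n) (w : nat -> bool).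

Definition exp_gram a b : R := (\sum_(i < n) (x a * x b) ^+ i) ^+ 2.

Lemma gram_expfun : gram (@expfun R n x) = exp_gram.
Proof.
apply/funext => a; apply/funext => b.
rewrite /gram /dot /exp_gram expr2 mulr_suml.
under [RHS]eq_bigr => i _ do rewrite mulr_sumr.
by rewrite pair_bigA; apply: eq_bigr => p _; rewrite /expfun /degree -!exprMn exprD.
Qed.

Definition weight m : R := 4 ^+ m / (16 * r%:R).

Definition sgd_update c m i j a : R :=
  c a + weight m * (B i j - expsum r x c (i + j)) *
    \sum_(b < r) gram_kernel r exp_gram r a b * x b ^+ (i + j).

Definition sgd_step c w : nat -> R := sampled n L Lam w (sgd_update c) c.

Fixpoint sgd_run t w : nat -> R :=
  if t is t'.+1 then sgd_step (sgd_run t' w) (skip (t' * sample_bits L) w) else fun=> 0.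

Lemma eq_sgd_run t w w' : (forall k, (k < t * sample_bits L)%N -> w k = w' k) ->
  sgd_run t w = sgd_run t w'.
Proof.
elim: t => //= t IH eqw; rewrite IH => [|k kt]; last by apply: eqw; rewrite mulSn ltn_addl.
by apply: eq_sampled => k kb; apply: eqw; rewrite mulSn addnC ltn_add2r.
Qed.

Let u := @expfun R n x.

Definition input_fun p : R := B p.1 p.2.

Definition residual := input_fun - proj r u input_fun.

Definition deviation c := lincomb r u c - proj r u input_fun.

Lemma deviation0 : sqnorm (deviation (fun=> 0)) = sqnorm (proj r u input_fun).
Proof.
rewrite -[RHS]sqnormN -[- proj _ _ _]add0r /deviation; congr (sqnorm (_ - _)).
by apply/funext => p; rewrite /lincomb big1 // => a _; rewrite mul0r.
Qed.

Lemma proj_deviation c : proj r u (deviation c) = deviation c.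
Proof. by rewrite projB proj_lincomb proj_proj. Qed.

Lemma deviation_update c m p :
  deviation (sgd_update c m p.1 p.2) =
  deviation c + (weight m * (residual p - deviation c p)) \*o rkernel r u p.
Proof.
rewrite [in LHS]/deviation [X in _ = X + _]/deviation addrAC; congr (_ - _).
apply/funext => q; rewrite rkernelE gram_expfun !fctE /= /lincomb mulr_sumr -big_split.
apply: eq_bigr => a _; rewrite /sgd_update mulrDl -mulrA mulrA.
have -> : residual p - deviation c p = B p.1 p.2 - expsum r x c (degree p).
  rewrite /residual /deviation !fctE /= /input_fun.
  by rewrite -[lincomb _ _ _ _]/(expsum r x c (degree p)); ring.
by rewrite !mulrA.
Qed.

Hypotheses (r_gt0 : (0 < r)%N).

Let rR_gt0 : 0 < r%:R :> R. Proof. by rewrite ltr0n. Qed.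

Lemma weight_ge0 m : 0 <= weight m.
Proof. by rewrite divr_ge0 ?exprn_ge0 ?mulr_ge0. Qed.

Lemma weight_rkernel_le1 m p :
  (2 ^ m < 2 * depth n (degree p))%N -> weight m * rkernel r u p p <= 1.
Proof.
move=> scale_lt; have := rkernel_expfun_le r x p; rewrite -/u.
set d := (depth _ _)%:R; set tau := rkernel _ _ _ _ => leverage_le.
rewrite /weight mulrAC ler_pdivrMr ?mulr_gt0 // mul1r.
have pow4_le : 4 ^+ m <= 4 * d ^+ 2 :> R.
  have -> : 4 * d ^+ 2 = (2 * d) ^+ 2 by ring.
  rewrite (_ : 4 = 2 ^+ 2) -?exprM 1?mulnC ?exprM; last by ring.
  by rewrite lerXn2r ?nnegrE ?mulr_ge0 ?exprn_ge0 // /d -natrX -natrM ler_nat ltnW.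
apply: le_trans (ler_wpM2r (rkernel_ge0 _ _ _) pow4_le) _.
have -> : 4 * d ^+ 2 * tau = 4 * (tau * d ^+ 2) by ring.
by rewrite (_ : 16 * r%:R = 4 * (4 * r%:R)) ?ler_wpM2l //; ring.
Qed.

Lemma sqnorm_deviation_update c m p : (2 ^ m < 2 * depth n (degree p))%N ->
  sqnorm (deviation (sgd_update c m p.1 p.2)) <=
  sqnorm (deviation c) + weight m * (residual p ^+ 2 - deviation c p ^+ 2).
Proof.
move=> scale_lt; rewrite deviation_update sqnormD dotZr sqnormZ sqnorm_rkernel.
have -> : dot (deviation c) (rkernel r u p) = deviation c p.
  by rewrite dotC -[LHS]/(proj r u (deviation c) p) proj_deviation.
rewrite -addrA lerD2l; set a := residual p; set b := deviation c p.
set om := weight m; set tau := rkernel _ _ _ _.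
have -> : 2 * (om * (a - b) * b) + (om * (a - b)) ^+ 2 * tau =
    om * (2 * (a - b) * b) + om * (a - b) ^+ 2 * (om * tau) by ring.
have -> : om * (a ^+ 2 - b ^+ 2) = om * (2 * (a - b) * b) + om * (a - b) ^+ 2 * 1 by ring.
rewrite lerD2l ler_wpM2l ?weight_rkernel_le1 // mulr_ge0 ?sqr_ge0 ?weight_ge0 //.
Qed.

Definition sgd_rate : R := (32 * r%:R * 2 ^+ Lam)^-1.

Lemma sgd_rate_gt0 : 0 < sgd_rate.
Proof. by rewrite invr_gt0 !mulr_gt0 ?exprn_gt0. Qed.

Lemma sgd_rate_le1 : sgd_rate <= 1.
Proof.
by rewrite invf_le1 -?natrX -!natrM ?ler1n ?ltr0n !muln_gt0 r_gt0 expn_gt0.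
Qed.

Hypotheses (Lam_le : (Lam <= L)%N) (L_lt : (L < 2 ^ Lam)%N) (n_le : (n <= 2 ^ L)%N).

Lemma avg_sgd_step c :
  avg (sample_bits L) (fun s => sqnorm (deviation (sgd_step c (nth false s)))) <=
  (1 - sgd_rate) * sqnorm (deviation c) + sgd_rate * sqnorm residual.
Proof.
pose gain p := (residual p ^+ 2 - deviation c p ^+ 2) / (16 * r%:R).
pose h := oracle (\matrix_(i, j) gain (i, j)).
have hE p : h p.1 p.2 = gain p by rewrite /h oracleE mxE -surjective_pairing.
apply: le_trans (_ : avg (sample_bits L) (fun s => sqnorm (deviation c) +
    sampled n L Lam (nth false s) (fun m i j => 4 ^+ m * h i j) 0) <= _).
  apply: ler_avg => s _; rewrite /sgd_step /sampled.
  set m := draw_scale _ _ _; set i := draw_row _ _ _; set j := draw_col _ _ _.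
  set b := draw_side _ _.
  case: ifP => [/and4P[_ _ scale_lt near]|_]; last by rewrite addr0.
  have [i_lt j_lt] := mirror_lt near; pose p := (Ordinal i_lt, Ordinal j_lt).
  apply: le_trans (sqnorm_deviation_update c (m := m) (p := p) _) _.
    apply: leq_trans scale_lt _; rewrite leq_mul2l /= /depth /degree /= /mirror.
    by move: near; rewrite /near_corner; case: (b) => /=; lia.
  by rewrite lerD2l (hE p) /gain /weight mulrA mulrAC.
rewrite avgD avg_const avg_sampled //.
have -> : \sum_(i < n) \sum_(j < n) h i j = (sqnorm residual - sqnorm (deviation c)) / (16 * r%:R).
  rewrite pair_bigA /= (eq_bigr _ (fun p _ => hE p)) -mulr_suml sumrB.
  by rewrite !sqnormE.
rewrite le_eqVlt; apply/predU1P; left; rewrite /sgd_rate; field.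
by rewrite !gt_eqF ?exprn_gt0.
Qed.

Lemma avg_sgd_run t :
  avg (t * sample_bits L) (fun s => sqnorm (deviation (sgd_run t (nth false s)))) <=
  (1 - sgd_rate) ^+ t * sqnorm (proj r u input_fun) + sqnorm residual.
Proof.
elim: t => [|t IH]; first by rewrite /= expr0 mul1r deviation0 lerDl sqnorm_ge0.
pose err s := sqnorm (deviation (sgd_run t (nth false s))).
rewrite mulSn addnC avg_cat.
apply: le_trans (_ : avg (t * sample_bits L)
    (fun s => (1 - sgd_rate) * err s + sgd_rate * sqnorm residual) <= _).
  apply: ler_avg => s sz; apply: le_trans (avg_sgd_step _).
  rewrite le_eqVlt; apply/predU1P; left; apply: eq_avg => v _ /=.
  rewrite skip_cat // (@eq_sgd_run _ _ (nth false s)) // => k kt.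
  by rewrite nth_cat sz kt.
rewrite avgD avg_const avgZ.
have := ler_wpM2l (_ : 0 <= 1 - sgd_rate) IH; rewrite subr_ge0 sgd_rate_le1 => /(_ isT).
rewrite mulrDr mulrA -exprS => step_le.
by rewrite -lerBrDr; apply: le_trans step_le _; rewrite mulrBl mul1r addrA.
Qed.

Lemma sgd_run_prob t T : (t * sample_bits L <= T)%N ->
  9 / 10 <= coin_prob R (fun w : T.-tuple bool =>
    sqnorm (deviation (sgd_run t (nth false w))) <=
    10 * ((1 - sgd_rate) ^+ t * sqnorm (proj r u input_fun) + sqnorm residual)).
Proof.
move=> tT; pose err s := sqnorm (deviation (sgd_run t (nth false s))).
apply: (coin_prob_markov (F := err)) => [s|]; first exact: sqnorm_ge0.
rewrite -(subnKC tT) avg_prefix => [|s v sz]; first exact: avg_sgd_run.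
by congr (sqnorm (deviation _)); apply: eq_sgd_run => k kt; rewrite nth_cat sz kt.
Qed.

End StochasticDescent.

(** * Moments of positive definite Hankel matrices *)

Section SymmetricMoments.
Variables (R : rcfType) (n : nat).

Lemma spectral_exp (C : numClosedFieldType) (A : 'M[C]_n.+1) (u : 'cV[C]_n.+1) (k : nat) :
  A \is normalmx ->
  A ^+ k *m u = invmx (spectralmx A) *m
    \col_a (spectral_diag A 0 a ^+ k * (spectralmx A *m u) a 0).
Proof.
move=> /orthomx_spectralP; have := spectral_unit A.
set P := spectralmx A; set d := spectral_diag A => P_unit AE.
elim: k => [|k IH].
  rewrite mul1mx -[LHS](mulKmx P_unit); congr (_ *m _).
  by apply/colP => a; rewrite [RHS]mxE expr0 mul1r.
rewrite exprS -[_ * _]/(_ *m _) -mulmxA IH {1}AE -!mulmxA mulKVmx // mul_diag_mx.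
by congr (_ *m _); apply/colP => a; rewrite !mxE exprS mulrA.
Qed.

Lemma symmetric_moments (S : 'M[R]_n.+1) (u : 'cV[R]_n.+1) : S^T = S ->
  exists m lam : 'I_n.+1 -> R, (forall a, 0 <= m a) /\
    forall k, (u^T *m S ^+ k *m u) 0 0 = \sum_a m a * lam a ^+ k.
Proof.
move=> symS; pose toC := real_complex R; pose A : 'M[R[i]]_n.+1 := map_mx toC S.
have symA : A \is symmetricmx.
  apply/is_hermitianmxP; rewrite expr0 scale1r.
  by apply/matrixP => i j; rewrite !mxE /= -{1}symS mxE.
have realA : A \is a realmx by apply/mxOverP => i j; rewrite mxE complex_real.
have normalA := symmetric_normalmx symA realA.
have := hermitian_spectral_diag_real (realsym_hermsym symA realA).
set P := spectralmx A; set d := spectral_diag A => /mxOverP d_real.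
pose v := P *m map_mx toC u.
exists (fun a => complex.Re (`|v a 0| ^+ 2)), (fun a => complex.Re (d 0 a)); split=> [a|k].
  have : 0 <= `|v a 0| ^+ 2 by rewrite exprn_ge0.
  by rewrite lecE => /andP[].
apply: (@complexI R); rewrite rmorph_sum.
rewrite [RHS](eq_bigr (fun a => `|v a 0| ^+ 2 * d 0 a ^+ k)) => [|a _]; last first.
  rewrite rmorphM rmorphXn; congr (_ * _ ^+ _); apply: RRe_real => //.
  by rewrite realX ?normr_real.
have -> : ((u^T *m S ^+ k *m u) 0 0)%:C%C = (map_mx toC (u^T *m S ^+ k *m u)) 0 0.
  by rewrite [RHS]mxE.
rewrite !map_mxM rmorphXn /= -/A -mulmxA spectral_exp // -/P -/d -/v mulmxA.
have -> : map_mx toC u^T *m invmx P = map_mx Num.conj v^T.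
  rewrite invmx_unitary ?spectral_unitarymx // /v trmx_mul map_mxM; congr (_ *m _).
  by apply/matrixP => i j; rewrite !mxE; apply/esym/conj_Creal; rewrite complex_real.
by rewrite mxE; apply: eq_bigr => a _; rewrite !mxE normCK; ring.
Qed.

End SymmetricMoments.

Section PositiveDefinite.
Variable R : rcfType.

Definition posdefmx n (A : 'M[R]_n) : Prop :=
  A^T = A /\ forall x : 'cV_n, x != 0 -> 0 < (x^T *m A *m x) 0 0.

Lemma posdefmx_unit n (A : 'M[R]_n) : posdefmx A -> A \in unitmx.
Proof.
move=> [_ A_pos]; rewrite -row_free_unit; apply: inj_row_free => v vA; apply/eqP.
apply: contraT => v_neq0; have := A_pos v^T; rewrite trmxK vA mul0mx mxE ltxx; apply.
by apply: contra v_neq0 => /eqP vT0; rewrite -[v]trmxK vT0 trmx0.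
Qed.

Lemma posdefmx_Schur n (a : R) (b : 'cV[R]_n) (D : 'M[R]_n) :
  posdefmx (block_mx a%:M b^T b D : 'M_(1 + n)) -> 0 < a /\ posdefmx (D - a^-1 *: (b *m b^T)).
Proof.
move=> [sym pos].
have a_gt0 : 0 < a.
  pose e : 'cV[R]_(1 + n) := col_mx 1%:M 0.
  have e_neq0 : e != 0.
    by apply/eqP => /matrixP /(_ (lshift n 0) 0) /eqP; rewrite col_mxEu !mxE eqxx oner_eq0.
  have := pos e e_neq0; rewrite /e tr_col_mx mul_row_block mul_row_col.
  by rewrite !trmx0 !trmx1 !mul0mx !mulmx0 !mul1mx !addr0 mulmx1 mxE eqxx mulr1n.
split=> //; split=> [|y y_neq0].
  have /eq_block_mx[_ _ _ DT] : block_mx a%:M b^T b D^T = block_mx a%:M b^T b D.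
    by rewrite -[RHS]sym tr_block_mx trmxK tr_scalar_mx.
  by rewrite linearB /= linearZ /= trmx_mul trmxK DT.
pose z : 'cV[R]_(1 + n) := col_mx (- a^-1 *: (b^T *m y)) y.
have z_neq0 : z != 0.
  apply: contra y_neq0 => /eqP z0; apply/eqP.
  by rewrite -[y](col_mxKd (- a^-1 *: (b^T *m y))) -/z z0 linear0.
have := pos z z_neq0; rewrite -mulmxA mul_block_col.
rewrite mul_scalar_mx scalerA mulrN mulfV ?gt_eqF // scaleN1r addNr.
rewrite -scalemxAr mulmxA scaleNr addrC scalemxAl -mulmxBl.
by rewrite tr_col_mx mul_row_col mulmx0 add0r mulmxA.
Qed.

Lemma Cholesky n (A : 'M[R]_n) : posdefmx A -> exists G : 'M_n, A = G^T *m G.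
Proof.
elim: n A => [|n IH] A A_pos; first by exists 0; apply/matrixP => - [].
pose A1 : 'M[R]_(1 + n) := A.
pose a := (ulsubmx A1) 0 0; pose b := dlsubmx A1; pose D := drsubmx A1.
have AE : A1 = block_mx a%:M b^T b D.
  by rewrite -mx11_scalar /b trmx_dlsub [A1^T](proj1 A_pos) submxK.
move: A_pos; rewrite -[A]/A1 AE => /posdefmx_Schur[a_gt0 /IH [G' GE]].
pose s := Num.sqrt a; have s_neq0 : s != 0 by rewrite gt_eqF // sqrtr_gt0.
have ss : s * s = a by rewrite -expr2 sqr_sqrtr // ltW.
pose G : 'M[R]_(1 + n) := block_mx s%:M (s^-1 *: b^T) 0 G'.
exists G; suff : block_mx a%:M b^T b D = G^T *m G by [].
have trZ : (s^-1 *: b^T)^T = s^-1 *: b by rewrite linearZ /= trmxK.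
rewrite tr_block_mx mulmx_block trZ.
rewrite -GE trmx0 tr_scalar_mx !mul0mx !mulmx0 !addr0; congr block_mx.
- by rewrite -scalar_mxM ss.
- by rewrite mul_scalar_mx scalerA mulfV // scale1r.
- by rewrite mul_mx_scalar scalerA mulfV // scale1r.
- by rewrite -scalemxAl -scalemxAr scalerA -invfM ss addrC subrK.
Qed.

Lemma Vandermonde_posdefmx n (a : 'rV[R]_n) : (forall i j, a 0 i = a 0 j -> i = j) ->
  posdefmx (Vandermonde n a *m (Vandermonde n a)^T).
Proof.
move=> a_inj; set V := Vandermonde n a.
have V_unit : V \in unitmx.
  rewrite unitmxE det_Vandermonde unitfE; apply/prodf_neq0 => i _; apply/prodf_neq0 => j ij.
  by rewrite subr_eq0; apply: contraTneq ij => /a_inj ->; rewrite ltnn.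
split=> [|x x_neq0]; first by rewrite trmx_mul trmxK.
pose z := V^T *m x.
have z_neq0 : z != 0.
  apply: contra x_neq0 => /eqP z0; rewrite -[x](mulKmx (_ : V^T \in unitmx)) ?unitmx_tr //.
  by rewrite -/z z0 mulmx0.
have -> : (x^T *m (V *m V^T) *m x) 0 0 = \sum_i z i 0 ^+ 2.
  have -> : x^T *m (V *m V^T) *m x = z^T *m z by rewrite /z trmx_mul trmxK !mulmxA.
  by rewrite mxE; apply: eq_bigr => i _; rewrite mxE expr2.
rewrite lt_neqAle sumr_ge0 ?andbT => [|i _]; last exact: sqr_ge0.
rewrite eq_sym; apply: contra z_neq0; rewrite psumr_eq0 => [/allP sq0|i _]; last exact: sqr_ge0.
apply/eqP/matrixP => i j; rewrite ord1 [RHS]mxE.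
by have := sq0 i (mem_index_enum i); rewrite /= sqrf_eq0 => /eqP.
Qed.

End PositiveDefinite.

Section HankelMoments.
Variable R : realType.

Lemma hankel_posdef_exists n : exists A : 'M[R]_n, hankel A /\ posdefmx A.
Proof.
pose a : 'rV[R]_n := \row_i i%:R.
exists (Vandermonde n a *m (Vandermonde n a)^T); split.
  by move=> i j k l ijkl; rewrite !mxE; apply: eq_bigr => s _; rewrite !mxE -!exprD ijkl.
apply: Vandermonde_posdefmx => i j; rewrite !mxE => /eqP.
by rewrite eqr_nat => /eqP /val_inj.
Qed.

Lemma hankelE n (H : 'M[R]_n.+1) : hankel H -> exists h : nat -> R, forall i j, H i j = h (i + j)%N.
Proof.
move=> hankelH; exists (fun k => H (inord (minn k n)) (inord (k - minn k n))) => i j.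
have i_lt := ltn_ord i; have j_lt := ltn_ord j.
by apply: hankelH; rewrite !inordK; lia.
Qed.

(* In the basis given by the columns of G, the shift e_k |-> e_(k+1) is
   symmetric; the moment of order 2n+1, which H leaves free, is taken to be 0. *)
Lemma hankel_symmetric_shift n (H G : 'M[R]_n.+1) :
  hankel H -> H = G^T *m G -> H \in unitmx ->
  exists2 S : 'M[R]_n.+1, S^T = S &
    forall k, (k < n)%N -> S *m col (inord k) G = col (inord k.+1) G.
Proof.
move=> /hankelE[h HE] GE; rewrite GE unitmx_mul => /andP[_ G_unit].
pose H1 : 'M[R]_n.+1 := \matrix_(i, j) if (i + j < n + n)%N then h (i + j).+1 else 0.
exists ((invmx G)^T *m H1 *m invmx G) => [|k kn].
  by rewrite !trmx_mul trmxK mulmxA; congr (_ *m _ *m _); apply/matrixP => i j; rewrite !mxE addnC.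
rewrite !colE -!mulmxA (mulKmx G_unit) -colE.
have -> : col (inord k) H1 = col (inord k.+1) H.
  apply/colP => i; rewrite !mxE HE; have i_lt := ltn_ord i.
  by rewrite !inordK ?addnS ?ifT //; lia.
by rewrite colE GE !mulmxA -trmx_mul mulmxV // trmx1 mul1mx.
Qed.

Lemma posdef_hankel_moments n (H : 'M[R]_n.+1) : hankel H -> posdefmx H ->
  exists m lam : 'I_n.+1 -> R, (forall a, 0 <= m a) /\
    forall i j, H i j = \sum_a m a * lam a ^+ (i + j).
Proof.
move=> hankelH posH; have [G GE] := Cholesky posH.
have [S symS shiftS] := hankel_symmetric_shift hankelH GE (posdefmx_unit posH).
pose u := col 0 G.
have colG k : (k <= n)%N -> S ^+ k *m u = col (inord k) G.
  elim: k => [|k IH] kn.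
    by rewrite expr0 mul1mx /u; congr col; apply: val_inj; rewrite /= inordK.
  by rewrite exprS -[_ * _]/(_ *m _) -mulmxA IH ?shiftS // ltnW.
have [m [lam [m_ge0 momentsE]]] := symmetric_moments u symS.
exists m, lam; split=> // i j; rewrite -momentsE.
have tr_expS k : (S ^+ k)^T = S ^+ k.
  elim: k => [|k IH]; first by rewrite expr0 trmx1.
  by rewrite {1}exprS -[_ * _]/(_ *m _) trmx_mul IH symS exprSr.
have -> : u^T *m S ^+ (i + j) *m u = (col i G)^T *m col j G.
  rewrite -[i in LHS]inord_val -[j in LHS]inord_val.
  rewrite -[i in RHS]inord_val -[j in RHS]inord_val -!colG -1?ltnS ?ltn_ord // !inord_val.
  by rewrite trmx_mul tr_expS exprD -[_ * _]/(_ *m _) !mulmxA.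
by rewrite GE !mxE; apply: eq_bigr => k _; rewrite !mxE.
Qed.

End HankelMoments.

(** * Approximation by fixed nodes *)

Lemma Bernoulli_le (R : realDomainType) (x : R) (m : nat) : -1 <= x -> 1 + m%:R * x <= (1 + x) ^+ m.
Proof.
move=> x_ge; elim: m => [|m IH]; first by rewrite mul0r addr0 expr0.
have x1_ge0 : 0 <= 1 + x by lra.
rewrite exprS -natr1; apply: le_trans (ler_wpM2l x1_ge0 IH).
by have := ler0n R m; nra.
Qed.

Lemma bin_le_expn k d : ('C(k, d) <= k ^ d)%N.
Proof.
elim: k d => [|k IH] [|d] //; rewrite binS.
apply: leq_trans (leq_add (IH d.+1) (IH d)) _; rewrite !expnS -mulSnr leq_mul2l /=.
by case: d => // d; rewrite leq_exp2r.
Qed.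

Section Interpolation.
Variable R : realFieldType.
Implicit Types (y c : nat -> R) (x b th de : R) (d k l j : nat).

Lemma interpolation_step d y c x : (forall l, (l < d)%N -> y l != y d) ->
  exists c', expsum d.+1 y c' 0 = 1 /\ forall k, expsum d.+1 y c' k.+1 =
    (x - y d) * expsum d y c k + y d * expsum d.+1 y c' k.
Proof.
move=> yd_new; pose e l := c l * (x - y d) / (y l - y d).
pose c' l := if (l < d)%N then e l else 1 - \sum_(l < d) e l.
have c'E k : expsum d.+1 y c' k = \sum_(l < d) e l * y l ^+ k + (1 - \sum_(l < d) e l) * y d ^+ k.
  rewrite /expsum big_ord_recr /= {2}/c' ltnn; congr (_ + _).
  by apply: eq_bigr => l _; rewrite /c' ltn_ord.
exists c'; split=> [|k].
  by rewrite c'E expr0 mulr1; under eq_bigr => l _ do rewrite expr0 mulr1; rewrite addrC subrK.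
rewrite !c'E exprS; have -> : \sum_(l < d) e l * y l ^+ k.+1 =
    (x - y d) * expsum d y c k + y d * \sum_(l < d) e l * y l ^+ k; last by ring.
rewrite /expsum !mulr_sumr -big_split; apply: eq_bigr => l _ /=; rewrite /e exprS.
by field; rewrite subr_eq0 yd_new.
Qed.

Lemma interpolation_remainder d y x b th :
  `|x| <= b -> 0 <= th ->
  (forall l, (l < d)%N -> `|y l| <= b) -> (forall l, (l < d)%N -> `|x - y l| <= th) ->
  (forall l l', (l < l')%N -> (l' < d)%N -> y l != y l') ->
  exists c, forall k, `|x ^+ k - expsum d y c k| <= 'C(k, d)%:R * b ^+ (k - d) * th ^+ d.
Proof.
move=> x_le th_ge0; elim: d => [|d IH] y_le xy_le y_dist.
  exists (fun=> 0) => k; rewrite /expsum big_ord0 subr0 bin0 expr0 mulr1 mul1r subn0 normrX.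
  by rewrite lerXn2r ?nnegrE // (le_trans _ x_le).
have [|||c c_le] := IH.
- by move=> l ld; apply: y_le; exact: ltnW.
- by move=> l ld; apply: xy_le; exact: ltnW.
- by move=> l l' ll ld; apply: y_dist => //; exact: ltnW.
have [c' [c'0 c'S]] := interpolation_step c x (fun l ld => y_dist l d ld (ltnSn d)).
exists c'; elim=> [|k IHk]; first by rewrite c'0 subrr normr0 bin0n !mul0r.
have -> : x ^+ k.+1 - expsum d.+1 y c' k.+1 =
    (x - y d) * (x ^+ k - expsum d y c k) + y d * (x ^+ k - expsum d.+1 y c' k).
  by rewrite c'S exprS; ring.
apply: le_trans (ler_normD _ _) _; rewrite !normrM subSS.
apply: le_trans (_ : _ <= th * ('C(k, d)%:R * b ^+ (k - d) * th ^+ d) +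
    b * ('C(k, d.+1)%:R * b ^+ (k - d.+1) * th ^+ d.+1)) _.
  by apply: lerD; apply: ler_pM => //; [exact: xy_le|exact: y_le].
rewrite le_eqVlt; apply/predU1P; left.
rewrite binS natrD exprS; have [kd|dk] := leqP k d.
  by rewrite (bin_small (n := k) (m := d.+1)) //; ring.
have -> : (k - d = (k - d.+1).+1)%N by lia.
by rewrite !exprS; ring.
Qed.

(* Bounding a single term of the binomial expansion of ((1 - de/2) + de/2)^k by 1. *)
Lemma binomial_term_le k d de : 0 <= de <= 4 / 5 ->
  'C(k, d)%:R * (1 - de) ^+ (k - d) * (de / 4) ^+ d <= (5 / 6) ^+ d * (1 - de / 2) ^+ k.
Proof.
move=> /andP[de_ge0 de_le]; set y := 1 - de / 2.
have y_ge0 : 0 <= y by rewrite /y; lra.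
have [kd|dk] := ltnP k d.
  by rewrite bin_small // !mul0r mulr_ge0 // exprn_ge0 //; lra.
have term_le1 : 'C(k, d)%:R * (y ^+ (k - d) * (de / 2) ^+ d) <= 1.
  have expand1 : (y + de / 2) ^+ k = 1 by rewrite /y subrK expr1n.
  rewrite -[leRHS]expand1 [(y + _) ^+ k]exprDn; have d_lt : (d < k.+1)%N by [].
  rewrite (bigD1 (Ordinal d_lt)) //= -[X in _ <= X + _]mulr_natl lerDl; apply: sumr_ge0 => i _.
  by rewrite mulrn_wge0 // mulr_ge0 // exprn_ge0 //; lra.
have de_sqr : 1 - de <= y ^+ 2 by rewrite /y expr2; nra.
apply: le_trans (_ : _ <= 'C(k, d)%:R * (y ^+ 2) ^+ (k - d) * (de / 4) ^+ d) _.
  rewrite ler_wpM2r ?exprn_ge0 //; first lra.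
  by rewrite ler_wpM2l // lerXn2r ?nnegrE ?sqr_ge0 //; lra.
have -> : 'C(k, d)%:R * (y ^+ 2) ^+ (k - d) * (de / 4) ^+ d =
   ('C(k, d)%:R * (y ^+ (k - d) * (de / 2) ^+ d)) * (y ^+ (k - d) * 2^-1 ^+ d).
  have -> : de / 4 = de / 2 * 2^-1 by field.
  by rewrite expr2 !exprMn; ring.
have rest_ge0 : 0 <= y ^+ (k - d) * 2^-1 ^+ d by rewrite mulr_ge0 ?exprn_ge0 // invr_ge0.
apply: le_trans (ler_wpM2r rest_ge0 term_le1) _; rewrite mul1r.
have -> : y ^+ k = y ^+ (k - d) * y ^+ d by rewrite -exprD subnK.
rewrite mulrCA ler_wpM2l ?exprn_ge0 // -exprMn lerXn2r ?nnegrE ?invr_ge0 //; rewrite /y; lra.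
Qed.

Definition shell j : R := (4 / 5) ^+ j.

Lemma shell_gt0 j : 0 < shell j. Proof. by apply: exprn_gt0; lra. Qed.

Lemma shell_le1 j : shell j <= 1. Proof. by apply: exprn_ile1; lra. Qed.

Lemma shellS j : shell j.+1 = 4 / 5 * shell j. Proof. exact: exprS. Qed.

Lemma shell_exists J x : 0 <= x < 1 - shell J ->
  exists2 j, (j < J)%N & 1 - shell j <= x < 1 - shell j.+1.
Proof.
move=> /andP[x_ge0]; elim: J => [|J IH] x_lt.
  by rewrite /shell expr0 subrr ltNge x_ge0 in x_lt.
have [J_le|/IH[j jJ j_shell]] := leP (1 - shell J) x; first by exists J; rewrite ?J_le.
by exists j => //; exact: ltnW.
Qed.

Definition shell_node d j l : R := 1 - shell j * (1 - l.+1%:R / (5 * d%:R)).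

Lemma shell_node_bounds d j l : (l < d)%N ->
  1 - shell j < shell_node d j l <= 1 - shell j.+1.
Proof.
move=> ld; have d_gt0 : 0 < d%:R :> R by rewrite ltr0n (leq_ltn_trans _ ld).
rewrite /shell_node; set t := l.+1%:R / (5 * d%:R).
have t_gt0 : 0 < t by rewrite divr_gt0 ?mulr_gt0.
have t_le : t <= 1 / 5.
  by rewrite /t ler_pdivrMr ?mulr_gt0 // mulrA divfK ?pnatr_eq0 // mul1r ler_nat.
by rewrite shellS; have := shell_gt0 j; nra.
Qed.

Lemma shell_node_gt0 d j l : (l < d)%N -> 0 < shell_node d j l.
Proof. by move=> /(shell_node_bounds j); have := shell_le1 j; lra. Qed.

Lemma shell_node_neq d j l l' : (l < l')%N -> (l' < d)%N -> shell_node d j l != shell_node d j l'.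
Proof.
move=> ll' ld; have d_gt0 : 0 < d%:R :> R by rewrite ltr0n (leq_ltn_trans _ ld).
rewrite -subr_eq0.
have -> : shell_node d j l - shell_node d j l' = shell j * ((l.+1%:R - l'.+1%:R) / (5 * d%:R)).
  by rewrite /shell_node; ring.
apply: mulf_neq0; first by rewrite gt_eqF ?shell_gt0.
apply: mulf_neq0; last by rewrite invr_eq0 gt_eqF ?mulr_gt0.
by rewrite subr_eq0 eqr_nat eqSS neq_ltn ll'.
Qed.

Lemma shell_approx d j x : 1 - shell j <= x < 1 - shell j.+1 ->
  exists c, forall k, `|x ^+ k - expsum d (shell_node d j) c k| <=
    (5 / 6) ^+ d * (1 - shell j.+1 / 2) ^+ k.
Proof.
move=> /andP[x_ge x_lt]; have sj_le1 := shell_le1 j.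
set de := shell j.+1 in x_lt *.
have sjE : shell j = 5 / 4 * de by rewrite /de shellS; lra.
have [|||||c c_le] := @interpolation_remainder d (shell_node d j) x (1 - de) (de / 4).
- by rewrite ler_norml; lra.
- by lra.
- by move=> l /(shell_node_bounds j); rewrite -/de ler_norml; lra.
- by move=> l /(shell_node_bounds j); rewrite -/de ler_norml; lra.
- exact: shell_node_neq.
by exists c => k; apply: le_trans (c_le k) _; apply: binomial_term_le; lra.
Qed.

Lemma innermost_approx n d J x : 8 * n%:R * shell J <= 1 -> 1 - shell J <= x <= 1 ->
  exists c, forall k, (k <= 2 * n)%N -> `|x ^+ k - expsum d (shell_node d J) c k| <= (5 / 6) ^+ d.
Proof.
move=> J_large /andP[x_ge x_le]; have sJ_gt0 := shell_gt0 J; have sJ_le1 := shell_le1 J.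
have sJS_gt0 := shell_gt0 J.+1.
have [|||||c c_le] := @interpolation_remainder d (shell_node d J) x 1 (shell J).
- by rewrite ler_norml; lra.
- by lra.
- by move=> l /(shell_node_bounds J); rewrite ler_norml; lra.
- by move=> l /(shell_node_bounds J); rewrite ler_norml; lra.
- exact: shell_node_neq.
exists c => k k_le; apply: le_trans (c_le k) _; rewrite expr1n mulr1.
apply: le_trans (_ : _ <= (k%:R * shell J) ^+ d) _.
  by rewrite exprMn -natrX ler_wpM2r ?ler_nat ?bin_le_expn // exprn_ge0 // ltW.
rewrite lerXn2r ?nnegrE ?mulr_ge0 ?(ltW sJ_gt0) //; first lra.
have : k%:R <= 2 * n%:R :> R by rewrite -natrM ler_nat.
by nra.
Qed.

Lemma innermost_exp_ge n J x : 8 * n%:R * shell J <= 1 -> 1 - shell J <= x <= 1 -> 1 / 2 <= x ^+ n.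
Proof.
move=> J_large /andP[x_ge _]; have sJ_le1 := shell_le1 J.
apply: le_trans (_ : (1 - shell J) ^+ n <= _); last by rewrite lerXn2r ?nnegrE; lra.
by apply: le_trans (Bernoulli_le n _); lra.
Qed.

Lemma shell_exp16_le de x : 0 <= de <= 16 / 25 -> 1 - 5 / 4 * de <= x ->
  (1 - de / 2) ^+ 16 <= x ^+ 2.
Proof.
move=> /andP[de_ge0 de_le] x_ge; set q := 1 - de / 2.
have q_ge0 : 0 <= q by rewrite /q; lra.
rewrite (_ : 16 = 8 * 2)%N // exprM lerXn2r ?nnegrE ?exprn_ge0 //; first by lra.
apply: le_trans x_ge.
have q4_le : q ^+ 4 <= 1 - 5 / 4 * de + 1 / 2 * de ^+ 2.
  have -> : q ^+ 4 = 1 - 2 * de + 3 / 2 * de ^+ 2 - 1 / 2 * de ^+ 3 + 1 / 16 * de ^+ 4.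
    by rewrite /q; field.
  have : 0 <= de * (16 / 25 - de) by apply: mulr_ge0; lra.
  have : 0 <= de ^+ 3 * (16 / 25 - de) by apply: mulr_ge0; [exact: exprn_ge0|lra].
  have : 0 <= de ^+ 3 by exact: exprn_ge0.
  by rewrite !mulrBr -exprSr -expr2; lra.
apply: le_trans (_ : _ <= (1 - 5 / 4 * de + 1 / 2 * de ^+ 2) ^+ 2) _.
  rewrite (_ : 8 = 4 * 2)%N // exprM lerXn2r ?nnegrE ?exprn_ge0 //.
  by apply: le_trans q4_le; exact: exprn_ge0.
rewrite -subr_ge0.
have -> : 1 - 5 / 4 * de - (1 - 5 / 4 * de + 1 / 2 * de ^+ 2) ^+ 2 =
    de * (5 / 4 - 41 / 16 * de + 5 / 4 * de ^+ 2 - 1 / 4 * de ^+ 3) by field.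
apply: mulr_ge0 => //.
have : de ^+ 3 <= de ^+ 2 * (16 / 25) by rewrite exprSr ler_wpM2l ?sqr_ge0.
by have := sqr_ge0 (de - 16 / 25); rewrite sqrrB; lra.
Qed.

(* Rounding down to multiples of 16, followed by a division by 8; this keeps
   [x ^+ coarse i] above the 16th power of a number in the same shell as x. *)
Definition coarse (i : nat) : nat := (2 * (i %/ 16))%N.

Lemma coarse_le i : (coarse i <= i)%N.
Proof. by rewrite /coarse; lia. Qed.

Lemma exp_coarse_le b x i : 0 <= b <= 1 -> b ^+ 16 <= x ^+ 2 -> b ^+ i <= x ^+ coarse i.
Proof.
move=> /andP[b_ge0 b_le1] bx; apply: le_trans (_ : b ^+ (16 * (i %/ 16)) <= _).
  by apply: ler_wiXn2l => //; rewrite mulnC leq_divM.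
by rewrite /coarse !exprM; apply: lerXn2r => //; rewrite nnegrE ?sqr_ge0 // exprn_ge0.
Qed.

Lemma unit_interval_approx n d J x : 8 * n%:R * shell J <= 1 -> 0 <= x <= 1 ->
  exists j c, (j <= J)%N /\ forall i i', (i < n)%N -> (i' < n)%N ->
    `|x ^+ (i + i') - expsum d (shell_node d j) c (i + i')| <=
    2 * (5 / 6) ^+ d * ((3 / 5) ^+ (i + i') + x ^+ (coarse i + coarse i')).
Proof.
move=> J_large /andP[x_ge0 x_le1].
have rate_ge0 : 0 <= (5 / 6 : R) ^+ d by apply: exprn_ge0; lra.
have outer_ge0 k : 0 <= (3 / 5 : R) ^+ k by apply: exprn_ge0; lra.
have [near|far] := leP (1 - shell J) x.
  have x_near : 1 - shell J <= x <= 1 by rewrite near.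
  have [c c_le] := innermost_approx d J_large x_near.
  exists J, c; split=> // i i' i_lt i'_lt; apply: le_trans (c_le _ _) _; first lia.
  have : 1 / 2 <= x ^+ (coarse i + coarse i').
    apply: le_trans (innermost_exp_ge J_large x_near) _.
    by apply: ler_wiXn2l => //; rewrite /coarse; lia.
  by have := outer_ge0 (i + i')%N; nra.
have [|j jJ x_shell] := @shell_exists J x; first by rewrite x_ge0.
have [c c_le] := shell_approx d x_shell; exists j, c; split=> [|i i' _ _]; first exact: ltnW.
have x_pow_ge0 : 0 <= x ^+ (coarse i + coarse i') by exact: exprn_ge0.
apply: le_trans (c_le _) _; set de := shell j.+1.
suff : (1 - de / 2) ^+ (i + i') <= (3 / 5) ^+ (i + i') + x ^+ (coarse i + coarse i').
  by have := outer_ge0 (i + i')%N; nra.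
have [j0|j_gt0] := posnP j.
  have -> : 1 - de / 2 = 3 / 5 by rewrite /de j0 /shell expr1; field.
  by rewrite lerDl.
apply: ler_wpDl => //; rewrite exprD (exprD x).
have de_gt0 : 0 < de by exact: shell_gt0.
have de_le : de <= 16 / 25 by rewrite /de -(prednK j_gt0) !shellS; have := shell_le1 j.-1; lra.
have q_bounds : 0 <= 1 - de / 2 <= 1 by lra.
have /andP[q_ge0 _] := q_bounds.
have exp16_le : (1 - de / 2) ^+ 16 <= x ^+ 2.
  have deE : de = 4 / 5 * shell j by exact: shellS.
  by apply: shell_exp16_le; [rewrite ltW|case/andP: x_shell => x_ge _; lra].
by apply: ler_pM; rewrite ?exprn_ge0 //; apply: exp_coarse_le.
Qed.

End Interpolation.

(** * Approximation of positive semidefinite Hankel matrices *)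

Section ExponentialSpan.
Variables (R : realFieldType) (r : nat) (x : nat -> R).

Definition expspan (f : nat -> R) : Prop := exists c, f = expsum r x c.

Lemma expspan_exp y : (exists2 a, (a < r)%N & x a = y) -> expspan (fun k => y ^+ k).
Proof.
move=> [a ar <-]; exists (fun b => (b == a)%:R); apply/funext => k.
rewrite /expsum (bigD1 (Ordinal ar)) //= eqxx mul1r big1 ?addr0 // => b.
by rewrite -val_eqE /= => /negPf ->; rewrite mul0r.
Qed.

Lemma expspan_sum (T : finType) (s : T -> R) (f : T -> nat -> R) :
  (forall l, expspan (f l)) -> expspan (fun k => \sum_l s l * f l k).
Proof.
move=> /boolp.choice[c fE]; exists (fun a => \sum_l s l * c l a); apply/funext => k.
under eq_bigr => l _ do rewrite fE mulr_sumr.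
rewrite exchange_big; apply: eq_bigr => a _; rewrite mulr_suml.
by apply: eq_bigr => l _; rewrite mulrA.
Qed.

Lemma expspan_map (h : R -> R) (c : nat -> R) :
  (forall a, (a < r)%N -> exists2 b, (b < r)%N & x b = h (x a)) ->
  expspan (fun k => \sum_(a < r) c a * h (x a) ^+ k).
Proof.
move=> h_closed; apply: (@expspan_sum _ (fun a : 'I_r => c a) (fun a k => h (x a) ^+ k)) => a.
by apply: (expspan_exp (y := h (x a))); exact: h_closed.
Qed.

Lemma expspan_alternate f : (forall a, (a < r)%N -> exists2 b, (b < r)%N & x b = - x a) ->
  expspan f -> expspan (fun k => (-1) ^+ k * f k).
Proof.
move=> opp_closed [c ->]; have [c' c'E] := expspan_map (h := -%R) c opp_closed.
exists c'; rewrite -c'E; apply/funext => k; rewrite mulr_sumr.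
by apply: eq_bigr => a _; rewrite mulrCA -exprMn mulN1r.
Qed.

Lemma expspan_reverse f N : (forall a, (a < r)%N -> x a != 0) ->
  (forall a, (a < r)%N -> exists2 b, (b < r)%N & x b = (x a)^-1) ->
  expspan f -> exists2 g, expspan g & forall k, (k <= N)%N -> g k = f (N - k)%N.
Proof.
move=> x_neq0 inv_closed [c ->].
exists (fun k => \sum_(a < r) (c a * x a ^+ N) * (x a)^-1 ^+ k); first by
  exact: (expspan_map (h := GRing.inv) (fun a => c a * x a ^+ N) inv_closed).
move=> k kN; apply: eq_bigr => a _; rewrite -mulrA; congr (_ * _).
by rewrite -{1}(subnK kN) exprD exprVn mulfK // expf_neq0 // x_neq0.
Qed.

End ExponentialSpan.

Section Nodes.
Variables (R : realFieldType) (d : nat).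

Definition node (a : nat) : R :=
  let x := shell_node R d ((a %/ 4) %/ d) ((a %/ 4) %% d) in
  match (a %% 4)%N with 0 => x | 1 => - x | 2 => x^-1 | _ => - x^-1 end.

Definition node_count (J : nat) : nat := (4 * (d * J.+1))%N.

Lemma nodeE j l e : (l < d)%N -> (e < 4)%N -> node (4 * (j * d + l) + e) =
  let x := shell_node R d j l in match e with 0 => x | 1 => - x | 2 => x^-1 | _ => - x^-1 end.
Proof.
move=> ld e4; rewrite /node mulnC divnMDl // (divn_small e4) addn0 modnMDl (modn_small e4).
by rewrite divnMDl ?(leq_ltn_trans _ ld) // divn_small // addn0 modnMDl modn_small.
Qed.

Variable J : nat.

Lemma node_index_lt j l e : (j <= J)%N -> (l < d)%N -> (e < 4)%N ->
  (4 * (j * d + l) + e < node_count J)%N.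
Proof.
move=> jJ ld e4; rewrite /node_count.
have : (j.+1 * d <= J.+1 * d)%N by rewrite leq_mul2r ltnS jJ orbT.
by rewrite mulSn [(J.+1 * d)%N]mulnC; lia.
Qed.

Lemma node_index a : (a < node_count J)%N ->
  exists j l e, [/\ (j <= J)%N, (l < d)%N, (e < 4)%N & a = (4 * (j * d + l) + e)%N].
Proof.
rewrite /node_count => a_lt; have d_gt0 : (0 < d)%N by move: a_lt; case: (d); lia.
exists (a %/ 4 %/ d)%N, (a %/ 4 %% d)%N, (a %% 4)%N; rewrite !ltn_mod d_gt0; split=> //.
  by rewrite -ltnS ltn_divLR // mulnC ltn_divLR // mulnC.
by rewrite -divn_eq mulnC -divn_eq.
Qed.

Lemma node_shell j l : (j <= J)%N -> (l < d)%N ->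
  exists2 a, (a < node_count J)%N & node a = shell_node R d j l.
Proof. by move=> jJ ld; exists (4 * (j * d + l) + 0)%N; [exact: node_index_lt|rewrite nodeE]. Qed.

Lemma node_neq0 a : (a < node_count J)%N -> node a != 0.
Proof.
move=> /node_index[j [l [e [_ ld e4 ->]]]]; rewrite nodeE //=.
by case: e e4 => [|[|[|[|]]]] // _; rewrite ?oppr_eq0 ?invr_eq0 gt_eqF ?shell_node_gt0.
Qed.

Lemma node_opp a : (a < node_count J)%N -> exists2 b, (b < node_count J)%N & node b = - node a.
Proof.
move=> /node_index[j [l [e [jJ ld e4 ->]]]].
pose e' := match e with 0 => 1 | 1 => 0 | 2 => 3 | _ => 2 end%N.
have e'4 : (e' < 4)%N by move: e e4 @e' => [|[|[|[|]]]].
exists (4 * (j * d + l) + e')%N; first exact: node_index_lt.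
by rewrite !nodeE //=; move: e e4 @e' {e'4} => [|[|[|[|]]]] //= _; rewrite opprK.
Qed.

Lemma node_inv a : (a < node_count J)%N -> exists2 b, (b < node_count J)%N & node b = (node a)^-1.
Proof.
move=> /node_index[j [l [e [jJ ld e4 ->]]]].
pose e' := match e with 0 => 2 | 1 => 3 | 2 => 0 | _ => 1 end%N.
have e'4 : (e' < 4)%N by move: e e4 @e' => [|[|[|[|]]]].
exists (4 * (j * d + l) + e')%N; first exact: node_index_lt.
by rewrite !nodeE //=; move: e e4 @e' {e'4} => [|[|[|[|]]]] //= _; rewrite ?invrN ?invrK.
Qed.

End Nodes.

Section IndexPairs.
Variable n : nat.
Implicit Types p : 'I_n * 'I_n.

Definition coarse_ord (i : 'I_n) : 'I_n := Ordinal (leq_ltn_trans (coarse_le i) (ltn_ord i)).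

Definition coarse_pair p := (coarse_ord p.1, coarse_ord p.2).

Definition rev_pair p := (rev_ord p.1, rev_ord p.2).

Lemma rev_pairK : involutive rev_pair.
Proof. by move=> [i j]; rewrite /rev_pair !rev_ordK. Qed.

Lemma degree_rev_pair p : degree (rev_pair p) = (2 * n.-1 - degree p)%N.
Proof. by have := ltn_ord p.1; have := ltn_ord p.2; rewrite /degree /=; lia. Qed.

Lemma degree_le p : (degree p <= 2 * n.-1)%N.
Proof. by have := ltn_ord p.1; have := ltn_ord p.2; rewrite /degree; lia. Qed.

Lemma coarse_pair_even p : ~~ odd (degree (coarse_pair p)).
Proof. by rewrite /degree /= /coarse -mulnDr oddM. Qed.

Lemma card_coarse_fiber q : (#|[set p | coarse_pair p == q]| <= 256)%N.
Proof.
have fiber i : (#|[set i' | coarse_ord i' == i]| <= 16)%N.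
  have inj_mod : {in [set i' | coarse_ord i' == i] &,
      injective (fun i' : 'I_n => inord (i' %% 16) : 'I_16)}.
    move=> i1 i2; rewrite !inE -!val_eqE /= => /eqP e1 /eqP e2 /(congr1 val) /=.
    rewrite !inordK ?ltn_mod // => e12; apply: val_inj => /=.
    by move: e1 e2 e12; rewrite /coarse; lia.
  by rewrite -(card_in_imset inj_mod) -[X in (_ <= X)%N](card_ord 16) max_card.
have -> : [set p | coarse_pair p == q] =
    setX [set i | coarse_ord i == q.1] [set j | coarse_ord j == q.2].
  by apply/setP => - [i j]; case: q => [i' j']; rewrite !inE.
by rewrite cardsX; exact: (leq_mul (fiber q.1) (fiber q.2)).
Qed.

Variables (R : realFieldType) (F : 'I_n * 'I_n -> R).

Lemma sum_rev_pair : \sum_p F (rev_pair p) = \sum_p F p.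
Proof. by rewrite [RHS](reindex_inj (inv_inj rev_pairK)). Qed.

Lemma sum_coarse_pair_le : (forall p, 0 <= F p) -> \sum_p F (coarse_pair p) <= 256 * \sum_p F p.
Proof.
by move=> F_ge0; apply: (@ler_sum_fiber _ _ _ coarse_pair _ F_ge0 256); exact: card_coarse_fiber.
Qed.

Lemma sum_corner_le : \sum_(p : 'I_n * 'I_n) ((3 / 5 : R) ^+ degree p) ^+ 2 <= 4.
Proof.
have geometric_le m : 0 <= \sum_(i < m) (9 / 25 : R) ^+ i <= 2 - 2 * (9 / 25) ^+ m.
  elim: m => [|m IH]; first by rewrite big_ord0 expr0; lra.
  by rewrite big_ord_recr /= exprS; have : 0 <= (9 / 25 : R) ^+ m by [apply: exprn_ge0; lra]; lra.
have pow_ge0 : 0 <= (9 / 25 : R) ^+ n by apply: exprn_ge0; lra.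
rewrite (eq_bigr (fun p : 'I_n * 'I_n => (9 / 25) ^+ p.1 * (9 / 25) ^+ p.2)) => [|p _]; last first.
  by rewrite -exprD -exprM mulnC exprM; congr (_ ^+ _); field.
rewrite -(pair_bigA _ (fun i j : 'I_n => (9 / 25) ^+ i * (9 / 25) ^+ j)) /=.
under eq_bigr => i _ do rewrite -mulr_sumr.
by rewrite -mulr_suml; have := geometric_le n; nra.
Qed.

End IndexPairs.

Section MomentApproximation.
Variables (R : realType) (N d J : nat).
Hypothesis J_large : 8 * N.+1%:R * shell R J <= 1.
Implicit Types (lam : R) (p : 'I_N.+1 * 'I_N.+1).

Let in_span := expspan (node_count d J) (node R d).
Let eta : R := 2 * (5 / 6) ^+ d.
Let corner p : R := (3 / 5) ^+ degree p.

Let eta_ge0 : 0 <= eta.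
Proof. by rewrite mulr_ge0 // exprn_ge0 //; lra. Qed.

Let corner_ge0 p : 0 <= corner p.
Proof. by apply: exprn_ge0; lra. Qed.

Lemma contracting_exp_approx lam : `|lam| <= 1 -> exists2 f, in_span f & forall p,
  `|lam ^+ degree p - f (degree p)| <= eta * (corner p + lam ^+ degree (coarse_pair p)).
Proof.
move=> lam_le1; have [|j [c [jJ c_le]]] := unit_interval_approx d J_large (x := `|lam|).
  by rewrite normr_ge0.
pose f0 k := \sum_(l < d) c l * shell_node R d j l ^+ k.
have span_f0 : in_span f0.
  by apply: expspan_sum => l; apply: expspan_exp; exact: node_shell.
have f0_le p : `| `|lam| ^+ degree p - f0 (degree p)| <=
    eta * (corner p + lam ^+ degree (coarse_pair p)).
  have := c_le p.1 p.2 (ltn_ord _) (ltn_ord _); congr (_ <= eta * (_ + _)).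
  by rewrite -[RHS]ger0_norm ?normrX // exprn_even_ge0 ?coarse_pair_even.
have [lam_ge0|lam_lt0] := ger0P lam; rewrite ?(ger0_norm lam_ge0) in f0_le; first by exists f0.
exists (fun k => (-1) ^+ k * f0 k) => [|p].
  by apply: expspan_alternate span_f0; exact: node_opp.
have -> : lam ^+ degree p = (-1) ^+ degree p * `|lam| ^+ degree p.
  by rewrite ltr0_norm // -exprMn mulN1r opprK.
by rewrite -mulrBr normrM normrX normrN1 expr1n mul1r.
Qed.

Lemma expanding_exp_approx lam : 1 <= `|lam| -> exists2 f, in_span f & forall p,
  `|lam ^+ degree p - f (degree p)| <= eta * (corner (rev_pair p) * lam ^+ (2 * N) +
    lam ^+ degree (rev_pair (coarse_pair (rev_pair p)))).
Proof.
move=> lam_ge1; have lam_neq0 : lam != 0 by rewrite -normr_gt0 (lt_le_trans ltr01).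
have [|f span_f f_le] := @contracting_exp_approx lam^-1.
  by rewrite normfV invf_le1 // normr_gt0.
have [g span_g gE] := expspan_reverse (2 * N) (@node_neq0 R d J) (@node_inv R d J) span_f.
exists (fun k => lam ^+ (2 * N) * g k) => [|p].
  have [c ->] := span_g; exists (fun a => lam ^+ (2 * N) * c a); apply/funext => k.
  by rewrite /expsum mulr_sumr; apply: eq_bigr => a _; rewrite mulrA.
have flip (q : 'I_N.+1 * 'I_N.+1) :
    lam ^+ degree (rev_pair q) = lam ^+ (2 * N) * lam^-1 ^+ degree q.
  have q_le : (degree q <= 2 * N)%N := degree_le q.
  by rewrite degree_rev_pair -[in RHS](subnK q_le) exprD exprVn mulfK ?expf_neq0.
have := f_le (rev_pair p); rewrite -[p in lam ^+ degree p]rev_pairK !flip.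
rewrite gE ?degree_le // -[(2 * N - _)%N]degree_rev_pair -mulrBr normrM.
have pow_ge0 : 0 <= lam ^+ (2 * N) by rewrite exprn_even_ge0 // oddM.
rewrite (ger0_norm pow_ge0) => /(ler_wpM2l pow_ge0) /le_trans; apply.
by rewrite mulrCA mulrDr (mulrC _ (corner _)).
Qed.

Lemma exp_approx lam : exists f, in_span f /\ forall p,
  `|lam ^+ degree p - f (degree p)| <= eta *
    (corner p + lam ^+ degree (coarse_pair p) + corner (rev_pair p) * lam ^+ (2 * N) +
     lam ^+ degree (rev_pair (coarse_pair (rev_pair p)))).
Proof.
have even_ge0 k : ~~ odd k -> 0 <= lam ^+ k by move=> k_even; rewrite exprn_even_ge0.
have coarse_ge0 p : 0 <= lam ^+ degree (coarse_pair p) by rewrite even_ge0 // coarse_pair_even.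
have rev_ge0 p : 0 <= lam ^+ degree (rev_pair (coarse_pair p)).
  rewrite even_ge0 // degree_rev_pair oddB ?degree_le // oddM /=.
  exact: coarse_pair_even.
have far_ge0 p : 0 <= corner (rev_pair p) * lam ^+ (2 * N).
  by rewrite mulr_ge0 // even_ge0 // oddM.
have [/contracting_exp_approx|/ltW/expanding_exp_approx] := leP `|lam| 1.
all: move=> [f span_f f_le]; exists f; split=> // p.
all: apply: le_trans (f_le p) _; rewrite ler_wpM2l //.
  by rewrite -addrA lerDl addr_ge0.
by rewrite -addrA lerDr addr_ge0.
Qed.

Lemma entry_le (H : 'M[R]_N.+1) i j : H i j ^+ 2 <= sqnorm (matfun H).
Proof.
rewrite sqnormE (bigD1 (i, j)) //= lerDl; apply: sumr_ge0 => p _.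
exact: sqr_ge0.
Qed.

Lemma sqr_sum4_le (a b c e : R) :
  (a + b + c + e) ^+ 2 <= 4 * (a ^+ 2 + b ^+ 2 + c ^+ 2 + e ^+ 2).
Proof.
have := sqr_ge0 (a - b); have := sqr_ge0 (a - c); have := sqr_ge0 (a - e).
have := sqr_ge0 (b - c); have := sqr_ge0 (b - e); have := sqr_ge0 (c - e).
by rewrite -subr_ge0; nra.
Qed.

Definition approx_rate : R := 2080 * (2 * (5 / 6) ^+ d) ^+ 2.

Definition majorant (H : 'M[R]_N.+1) p : R :=
  corner p * H 0 0 + matfun H (coarse_pair p) + corner (rev_pair p) * H ord_max ord_max +
  matfun H (rev_pair (coarse_pair (rev_pair p))).

Lemma sqnorm_majorant_le (H : 'M[R]_N.+1) : sqnorm (majorant H) <= 2080 * sqnorm (matfun H).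
Proof.
rewrite [leLHS]sqnormE; set D := sqnorm (matfun H).
have DE : D = \sum_p matfun H p ^+ 2 by exact: sqnormE.
have corner_le i : \sum_p (corner p * H i i) ^+ 2 <= 4 * D.
  under eq_bigr => p _ do rewrite exprMn.
  rewrite -mulr_suml ler_pM ?sqr_ge0 ?sum_corner_le ?entry_le //.
  by apply: sumr_ge0 => p _; exact: sqr_ge0.
have entry_ge0 p : 0 <= matfun H p ^+ 2 by exact: sqr_ge0.
have coarse_sum_le : \sum_p matfun H (coarse_pair p) ^+ 2 <= 256 * D.
  by rewrite DE (sum_coarse_pair_le (F := fun p => matfun H p ^+ 2)).
have rev_corner_le : \sum_p (corner (rev_pair p) * H ord_max ord_max) ^+ 2 <= 4 * D.
  by rewrite (sum_rev_pair (fun p => (corner p * H ord_max ord_max) ^+ 2)).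
have rev_coarse_le : \sum_p matfun H (rev_pair (coarse_pair (rev_pair p))) ^+ 2 <= 256 * D.
  rewrite (sum_rev_pair (fun p => matfun H (rev_pair (coarse_pair p)) ^+ 2)).
  apply: le_trans (sum_coarse_pair_le (F := fun p => matfun H (rev_pair p) ^+ 2) _) _ => //.
  by rewrite (sum_rev_pair (fun p => matfun H p ^+ 2)) -DE.
apply: le_trans (ler_sum _ (fun p _ => sqr_sum4_le _ _ _ _)) _.
rewrite -mulr_sumr !big_split /=; have := corner_le 0; lra.
Qed.

Lemma moments_approx (H : 'M[R]_N.+1) (T : finType) (m lam : T -> R) :
  (forall a, 0 <= m a) -> (forall i j, H i j = \sum_a m a * lam a ^+ (i + j)) ->
  exists c, sqnorm (matfun H - lincomb (node_count d J) (@expfun R N.+1 (node R d)) c) <=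
    approx_rate * sqnorm (matfun H).
Proof.
move=> m_ge0 HE.
have matfunE p : matfun H p = \sum_a m a * lam a ^+ degree p by exact: HE.
have [f f_approx] := boolp.choice (fun a => exp_approx (lam a)).
have [c cE] : in_span (fun k => \sum_a m a * f a k) by apply: expspan_sum => a; case: (f_approx a).
exists c; rewrite lincomb_expfun -cE.
set err := matfun H - _; have err_le p : `|err p| <= eta * majorant H p.
  rewrite /err fctE /= matfunE -sumrB; apply: le_trans (ler_norm_sum _ _ _) _.
  have -> : majorant H p = \sum_a m a * (corner p + lam a ^+ degree (coarse_pair p) +
      corner (rev_pair p) * lam a ^+ (2 * N) +
      lam a ^+ degree (rev_pair (coarse_pair (rev_pair p)))).
    rewrite /majorant !matfunE !HE !mulr_sumr -!big_split; apply: eq_bigr => a _ /=.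
    by rewrite addn0 expr0 addnn -mul2n; ring.
  rewrite mulr_sumr; apply: ler_sum => a _; rewrite -mulrBr normrM ger0_norm // mulrCA ler_wpM2l //.
  by case: (f_approx a) => _.
have -> : approx_rate * sqnorm (matfun H) = eta ^+ 2 * (2080 * sqnorm (matfun H)).
  by rewrite /approx_rate -/eta; ring.
apply: le_trans (ler_wpM2l (sqr_ge0 _) (sqnorm_majorant_le H)).
rewrite !sqnormE mulr_sumr; apply: ler_sum => p _; rewrite -real_normK ?num_real // -exprMn.
by rewrite lerXn2r ?nnegrE // (le_trans (normr_ge0 _) (err_le p)).
Qed.

End MomentApproximation.

Section PsdHankel.
Variable R : realType.

Lemma quadratic_limit_le0 (a b c : R) :
  (forall t, 0 < t -> a + t * b + t ^+ 2 * c <= 0) -> a <= 0.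
Proof.
move=> le0; apply/ler_addgt0Pr => e e_gt0; rewrite add0r.
pose s := `|b| + `|c| + 1; pose t := Num.min 1 (e / s).
have b_ge0 := normr_ge0 b; have c_ge0 := normr_ge0 c.
have s_gt0 : 0 < s by rewrite /s; lra.
have t_gt0 : 0 < t by rewrite lt_min ltr01 divr_gt0.
have t_le1 : t <= 1 by rewrite ge_min lexx.
have ts_le : t * s <= e by rewrite -ler_pdivlMr // ge_min lexx orbT.
have tb_ge : - (t * `|b|) <= t * b by rewrite -mulrN ler_pM2l // lerNl ler_normr lexx orbT.
have tc_ge : - (t * `|c|) <= t ^+ 2 * c.
  apply: le_trans (_ : - (t ^+ 2 * `|c|) <= _).
    by rewrite lerN2 ler_wpM2r // expr2 ler_piMr // ltW.
  by rewrite -mulrN ler_wpM2l ?sqr_ge0 // lerNl ler_normr lexx orbT.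
have : t * s = t * `|b| + t * `|c| + t by rewrite /s; ring.
by have := le0 t t_gt0; lra.
Qed.

Lemma psd_hankel_residual N d J (H : 'M[R]_N.+1) :
  8 * N.+1%:R * shell R J <= 1 -> hankel H -> psd H ->
  sqnorm (matfun H - proj (node_count d J) (@expfun R N.+1 (node R d)) (matfun H)) <=
    approx_rate R d * sqnorm (matfun H).
Proof.
move=> J_large hankelH [symH psdH]; set P := proj _ _.
have [H0 [hankelH0 [symH0 posH0]]] := hankel_posdef_exists R N.+1.
pose g := matfun H; pose g0 := matfun H0.
rewrite -subr_le0 -/g.
apply: (@quadratic_limit_le0 _ (2 * dot (g - P g) (g0 - P g0) - approx_rate R d * (2 * dot g g0))
  (sqnorm (g0 - P g0) - approx_rate R d * sqnorm g0)) => t t_gt0.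
pose Ht := H + t *: H0.
have hankelHt : hankel Ht.
  by move=> i j k l ijkl; rewrite !mxE (hankelH _ _ _ _ ijkl) (hankelH0 _ _ _ _ ijkl).
have posHt : posdefmx Ht.
  split=> [|x x_neq0]; first by rewrite linearD linearZ /= symH symH0.
  rewrite mulmxDr mulmxDl -scalemxAr -scalemxAl [ltRHS]mxE [X in _ + X]mxE.
  by rewrite ltr_wpDl ?psdH // mulr_gt0 ?posH0.
have [m [lam [m_ge0 HtE]]] := posdef_hankel_moments hankelHt posHt.
have [c c_le] := moments_approx d J_large m_ge0 HtE.
have := le_trans (sqnorm_projB_lincomb_le _ _ _ c) c_le.
have -> : matfun Ht = g + (t \*o g0) by apply/funext => p; rewrite /matfun !mxE fctE.
have -> : g + (t \*o g0) - proj (node_count d J) (@expfun R N.+1 (node R d)) (g + (t \*o g0)) =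
    (g - P g) + (t \*o (g0 - P g0)).
  rewrite projD projZ -/P opprD addrACA; congr (_ + _).
  by apply/funext => p; rewrite !fctE /= mulrBr.
rewrite (sqnormD g (t \*o g0)) (sqnormD (g - P g)) !dotZr !sqnormZ -subr_le0.
by congr (_ <= _); ring.
Qed.

End PsdHankel.

(** * A structured language for the machine *)

Declare Scope nexpr_scope.
Delimit Scope nexpr_scope with nexpr.
Declare Scope rexpr_scope.
Delimit Scope rexpr_scope with rexpr.

Inductive nop : Type := NPlus | NMinus.

Inductive nexpr : Type :=
| NReg of nat
| NLit of nat
| NBin of nop & nexpr & nexpr
| NHalve of nexpr.

Bind Scope nexpr_scope with nexpr.
Arguments NBin _ (_ _)%_nexpr_scope.
Arguments NHalve _%_nexpr_scope.
Coercion NReg : nat >-> nexpr.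
Notation "e1 + e2" := (NBin NPlus e1 e2) : nexpr_scope.
Notation "e1 - e2" := (NBin NMinus e1 e2) : nexpr_scope.
Notation "e ./2" := (NHalve e) : nexpr_scope.

Inductive rop : Type := RPlus | RMinus | RTimes | ROver.

Inductive rexpr : Type :=
| XReg of nat
| XNat of nexpr
| XArr of nat & nexpr
| XBin of rop & rexpr & rexpr.

Bind Scope rexpr_scope with rexpr.
Arguments XBin _ (_ _)%_rexpr_scope.
Coercion XReg : nat >-> rexpr.
Notation "e1 + e2" := (XBin RPlus e1 e2) : rexpr_scope.
Notation "e1 - e2" := (XBin RMinus e1 e2) : rexpr_scope.
Notation "e1 * e2" := (XBin RTimes e1 e2) : rexpr_scope.
Notation "e1 / e2" := (XBin ROver e1 e2) : rexpr_scope.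
Notation XLit c := (XNat (NLit c)).

Inductive stmt : Type :=
| SetN of nat & nexpr
| SetX of nat & rexpr
| SetA of nat & nexpr & rexpr
| Ask of nat & nexpr & nexpr
| Toss of nat
| Then of stmt & stmt
| IfLt of nexpr & nexpr & stmt & stmt
| For of nat & nat & stmt.

Notation "p ;; q" := (Then p q) (at level 60, right associativity).

Definition nop_fun (op : nop) : nat -> nat -> nat :=
  match op with NPlus => addn | NMinus => subn end.

Definition nop_instr (op : nop) : nat -> nat -> nat -> instr :=
  match op with NPlus => NAdd | NMinus => NSub end.

Definition rop_fun (F : unitRingType) (op : rop) : F -> F -> F :=
  match op with
  | RPlus => +%R | RMinus => fun x y => x - y | RTimes => *%R | ROver => fun x y => x / y
  end.

Definition rop_instr (op : rop) : nat -> nat -> nat -> instr :=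
  match op with RPlus => RAdd | RMinus => RSub | RTimes => RMul | ROver => RDiv end.

(* Registers are the cells 0..31 of either memory, expression temporaries the
   cells from 32 on, and entry i of the q-th of eight real arrays is X[64+q+8i]. *)
Notation temp k := (32 + k)%N.

Definition arr_addr (q i : nat) : nat := (64 + q + 8 * i)%N.

Fixpoint compile_nexpr (e : nexpr) (k : nat) : cmd :=
  match e with
  | NReg r => Seq (Do (NConst (temp k.+1) 0)) (Do (NAdd (temp k) r (temp k.+1)))
  | NLit c => Do (NConst (temp k) c)
  | NBin op e1 e2 => Seq (compile_nexpr e1 k) (Seq (compile_nexpr e2 k.+1)
      (Do (nop_instr op (temp k) (temp k) (temp k.+1))))
  | NHalve e1 => Seq (compile_nexpr e1 k) (Do (NHalf (temp k) (temp k)))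
  end.

Definition compile_addr (q : nat) : cmd :=
  Seq (Do (NAdd 32 32 32)) (Seq (Do (NAdd 32 32 32)) (Seq (Do (NAdd 32 32 32))
    (Seq (Do (NConst 33 (64 + q))) (Do (NAdd 32 33 32))))).

Fixpoint compile_rexpr (e : rexpr) (k : nat) : cmd :=
  match e with
  | XReg x => Seq (Do (NConst 32 0)) (Seq (Do (RNat (temp k) 32)) (Do (RAdd (temp k) x (temp k))))
  | XNat e1 => Seq (compile_nexpr e1 0) (Do (RNat (temp k) 32))
  | XArr q e1 => Seq (compile_nexpr e1 0) (Seq (compile_addr q) (Do (RLoad (temp k) 32)))
  | XBin op e1 e2 => Seq (compile_rexpr e1 k) (Seq (compile_rexpr e2 k.+1)
      (Do (rop_instr op (temp k) (temp k) (temp k.+1))))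
  end.

Fixpoint compile (p : stmt) : cmd :=
  match p with
  | SetN r e => Seq (compile_nexpr e 0) (Seq (Do (NConst 33 0)) (Do (NAdd r 32 33)))
  | SetX x e => Seq (compile_rexpr e 0)
      (Seq (Do (NConst 32 0)) (Seq (Do (RNat 33 32)) (Do (RAdd x 32 33))))
  | SetA q i e => Seq (compile_rexpr e 0) (Seq (compile_nexpr i 0)
      (Seq (compile_addr q) (Do (RStore 32 32))))
  | Ask x i j => Seq (compile_nexpr i 0) (Seq (compile_nexpr j 1) (Do (Query x 32 33)))
  | Toss r => Do (Flip r)
  | p1 ;; p2 => Seq (compile p1) (compile p2)
  | IfLt e1 e2 p1 p2 => Seq (compile_nexpr e1 0) (Seq (compile_nexpr e2 1)
      (If (NLt 32 33) (compile p1) (compile p2)))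
  | For i r p1 => Seq (Do (NConst i 0))
      (While (NLt i r) (Seq (compile p1) (Seq (Do (NConst 32 1)) (Do (NAdd i i 32)))))
  end.

Fixpoint cost_nexpr (e : nexpr) : nat :=
  match e with
  | NReg _ => 2
  | NLit _ => 1
  | NBin _ e1 e2 => (cost_nexpr e1 + (cost_nexpr e2 + 1))%N
  | NHalve e1 => (cost_nexpr e1 + 1)%N
  end.

Fixpoint cost_rexpr (e : rexpr) : nat :=
  match e with
  | XReg _ => 3
  | XNat e1 => (cost_nexpr e1 + 1)%N
  | XArr _ e1 => (cost_nexpr e1 + (5 + 1))%N
  | XBin _ e1 e2 => (cost_rexpr e1 + (cost_rexpr e2 + 1))%N
  end.

Section Cost.
Variable b : nat.

(* The running time when no loop makes more than b iterations. *)
Fixpoint cost (p : stmt) : nat :=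
  match p with
  | SetN _ e => (cost_nexpr e + 2)%N
  | SetX _ e => (cost_rexpr e + 3)%N
  | SetA _ i e => (cost_rexpr e + (cost_nexpr i + (5 + 1)))%N
  | Ask _ i j => (cost_nexpr i + (cost_nexpr j + 1))%N
  | Toss _ => 1
  | p1 ;; p2 => (cost p1 + cost p2)%N
  | IfLt e1 e2 p1 p2 => (cost_nexpr e1 + (cost_nexpr e2 + (cost p1 + cost p2).+1))%N
  | For _ _ p1 => (1 + (b * (cost p1 + 2).+1 + 1))%N
  end.

End Cost.

Fixpoint size_stmt (p : stmt) : nat :=
  match p with
  | p1 ;; p2 => (size_stmt p1 + size_stmt p2)%N
  | IfLt e1 e2 p1 p2 => (cost_nexpr e1 + cost_nexpr e2 + 1 + size_stmt p1 + size_stmt p2)%N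
  | For _ _ p1 => (size_stmt p1 + 5)%N
  | _ => cost 0 p
  end.

Fixpoint nesting (p : stmt) : nat :=
  match p with
  | p1 ;; p2 | IfLt _ _ p1 p2 => maxn (nesting p1) (nesting p2)
  | For _ _ p1 => (nesting p1).+1
  | _ => 0%N
  end.

Lemma cost_le (b d : nat) (p : stmt) : (nesting p <= d)%N -> (cost b p <= size_stmt p * b.+1 ^ d)%N.
Proof.
have pow_gt0 k : (0 < b.+1 ^ k)%N by rewrite expn_gt0.
have le_mul_pow x k : (x <= x * b.+1 ^ k)%N by rewrite leq_pmulr.
elim: p d => [r e|x e|q i e|x i j|r|p1 IH1 p2 IH2|e1 e2 p1 IH1 p2 IH2|i r p1 IH] d /=;
  rewrite ?le_mul_pow // ?geq_max.
- by move=> /andP[/IH1 le1 /IH2 le2]; rewrite mulnDl leq_add.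
- move=> /andP[/IH1 le1 /IH2 le2]; rewrite !mulnDl.
  have := le_mul_pow (cost_nexpr e1) d; have := le_mul_pow (cost_nexpr e2) d.
  by have := pow_gt0 d; lia.
- case: d => // d /IH le1; rewrite expnS; move: (pow_gt0 d) le1; set X := (b.+1 ^ d)%N => X_gt0 le1.
  have : (b * (cost b p1 + 2).+1 <= b * (size_stmt p1 * X + 3))%N by rewrite leq_mul2l; lia.
  by nia.
Qed.

Fixpoint wf_nexpr (e : nexpr) : bool :=
  match e with
  | NReg r => (r < 32)%N
  | NLit _ => true
  | NBin _ e1 e2 => wf_nexpr e1 && wf_nexpr e2
  | NHalve e1 => wf_nexpr e1
  end.

Fixpoint wf_rexpr (e : rexpr) (k : nat) : bool :=
  (k < 31)%N &&
  match e with
  | XReg x => (x < 32)%N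
  | XNat e1 => wf_nexpr e1
  | XArr q e1 => (q < 8)%N && wf_nexpr e1
  | XBin _ e1 e2 => wf_rexpr e1 k && wf_rexpr e2 k.+1
  end.

Fixpoint writesN (p : stmt) : seq nat :=
  match p with
  | SetN r _ | Toss r => [:: r]
  | p1 ;; p2 | IfLt _ _ p1 p2 => writesN p1 ++ writesN p2
  | For i _ p1 => i :: writesN p1
  | _ => [::]
  end.

Fixpoint writesX (p : stmt) : seq nat :=
  match p with
  | SetX x _ | Ask x _ _ => [:: x]
  | p1 ;; p2 | IfLt _ _ p1 p2 => writesX p1 ++ writesX p2
  | For _ _ p1 => writesX p1
  | _ => [::]
  end.

Fixpoint writesA (p : stmt) : seq nat :=
  match p with
  | SetA q _ _ => [:: q]
  | p1 ;; p2 | IfLt _ _ p1 p2 => writesA p1 ++ writesA p2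
  | For _ _ p1 => writesA p1
  | _ => [::]
  end.

Fixpoint toss_free (p : stmt) : bool :=
  match p with
  | Toss _ => false
  | p1 ;; p2 | IfLt _ _ p1 p2 => toss_free p1 && toss_free p2
  | For _ _ p1 => toss_free p1
  | _ => true
  end.

(* The registers in [bounds] hold loop bounds; the program must not write to them. *)
Fixpoint wf (bounds : seq nat) (p : stmt) : bool :=
  match p with
  | SetN r e => [&& (r < 32)%N, r \notin bounds & wf_nexpr e]
  | SetX x e => (x < 32)%N && wf_rexpr e 0
  | SetA q i e => [&& (q < 8)%N, wf_nexpr i & wf_rexpr e 0]
  | Ask x i j => [&& (x < 32)%N, wf_nexpr i & wf_nexpr j]
  | Toss r => (r < 32)%N && (r \notin bounds)
  | p1 ;; p2 => wf bounds p1 && wf bounds p2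
  | IfLt e1 e2 p1 p2 => [&& wf_nexpr e1, wf_nexpr e2, wf bounds p1 & wf bounds p2]
  | For i r p1 => [&& (i < 32)%N, (r < 32)%N, i \notin bounds, r \in bounds,
      i \notin writesN p1 & wf bounds p1]
  end.

Lemma wf_writesN (bounds : seq nat) (p : stmt) (k : nat) :
  wf bounds p -> k \in bounds -> k \notin writesN p.
Proof.
have neq r : k \in bounds -> r \notin bounds -> k != r by move=> k_in; apply: contraNneq => <-.
elim: p => [r e|x e|q i e|x i j|r|p1 IH1 p2 IH2|e1 e2 p1 IH1 p2 IH2|i r p1 IH] //=.
- by move=> /and3P[_ r_out _] k_in; rewrite inE neq.
- by move=> /andP[_ r_out] k_in; rewrite inE neq.
- by move=> /andP[wf1 wf2] k_in; rewrite mem_cat negb_or IH1 ?IH2.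
- by move=> /and4P[_ _ wf1 wf2] k_in; rewrite mem_cat negb_or IH1 ?IH2.
- by move=> /and5P[_ _ i_out _ /andP[_ wf1]] k_in; rewrite inE negb_or neq // IH.
Qed.

(** * Semantics of the language *)

Lemma updE (V : Type) (f : nat -> V) k v : upd f k v k = v.
Proof. by rewrite /upd eqxx. Qed.

Lemma updNE (V : Type) (f : nat -> V) k v j : j != k -> upd f k v j = f j.
Proof. by rewrite /upd => /negPf ->. Qed.

Section Semantics.
Variables (R : realType) (B : nat -> nat -> R) (w : nat -> bool).

Record env : Type := Env {
  nreg : nat -> nat;
  xreg : nat -> R;
  arr : nat -> nat -> R;
  tossed : nat }.

Implicit Types (a : env) (p : stmt) (e : nexpr) (i j k r q x : nat).

Definition set_nreg a r v := Env (upd (nreg a) r v) (xreg a) (arr a) (tossed a).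
Definition set_xreg a x v := Env (nreg a) (upd (xreg a) x v) (arr a) (tossed a).
Definition set_arr a q i v :=
  Env (nreg a) (xreg a) (upd (arr a) q (upd (arr a q) i v)) (tossed a).

Fixpoint eval_nexpr e (N : nat -> nat) : nat :=
  match e with
  | NReg r => N r
  | NLit c => c
  | NBin op e1 e2 => nop_fun op (eval_nexpr e1 N) (eval_nexpr e2 N)
  | NHalve e1 => (eval_nexpr e1 N)./2
  end.

Fixpoint eval_rexpr (e : rexpr) a : R :=
  match e with
  | XReg x => xreg a x
  | XNat e1 => (eval_nexpr e1 (nreg a))%:R
  | XArr q e1 => arr a q (eval_nexpr e1 (nreg a))
  | XBin op e1 e2 => rop_fun op (eval_rexpr e1 a) (eval_rexpr e2 a)
  end.

Fixpoint denote p a : env :=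
  match p with
  | SetN r e => set_nreg a r (eval_nexpr e (nreg a))
  | SetX x e => set_xreg a x (eval_rexpr e a)
  | SetA q i e => set_arr a q (eval_nexpr i (nreg a)) (eval_rexpr e a)
  | Ask x i j => set_xreg a x (B (eval_nexpr i (nreg a)) (eval_nexpr j (nreg a)))
  | Toss r => Env (upd (nreg a) r (w (tossed a) : nat)) (xreg a) (arr a) (tossed a).+1
  | p1 ;; p2 => denote p2 (denote p1 a)
  | IfLt e1 e2 p1 p2 =>
      if (eval_nexpr e1 (nreg a) < eval_nexpr e2 (nreg a))%N then denote p1 a else denote p2 a
  | For i r p1 =>
      iter (nreg a r) (fun a => set_nreg (denote p1 a) i (nreg (denote p1 a) i).+1) (set_nreg a i 0)
  end.

Lemma denote_nreg p a k : k \notin writesN p -> nreg (denote p a) k = nreg a k.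
Proof.
elim: p a => [r e|x e|q i e|x i j|r|p1 IH1 p2 IH2|e1 e2 p1 IH1 p2 IH2|i r p1 IH] a //=.
- by rewrite inE => neq; rewrite updNE.
- by rewrite inE => neq; rewrite updNE.
- by rewrite mem_cat negb_or => /andP[out1 out2]; rewrite IH2 ?IH1.
- by rewrite mem_cat negb_or => /andP[out1 out2]; case: ifP => _; rewrite ?IH1 ?IH2.
- rewrite inE negb_or => /andP[neq out].
  by elim: (nreg a r) => [|m IHm] /=; rewrite updNE // IH.
Qed.

Lemma denote_xreg p a k : k \notin writesX p -> xreg (denote p a) k = xreg a k.
Proof.
elim: p a => [r e|x e|q i e|x i j|r|p1 IH1 p2 IH2|e1 e2 p1 IH1 p2 IH2|i r p1 IH] a //=.
- by rewrite inE => neq; rewrite updNE.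
- by rewrite inE => neq; rewrite updNE.
- by rewrite mem_cat negb_or => /andP[out1 out2]; rewrite IH2 ?IH1.
- by rewrite mem_cat negb_or => /andP[out1 out2]; case: ifP => _; rewrite ?IH1 ?IH2.
- by move=> out; elim: (nreg a r) => [|m IHm] //=; rewrite IH.
Qed.

Lemma denote_arr p a k : k \notin writesA p -> arr (denote p a) k = arr a k.
Proof.
elim: p a => [r e|x e|q i e|x i j|r|p1 IH1 p2 IH2|e1 e2 p1 IH1 p2 IH2|i r p1 IH] a //=.
- by rewrite inE => neq; rewrite updNE.
- by rewrite mem_cat negb_or => /andP[out1 out2]; rewrite IH2 ?IH1.
- by rewrite mem_cat negb_or => /andP[out1 out2]; case: ifP => _; rewrite ?IH1 ?IH2.
- by move=> out; elim: (nreg a r) => [|m IHm] //=; rewrite IH.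
Qed.

Lemma denote_tossed p a : toss_free p -> tossed (denote p a) = tossed a.
Proof.
elim: p a => [r e|x e|q i e|x i j|r|p1 IH1 p2 IH2|e1 e2 p1 IH1 p2 IH2|i r p1 IH] a //=.
- by move=> /andP[free1 free2]; rewrite IH2 ?IH1.
- by move=> /andP[free1 free2]; case: ifP => _; rewrite ?IH1 ?IH2.
- by move=> free; elim: (nreg a r) => //= m IHm; rewrite IH.
Qed.

Definition frame p a a' : Prop :=
  [/\ forall k, k \notin writesN p -> nreg a' k = nreg a k,
      forall k, k \notin writesX p -> xreg a' k = xreg a k &
      forall k, k \notin writesA p -> arr a' k = arr a k].

Section Loops.
Variables (i r : nat) (p : stmt) (a : env).

Definition for_step a' := set_nreg (denote p a') i (nreg (denote p a') i).+1.

Lemma iter_for_step m (a' := iter m for_step (set_nreg a i 0)) :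
  i \notin writesN p -> nreg a' i = m /\ frame (For i r p) a a'.
Proof.
rewrite {}/a' => i_out; elim: m => [|m [im [frN frX frA]]] /=.
  rewrite updE; split=> //; split=> k //=; rewrite inE negb_or => /andP[neq _].
  by rewrite updNE.
rewrite updE denote_nreg // im; split=> //; split=> k out.
- by have := out; rewrite /= inE negb_or => /andP[ki kp]; rewrite updNE // denote_nreg // frN.
- by rewrite denote_xreg // frX.
- by rewrite denote_arr // frA.
Qed.

Lemma denote_for_ind (Inv : nat -> env -> Prop) :
  i \notin writesN p ->
  Inv 0%N (set_nreg a i 0) ->
  (forall t a', (t < nreg a r)%N -> nreg a' i = t -> frame (For i r p) a a' -> Inv t a' ->
     Inv t.+1 (set_nreg (denote p a') i t.+1)) ->
  Inv (nreg a r) (denote (For i r p) a).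
Proof.
move=> i_out Inv0 InvS.
suff loop m : (m <= nreg a r)%N -> Inv m (iter m for_step (set_nreg a i 0)) by exact: loop.
elim: m => [|m IH] m_lt //=; have [im fr] := iter_for_step m i_out.
by rewrite /for_step denote_nreg // im; apply: InvS => //; apply: IH; exact: ltnW.
Qed.

Lemma denote_for_fill q o (f : nat -> R) :
  i \notin writesN p ->
  (forall t a', (t < nreg a r)%N -> nreg a' i = t -> frame (For i r p) a a' ->
     arr a' q (o + t)%N = arr a q (o + t)%N ->
     arr (denote p a') q = upd (arr a' q) (o + t)%N (f t)) ->
  forall k, arr (denote (For i r p) a) q k =
    if (o <= k < o + nreg a r)%N then f (k - o)%N else arr a q k.
Proof.
move=> i_out body.
pose Inv t a' := forall k, arr a' q k = if (o <= k < o + t)%N then f (k - o)%N else arr a q k.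
apply: (denote_for_ind (Inv := Inv)) => [//|k|t a' t_lt it fr IH k].
  by rewrite ifF //; lia.
rewrite /set_nreg /= (body t a' t_lt it fr) ?IH ?ltnn ?andbF // /upd; case: eqP => [->|neq].
  by rewrite addKn leq_addr addnS ltnS leqnn.
by rewrite IH; congr (if _ then _ else _); lia.
Qed.

Lemma denote_for_sum x (f : nat -> R) :
  i \notin writesN p ->
  (forall t a', (t < nreg a r)%N -> nreg a' i = t -> frame (For i r p) a a' ->
     xreg (denote p a') x = xreg a' x + f t) ->
  xreg (denote (For i r p) a) x = xreg a x + \sum_(t < nreg a r) f t.
Proof.
move=> i_out body.
apply: (denote_for_ind (Inv := fun t a' => xreg a' x = xreg a x + \sum_(t' < t) f t')) => //.
  by rewrite big_ord0 addr0.
by move=> t a' t_lt it fr IH; rewrite big_ord_recr /= (body t a' t_lt it fr) IH addrA.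
Qed.

Lemma denote_for_count k c : i \notin writesN p -> k != i ->
  (forall a', frame (For i r p) a a' -> nreg (denote p a') k = (nreg a' k + c)%N) ->
  nreg (denote (For i r p) a) k = (nreg a k + nreg a r * c)%N.
Proof.
move=> i_out ki body.
apply: (denote_for_ind (Inv := fun t a' => nreg a' k = (nreg a k + t * c)%N)) => //.
  by rewrite /= updNE // addn0.
by move=> t a' _ _ fr IH; rewrite /= updNE // body // IH mulSnr addnA.
Qed.

End Loops.

Definition sim (s : state R) a : Prop :=
  [/\ forall j, (j < 32)%N -> nmem s j = nreg a j,
      forall j, (j < 32)%N -> rmem s j = xreg a j,
      forall q i, (q < 8)%N -> rmem s (arr_addr q i) = arr a q i &
      coins s = tossed a].

Local Notation halts := (@halts_within R B w).

Lemma halts_seq T1 T2 c1 c2 s s1 s2 :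
  halts T1 c1 s s1 -> halts T2 c2 s1 s2 -> halts (T1 + T2) (Seq c1 c2) s s2.
Proof.
move=> [t1 le1 ex1] [t2 le2 ex2]; exists (t1 + t2)%N; first exact: leq_add.
exact: ExecSeq ex1 ex2.
Qed.

Lemma halts_do ins s : halts 1 (Do ins) s (step B w ins s).
Proof. by exists 1%N => //; constructor. Qed.

Lemma halts_le T T' c s s' : (T <= T')%N -> halts T c s s' -> halts T' c s s'.
Proof. by move=> leT [t le_t ex]; exists t => //; exact: leq_trans leT. Qed.

Lemma eq_eval_nexpr e N N' : wf_nexpr e -> (forall j, (j < 32)%N -> N j = N' j) ->
  eval_nexpr e N = eval_nexpr e N'.
Proof.
move=> + eqN; elim: e => //= [op e1 IH1 e2 IH2|e1 IH1].
  by move=> /andP[/IH1 -> /IH2 ->].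
by move=> /IH1 ->.
Qed.

Definition evaluates_nat T c k (s : state R) v : Prop :=
  exists s', [/\ halts T c s s', rmem s' = rmem s, coins s' = coins s,
    (forall j, (j < temp k)%N -> nmem s' j = nmem s j) & nmem s' (temp k) = v].

Lemma compile_nexprP e k s : wf_nexpr e ->
  evaluates_nat (cost_nexpr e) (compile_nexpr e k) k s (eval_nexpr e (nmem s)).
Proof.
elim: e k s => [r|c|op e1 IH1 e2 IH2|e1 IH1] k s /=.
- move=> r_lt; eexists; split; first by apply: halts_seq (halts_do _ _) (halts_do _ _).
  + by [].
  + by [].
  + by move=> j j_lt /=; rewrite !updNE //; lia.
  + by rewrite /= !updE addn0 updNE //; lia.
- move=> _; eexists; split; first exact: halts_do.
  + by [].
  + by [].
  + by move=> j j_lt /=; rewrite updNE //; lia.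
  + by rewrite /= updE.
- move=> /andP[wf1 wf2].
  have [s1 [run1 rmem1 coins1 nmem1 val1]] := IH1 k s wf1.
  have [s2 [run2 rmem2 coins2 nmem2 val2]] := IH2 k.+1 s1 wf2.
  have opE : step B w (nop_instr op (temp k) (temp k) (temp k.+1)) s2 =
      setN s2 (temp k) (nop_fun op (nmem s2 (temp k)) (nmem s2 (temp k.+1))) by case: (op).
  eexists; split; first by apply: halts_seq run1 (halts_seq run2 (halts_do _ _)).
  + by rewrite opE /= rmem2.
  + by rewrite opE /= coins2.
  + by move=> j j_lt; rewrite opE /= updNE ?nmem2 ?nmem1 //; lia.
  + rewrite opE /= updE nmem2 ?val1 ?val2 ?addnS //; congr nop_fun.
    by apply: eq_eval_nexpr => // j j_lt; apply: nmem1; lia.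
- move=> wf1; have [s1 [run1 rmem1 coins1 nmem1 val1]] := IH1 k s wf1.
  eexists; split; first by apply: halts_seq run1 (halts_do _ _).
  + by rewrite /= rmem1.
  + by rewrite /= coins1.
  + by move=> j j_lt /=; rewrite updNE ?nmem1 //; lia.
  + by rewrite /= updE val1.
Qed.

Lemma compile_addrP q s : exists s', [/\ halts 5 (compile_addr q) s s',
  rmem s' = rmem s, coins s' = coins s, (forall j, (j < 32)%N -> nmem s' j = nmem s j) &
  nmem s' 32 = arr_addr q (nmem s 32)].
Proof.
eexists; split.
- exact: (halts_seq (halts_do _ _) (halts_seq (halts_do _ _) (halts_seq (halts_do _ _)
    (halts_seq (halts_do _ _) (halts_do _ _))))).
- by [].
- by [].
- by move=> j j_lt /=; rewrite !updNE //; lia.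
- by rewrite /= /upd /= /arr_addr; lia.
Qed.

Lemma arr_addr_ge q i : (64 <= arr_addr q i)%N.
Proof. by rewrite /arr_addr -addnA leq_addr. Qed.

Lemma arr_addr_inj q q' i i' : (q < 8)%N -> (q' < 8)%N ->
  arr_addr q i = arr_addr q' i' -> q = q' /\ i = i'.
Proof. by rewrite /arr_addr => q_lt q'_lt eq_addr; split; lia. Qed.

Definition keeps_regs k (s s' : state R) : Prop :=
  [/\ coins s' = coins s, (forall j, (j < 32)%N -> nmem s' j = nmem s j) &
      (forall j, (j < temp k)%N || (64 <= j)%N -> rmem s' j = rmem s j)].

Lemma keeps_regs_sim k s s' a : keeps_regs k s s' -> sim s a -> sim s' a.
Proof.
move=> [eq_coins eq_nmem eq_rmem] [simN simX simA simC]; split.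
- by move=> j j_lt; rewrite eq_nmem ?simN.
- by move=> j j_lt; rewrite eq_rmem ?simX //; lia.
- by move=> q i q_lt; rewrite eq_rmem ?simA // arr_addr_ge orbT.
- by rewrite eq_coins.
Qed.

Lemma sim_nexpr e k s a : sim s a -> wf_nexpr e -> exists s',
  [/\ halts (cost_nexpr e) (compile_nexpr e k) s s', rmem s' = rmem s,
      (forall j, (j < temp k)%N -> nmem s' j = nmem s j), sim s' a &
      nmem s' (temp k) = eval_nexpr e (nreg a)].
Proof.
move=> sim_s wf_e; have [s' [run eq_rmem eq_coins eq_nmem val]] := compile_nexprP k s wf_e.
exists s'; split=> //.
  by apply: (@keeps_regs_sim k s) => //; split=> // j j_lt; rewrite ?eq_rmem // eq_nmem //; lia.
by rewrite val; apply: eq_eval_nexpr => // j j_lt; case: sim_s => ->.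
Qed.

Lemma sim_rexpr (e : rexpr) k s a : sim s a -> wf_rexpr e k -> exists s',
  [/\ halts (cost_rexpr e) (compile_rexpr e k) s s', keeps_regs k s s' &
      rmem s' (temp k) = eval_rexpr e a].
Proof.
elim: e k s => [x|e1|q e1|op e1 IH1 e2 IH2] k s sim_s /=.
- move=> /andP[k_lt x_lt]; have [_ simX _ _] := sim_s.
  eexists; split.
  + by apply: halts_seq (halts_do _ _) (halts_seq (halts_do _ _) (halts_do _ _)).
  + split=> [//|j j_lt|j j_lt] /=; first by rewrite updNE //; lia.
    by rewrite !updNE //; lia.
  by rewrite /= !updE updNE ?simX ?addr0 //; lia.
- move=> /andP[k_lt wf1].
  have [s1 [run1 rmem1 nmem1 [simN simX simA simC] val1]] := sim_nexpr 0 sim_s wf1.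
  have [simN0 _ _ simC0] := sim_s.
  eexists; split; first by apply: halts_seq run1 (halts_do _ _).
    split=> [|j j_lt|j j_lt] /=; first by rewrite simC simC0.
      by rewrite nmem1 // addn0.
    by rewrite updNE ?rmem1 //; lia.
  by rewrite /= updE; move: val1; rewrite addn0 => ->.
- move=> /and3P[k_lt q_lt wf1].
  have [s1 [run1 rmem1 nmem1 [simN simX simA simC] val1]] := sim_nexpr 0 sim_s wf1.
  have [_ _ simA0 simC0] := sim_s.
  have [s2 [run2 rmem2 coins2 nmem2 val2]] := compile_addrP q s1.
  eexists; split; first by apply: halts_seq run1 (halts_seq run2 (halts_do _ _)).
    split=> [|j j_lt|j j_lt] /=; first by rewrite coins2 simC simC0.
      by rewrite nmem2 ?nmem1 // addn0.
    by rewrite updNE ?rmem2 ?rmem1 //; lia.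
  by rewrite /= updE val2 rmem2 simA //; move: val1; rewrite addn0 => ->.
- move=> /and3P[k_lt wf1 wf2].
  have [s1 [run1 keep1 val1]] := IH1 k s sim_s wf1.
  have [s2 [run2 keep2 val2]] := IH2 k.+1 s1 (keeps_regs_sim keep1 sim_s) wf2.
  have [coins1 nmem1 rmem1] := keep1; have [coins2 nmem2 rmem2] := keep2.
  have opE : step B w (rop_instr op (temp k) (temp k) (temp k.+1)) s2 =
      Defs.setX s2 (temp k) (rop_fun op (rmem s2 (temp k)) (rmem s2 (temp k.+1))) by case: (op).
  eexists; split; first by apply: halts_seq run1 (halts_seq run2 (halts_do _ _)).
    rewrite opE; split=> [|j j_lt|j j_lt] /=; first by rewrite coins2.
      by rewrite nmem2 ?nmem1.
    by rewrite updNE ?rmem2 ?rmem1 //; lia.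
  by rewrite opE /= updE val2 rmem2 ?val1 //; lia.
Qed.

Definition runs (T : nat) (c : cmd) a a' : Prop :=
  forall s, sim s a -> exists2 s', halts T c s s' & sim s' a'.

Lemma runs_le T T' c a a' : (T <= T')%N -> runs T c a a' -> runs T' c a a'.
Proof. by move=> leT run s /run[s' halt sim']; exists s' => //; exact: halts_le halt. Qed.

Lemma runs_seq T1 T2 c1 c2 a a1 a2 :
  runs T1 c1 a a1 -> runs T2 c2 a1 a2 -> runs (T1 + T2) (Seq c1 c2) a a2.
Proof.
move=> run1 run2 s /run1[s1 halt1 /run2[s2 halt2 sim2]]; exists s2 => //.
exact: halts_seq halt1 halt2.
Qed.

Lemma runs_setN r e a : (r < 32)%N -> wf_nexpr e ->
  runs (cost_nexpr e + 2) (compile (SetN r e)) a (denote (SetN r e) a).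
Proof.
move=> r_lt wf_e s sim_s.
have [s1 [run1 rmem1 nmem1 [simN simX simA simC] val1]] := sim_nexpr 0 sim_s wf_e.
eexists; first by apply: halts_seq run1 (@halts_seq 1 1 _ _ _ _ _ (halts_do _ _) (halts_do _ _)).
split=> //= j j_lt; rewrite /upd /=; case: eqP => // _; last by rewrite ifF ?simN //; lia.
by rewrite addn0; move: val1; rewrite addn0.
Qed.

Lemma runs_setX x (e : rexpr) a : (x < 32)%N -> wf_rexpr e 0 ->
  runs (cost_rexpr e + 3) (compile (SetX x e)) a (denote (SetX x e) a).
Proof.
move=> x_lt wf_e s sim_s; have [s1 [run1 keep1 val1]] := sim_rexpr sim_s wf_e.
have [simN simX simA simC] := keeps_regs_sim keep1 sim_s.
eexists; first by apply: halts_seq run1 (@halts_seq 1 2 _ _ _ _ _ (halts_do _ _)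
  (@halts_seq 1 1 _ _ _ _ _ (halts_do _ _) (halts_do _ _))).
split=> //= [j j_lt|j j_lt|q i q_lt].
- by rewrite updNE ?simN //; lia.
- rewrite /upd /=; case: eqP => // _; last by rewrite ifF ?simX //; lia.
  by move: val1; rewrite addn0 addr0.
- by have addr_ge := arr_addr_ge q i; rewrite !updNE ?simA //; lia.
Qed.

Lemma runs_setA q (i : nexpr) (e : rexpr) a : (q < 8)%N -> wf_nexpr i -> wf_rexpr e 0 ->
  runs (cost_rexpr e + (cost_nexpr i + (5 + 1))) (compile (SetA q i e)) a (denote (SetA q i e) a).
Proof.
move=> q_lt wf_i wf_e s sim_s; have [s1 [run1 keep1 val1]] := sim_rexpr sim_s wf_e.
have [s2 [run2 rmem2 _ [simN simX simA simC] val2]] :=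
  sim_nexpr 0 (keeps_regs_sim keep1 sim_s) wf_i.
have [s3 [run3 rmem3 coins3 nmem3 val3]] := compile_addrP q s2.
eexists; first by apply: halts_seq run1 (halts_seq run2 (halts_seq run3 (halts_do _ _))).
have addrE : nmem s3 32 = arr_addr q (eval_nexpr i (nreg a)).
  by rewrite val3; move: val2; rewrite addn0 => ->.
have valE : rmem s3 32 = eval_rexpr e a by rewrite rmem3 rmem2; move: val1; rewrite addn0.
split=> /= [j j_lt|j j_lt|q' i' q'_lt|].
- by rewrite nmem3 ?simN.
- by rewrite addrE updNE ?rmem3 ?simX //; have := arr_addr_ge q (eval_nexpr i (nreg a)); lia.
- rewrite addrE valE /upd rmem3 simA //; case: eqP => [/arr_addr_inj[] // -> ->|neq].
    by rewrite !eqxx.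
  case: eqP => // eq_q; subst q'; case: eqP => // eq_i.
  by case: neq; rewrite eq_i.
- by rewrite coins3.
Qed.

Lemma runs_ask x (i j : nexpr) a : (x < 32)%N -> wf_nexpr i -> wf_nexpr j ->
  runs (cost_nexpr i + (cost_nexpr j + 1)) (compile (Ask x i j)) a (denote (Ask x i j) a).
Proof.
move=> x_lt wf_i wf_j s sim_s; have [s1 [run1 rmem1 _ sim1 val1]] := sim_nexpr 0 sim_s wf_i.
have [s2 [run2 rmem2 nmem2 [simN simX simA simC] val2]] := sim_nexpr 1 sim1 wf_j.
eexists; first by apply: halts_seq run1 (halts_seq run2 (halts_do _ _)).
split=> //= [k k_lt|q k q_lt].
  by rewrite nmem2 // /upd simX //; move: val1 val2; rewrite addn0 => -> ->.
by have addr_ge := arr_addr_ge q k; rewrite updNE ?simA //; lia.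
Qed.

Lemma runs_toss r a : (r < 32)%N -> runs 1 (compile (Toss r)) a (denote (Toss r) a).
Proof.
move=> r_lt s [simN simX simA simC]; eexists; first exact: halts_do.
by split=> //= [j j_lt|]; rewrite ?simC // /upd simN.
Qed.

Lemma runs_ifLt e1 e2 c1 c2 T a a' : wf_nexpr e1 -> wf_nexpr e2 ->
  runs T (if (eval_nexpr e1 (nreg a) < eval_nexpr e2 (nreg a))%N then c1 else c2) a a' ->
  runs (cost_nexpr e1 + (cost_nexpr e2 + T.+1))
    (Seq (compile_nexpr e1 0) (Seq (compile_nexpr e2 1) (If (NLt 32 33) c1 c2))) a a'.
Proof.
move=> wf1 wf2 branch s sim_s; have [s1 [run1 _ _ sim1 val1]] := sim_nexpr 0 sim_s wf1.
have [s2 [run2 _ nmem2 sim2 val2]] := sim_nexpr 1 sim1 wf2.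
have testE : holds (NLt 32 33) s2 = (eval_nexpr e1 (nreg a) < eval_nexpr e2 (nreg a))%N.
  by rewrite /= nmem2 //; move: val1 val2; rewrite addn0 => -> ->.
have [s3 [t3 le3 exec3] sim3] := branch s2 sim2.
exists s3 => //; apply: halts_seq run1 (halts_seq run2 _).
by exists t3.+1 => //; apply: ExecIf; rewrite testE.
Qed.

Definition env_holds (t : test) a : bool :=
  match t with NLt i j => (nreg a i < nreg a j)%N | RLt x y => xreg a x < xreg a y end.

Definition wf_test (t : test) : bool :=
  match t with NLt i j | RLt i j => (i < 32)%N && (j < 32)%N end.

Lemma runs_while t c (f : env -> env) T k a : wf_test t ->
  (forall m, (m < k)%N ->
     env_holds t (iter m f a) /\ runs T c (iter m f a) (iter m.+1 f a)) ->
  ~~ env_holds t (iter k f a) -> runs (k * T.+1 + 1) (While t c) a (iter k f a).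
Proof.
move=> wf_t; have testE s a' : sim s a' -> holds t s = env_holds t a'.
  by case: t wf_t => i j /= /andP[i_lt j_lt] [simN simX _ _]; rewrite ?simN ?simX.
elim: k a => [|k IH] a body stop s sim_s.
  by exists s => //; exists 1%N => //; apply: ExecWhileF; rewrite (testE _ _ sim_s).
have [go run1] := body 0%N (ltn0Sn k).
have [s1 [t1 le1 exec1] sim1] := run1 s sim_s.
have [||s2 [t2 le2 exec2] sim2] := IH (f a) _ _ s1 sim1.
- by move=> m mk; rewrite -!iterSr; exact: body.
- by rewrite -iterSr.
exists s2; last by rewrite iterSr.
exists (t1 + t2).+1; first by rewrite mulSn; lia.
by apply: ExecWhileT exec1 exec2; rewrite (testE _ _ sim_s).
Qed.

Lemma runs_for i r p T a : (i < 32)%N -> (r < 32)%N -> r != i ->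
  i \notin writesN p -> r \notin writesN p ->
  (forall a', frame (For i r p) a a' -> runs T (compile p) a' (denote p a')) ->
  runs (1 + (nreg a r * (T + 2).+1 + 1)) (compile (For i r p)) a (denote (For i r p) a).
Proof.
move=> i_lt r_lt ri i_out r_out body.
have incr a1 : runs 2 (Seq (Do (NConst 32 1)) (Do (NAdd i i 32))) a1 (set_nreg a1 i (nreg a1 i).+1).
  move=> s [simN simX simA simC]; eexists.
    exact: (@halts_seq 1 1 _ _ _ _ _ (halts_do _ _) (halts_do _ _)).
  split=> //= j j_lt; rewrite /upd /= (ltn_eqF i_lt) simN //.
  by case: eqP => _ //; rewrite ?addn1 // ifF ?simN //; lia.
have start : runs 1 (Do (NConst i 0)) a (set_nreg a i 0).
  move=> s [simN simX simA simC]; eexists; first exact: halts_do.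
  by split=> //= j j_lt; rewrite /upd simN.
have iterP m := iter_for_step r a m i_out.
have boundE m : nreg (iter m (for_step i p) (set_nreg a i 0)) r = nreg a r.
  by have [_ [frN _ _]] := iterP m; rewrite frN // inE negb_or ri.
apply: runs_seq start _; apply: runs_while => /= [|m m_lt|]; first by rewrite i_lt.
  have [im fr] := iterP m; rewrite im boundE m_lt; split=> //.
  by apply: runs_seq (body _ fr) _; exact: incr.
by have [-> _] := iterP (nreg a r); rewrite boundE ltnn.
Qed.

Lemma runs_compile bounds b p a : wf bounds p -> (forall r, r \in bounds -> (nreg a r <= b)%N) ->
  runs (cost b p) (compile p) a (denote p a).
Proof.
elim: p a => [r e|x e|q i e|x i j|r|p1 IH1 p2 IH2|e1 e2 p1 IH1 p2 IH2|i r p1 IH] a.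
- by move=> /and3P[r_lt _ wf_e] _; exact: runs_setN.
- by move=> /andP[x_lt wf_e] _; exact: runs_setX.
- by move=> /and3P[q_lt wf_i wf_e] _; exact: runs_setA.
- by move=> /and3P[x_lt wf_i wf_j] _; exact: runs_ask.
- by move=> /andP[r_lt _] _; exact: runs_toss.
- move=> /= /andP[wf1 wf2] le_b; apply: runs_seq (IH1 _ wf1 le_b) (IH2 _ wf2 _) => k k_in.
  by rewrite denote_nreg ?le_b // (wf_writesN wf1).
- move=> /= /and4P[wf_e1 wf_e2 wf1 wf2] le_b; apply: runs_ifLt => //.
  by case: ifP => _; [apply: runs_le (IH1 _ wf1 le_b)|apply: runs_le (IH2 _ wf2 le_b)]; lia.
- move=> /and5P[i_lt r_lt i_out r_in /andP[i_out1 wf1]] le_b.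
  apply: (runs_le (T := 1 + (nreg a r * (cost b p1 + 2).+1 + 1))) => /=.
    by rewrite leq_add2l leq_add2r leq_mul2r le_b ?orbT.
  apply: runs_for => //; [by apply: contraNneq i_out => <-|exact: wf_writesN wf1 _|].
  move=> a' [frN _ _]; apply: IH => // k k_in.
  rewrite frN ?le_b // inE negb_or (wf_writesN wf1 k_in) andbT.
  by apply: contraNneq i_out => <-.
Qed.

End Semantics.

Lemma denoteE (R : realType) (B : nat -> nat -> R) (w : nat -> bool) :
  (forall r e a, denote B w (SetN r e) a = set_nreg a r (eval_nexpr e (nreg a))) *
  (forall x e a, denote B w (SetX x e) a = set_xreg a x (eval_rexpr e a)) *
  (forall q i e a, denote B w (SetA q i e) a =
     set_arr a q (eval_nexpr i (nreg a)) (eval_rexpr e a)) *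
  (forall x i j a, denote B w (Ask x i j) a =
     set_xreg a x (B (eval_nexpr i (nreg a)) (eval_nexpr j (nreg a)))) *
  (forall r a, denote B w (Toss r) a =
     Env (upd (nreg a) r (w (tossed a) : nat)) (xreg a) (arr a) (tossed a).+1) *
  (forall e1 e2 p1 p2 a, denote B w (IfLt e1 e2 p1 p2) a =
     if (eval_nexpr e1 (nreg a) < eval_nexpr e2 (nreg a))%N then denote B w p1 a
     else denote B w p2 a).
Proof. by []. Qed.

Lemma denote_then (R : realType) (B : nat -> nat -> R) (w : nat -> bool) p1 p2 a :
  denote B w (p1 ;; p2) a = denote B w p2 (denote B w p1 a).
Proof. by []. Qed.

(* Keeps simplification from executing whole programs. *)
Opaque denote.

Definition frameE := (denote_nreg, denote_xreg, denote_arr, denote_tossed).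

(** * The program *)

Notation n_dim := 0%N (only parsing).
Notation n_row_arg := 1%N (only parsing).
Notation n_col_arg := 2%N (only parsing).
Notation n_bits := 3%N (only parsing).
Notation n_per_shell := 4%N (only parsing).
Notation n_shells := 5%N (only parsing).
Notation n_nodes := 6%N (only parsing).
Notation n_rounds := 7%N (only parsing).
Notation n_scale_bits := 8%N (only parsing).
Notation n_geo_step := 9%N (only parsing).
Notation n_geo_exp := 10%N (only parsing).
Notation n_i := 11%N (only parsing).
Notation n_j := 12%N (only parsing).
Notation n_pos := 13%N (only parsing).
Notation n_l := 14%N (only parsing).
Notation n_round := 15%N (only parsing).
Notation n_scale := 16%N (only parsing).
Notation n_row := 17%N (only parsing).
Notation n_col := 18%N (only parsing).
Notation n_pow := 19%N (only parsing).
Notation n_coin := 20%N (only parsing).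
Notation n_side := 21%N (only parsing).
Notation n_bit := 22%N (only parsing).
Notation n_halved := 24%N (only parsing).
Notation n_zero := 26%N (only parsing).
Notation n_unused := 31%N (only parsing).

Notation x_out := 0%N (only parsing).
Notation x_eps := 0%N (only parsing).
Notation x_geo := 1%N (only parsing).
Notation x_geo_block := 2%N (only parsing).
Notation x_geo_pow := 3%N (only parsing).
Notation x_acc := 4%N (only parsing).
Notation x_sqnorm := 5%N (only parsing).
Notation x_step := 6%N (only parsing).
Notation x_shell := 7%N (only parsing).
Notation x_node := 8%N (only parsing).
Notation x_rate := 9%N (only parsing).
Notation x_target := 10%N (only parsing).

Notation a_node := 0%N (only parsing).
Notation a_vec := 1%N (only parsing).
Notation a_img := 2%N (only parsing).
Notation a_kernel := 3%N (only parsing).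
Notation a_coef := 4%N (only parsing).

Definition Idle : stmt := SetN n_unused n_unused.

Definition WhenLt (e1 e2 : nexpr) (p : stmt) : stmt := IfLt e1 e2 p Idle.
Arguments WhenLt (e1 e2)%_nexpr_scope p.

(* X[x_geo] := 1 + y + ... + y^(m-1) by binary splitting of m < 2^N[n_bits]. *)
Definition GeoBody : stmt :=
  WhenLt (NLit 0) (n_geo_exp - (n_geo_exp./2 + n_geo_exp./2))
    (SetX x_geo (x_geo_block + x_geo_pow * x_geo)) ;;
  SetX x_geo_block (x_geo_block + x_geo_block * x_geo_pow) ;;
  SetX x_geo_pow (x_geo_pow * x_geo_pow) ;;
  SetN n_geo_exp (n_geo_exp./2).
Definition GeoInit (y : rexpr) (m : nexpr) : stmt :=
  SetX x_geo_pow y ;; SetN n_geo_exp m ;; SetX x_geo (XLit 0) ;; SetX x_geo_block (XLit 1).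
Definition Geo (y : rexpr) (m : nexpr) : stmt := GeoInit y m ;; For n_geo_step n_bits GeoBody.
Arguments Geo y%_rexpr_scope m%_nexpr_scope.

Definition power_of_geo (y : rexpr) : rexpr := XLit 1 + (y - XLit 1) * x_geo.

(* The matrix A[a_kernel] is stored row by row; A[a_img] := A[a_kernel] A[a_vec]. *)
Definition MatVecRow : stmt :=
  SetX x_acc (XLit 0) ;;
  For n_j n_nodes (SetX x_acc (x_acc + XArr a_kernel (n_pos + n_j) * XArr a_vec n_j)) ;;
  SetA a_img n_i x_acc ;;
  SetN n_pos (n_pos + n_nodes).
Definition MatVec : stmt := SetN n_pos (NLit 0) ;; For n_i n_nodes MatVecRow.

Definition GramColumn : stmt :=
  For n_i n_nodes
    (Geo (XArr a_node n_i * XArr a_node n_l) n_dim ;; SetA a_vec n_i (x_geo * x_geo)).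
Definition GsCoef : stmt :=
  For n_i n_nodes (SetA a_img n_i (XLit 0 - XArr a_img n_i)) ;;
  SetA a_img n_l (XArr a_img n_l + XLit 1).
Definition GsSqnorm : stmt :=
  SetX x_sqnorm (XLit 0) ;;
  For n_i n_nodes (SetX x_sqnorm (x_sqnorm + XArr a_img n_i * XArr a_vec n_i)).
Definition KernelRow : stmt :=
  For n_j n_nodes (SetA a_kernel (n_pos + n_j)
    (XArr a_kernel (n_pos + n_j) + XArr a_img n_i * XArr a_img n_j / x_sqnorm)) ;;
  SetN n_pos (n_pos + n_nodes).
Definition KernelUpdate : stmt := SetN n_pos (NLit 0) ;; For n_i n_nodes KernelRow.
Definition KernelStep : stmt := GramColumn ;; MatVec ;; GsCoef ;; GsSqnorm ;; KernelUpdate.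
Definition Kernel : stmt := For n_l n_nodes KernelStep.

Definition ReadBits (dst cnt : nat) : stmt :=
  SetN dst (NLit 0) ;;
  For n_bit n_bits (Toss n_coin ;; WhenLt n_bit cnt (SetN dst (dst + dst + n_coin))).
Definition Pow2 : stmt :=
  SetN n_pow (NLit 1) ;; For n_bit n_bits (WhenLt n_bit n_scale (SetN n_pow (n_pow + n_pow))).
Definition Draw : stmt :=
  ReadBits n_scale n_scale_bits ;; ReadBits n_row n_scale ;; ReadBits n_col n_scale ;;
  Toss n_side ;; Pow2.
Definition WhenAccepted (p : stmt) : stmt :=
  WhenLt n_scale (n_bits + NLit 1)
    (WhenLt (n_row + n_col) n_pow
      (WhenLt n_pow (n_row + n_col + NLit 1 + (n_row + n_col + NLit 1))
        (WhenLt (n_row + n_col + NLit 1 + n_side) (n_dim + NLit 1) p))).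
Definition Mirror : stmt :=
  WhenLt (NLit 0) n_side
    (SetN n_row (n_dim - NLit 1 - n_row) ;; SetN n_col (n_dim - NLit 1 - n_col)).

Definition EntryPowers : stmt :=
  For n_i n_nodes
    (Geo (XArr a_node n_i) (n_row + n_col) ;;
     SetA a_vec n_i (power_of_geo (XArr a_node n_i))).
Definition EntryError : stmt :=
  Ask x_step n_row n_col ;;
  For n_i n_nodes (SetX x_step (x_step - XArr a_coef n_i * XArr a_vec n_i)).
Definition ScaleStep : stmt :=
  SetX x_step (x_step * (XNat n_pow * XNat n_pow) / (XLit 16 * XNat n_nodes)).
Definition AddStep : stmt :=
  For n_i n_nodes (SetA a_coef n_i (XArr a_coef n_i + x_step * XArr a_img n_i)).
Definition SgdUpdate : stmt := EntryPowers ;; EntryError ;; ScaleStep ;; MatVec ;; AddStep.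
Definition SgdStep : stmt := Draw ;; WhenAccepted (Mirror ;; SgdUpdate).
Definition Sgd : stmt := For n_round n_rounds SgdStep.

Definition NodeGroup : stmt :=
  SetX x_node (XLit 1 - x_shell * (XLit 1 - XNat (n_j + NLit 1) / (XLit 5 * XNat n_per_shell))) ;;
  SetA a_node n_pos x_node ;;
  SetA a_node (n_pos + NLit 1) (XLit 0 - x_node) ;;
  SetA a_node (n_pos + NLit 2) (XLit 1 / x_node) ;;
  SetA a_node (n_pos + NLit 3) (XLit 0 - XLit 1 / x_node) ;;
  SetN n_pos (n_pos + NLit 4).
Definition NodeShell : stmt :=
  For n_j n_per_shell NodeGroup ;; SetX x_shell (x_shell * (XLit 4 / XLit 5)).
Definition Nodes : stmt :=
  (SetN n_pos (NLit 0) ;; SetX x_shell (XLit 1)) ;; For n_i n_shells NodeShell.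

Definition CountRounds : stmt :=
  SetN n_rounds (NLit 0) ;;
  For n_i n_per_shell (For n_j n_nodes (For n_l n_bits (SetN n_rounds (n_rounds + NLit 64)))).

Definition EntryU : stmt :=
  Geo (XArr a_node n_col_arg) n_row_arg ;;
  SetX x_out (XArr a_coef n_col_arg * power_of_geo (XArr a_node n_col_arg)).
Definition EntryV : stmt :=
  Geo (XArr a_node n_col_arg) n_row_arg ;; SetX x_out (power_of_geo (XArr a_node n_col_arg)).

Section Correctness.
Variables (R : realType) (B : nat -> nat -> R) (w : nat -> bool).
Implicit Types (a : env R) (i j l m n r t k : nat) (x : nat -> R).
Local Notation env := (env R).
Local Notation denote := (denote B w).

Lemma modn_pow2S m t : (m %% 2 ^ t.+1 = m %% 2 ^ t + odd (m %/ 2 ^ t) * 2 ^ t)%N.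
Proof.
rewrite {1}(divn_eq m (2 ^ t)) {1}(divn_eq (m %/ 2 ^ t) 2) modn2 mulnDl -mulnA -expnS -addnA.
rewrite modnMDl modn_small; first by rewrite addnC.
have := ltn_pmod m (_ : 0 < 2 ^ t)%N; rewrite expn_gt0 => /(_ isT).
by rewrite expnS; case: odd; lia.
Qed.

Lemma geo_body a (a' := denote GeoBody a) :
  [/\ xreg a' x_geo = if odd (nreg a n_geo_exp)
        then xreg a x_geo_block + xreg a x_geo_pow * xreg a x_geo else xreg a x_geo,
      xreg a' x_geo_block = xreg a x_geo_block + xreg a x_geo_block * xreg a x_geo_pow,
      xreg a' x_geo_pow = xreg a x_geo_pow * xreg a x_geo_pow &
      nreg a' n_geo_exp = (nreg a n_geo_exp)./2].
Proof.
have odd_test v : (0 < v - (v./2 + v./2))%N = odd v.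
  by have := odd_double_half v; rewrite -addnn; case: odd; lia.
by rewrite {}/a' 3!denote_then !denoteE /= odd_test; case: ifP => _; rewrite ?denoteE.
Qed.

Lemma sum_expD k l (y : R) :
  \sum_(i < k + l) y ^+ i = \sum_(i < k) y ^+ i + y ^+ k * \sum_(i < l) y ^+ i.
Proof.
rewrite big_split_ord /= mulr_sumr; congr (_ + _); apply: eq_bigr => i _.
by rewrite exprD.
Qed.

Lemma geo_sum (e : rexpr) (m : nexpr) a : (eval_nexpr m (nreg a) < 2 ^ nreg a n_bits)%N ->
  xreg (denote (Geo e m) a) x_geo = \sum_(i < eval_nexpr m (nreg a)) eval_rexpr e a ^+ i.
Proof.
set M := eval_nexpr m _; set y := eval_rexpr e a => M_lt.
rewrite denote_then; set a0 := denote (GeoInit e m) a.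
have bitsE : nreg a0 n_bits = nreg a n_bits by rewrite frameE.
pose Inv t (a' : env) := [/\ xreg a' x_geo = \sum_(i < M %% 2 ^ t) y ^+ i,
  xreg a' x_geo_block = \sum_(i < 2 ^ t) y ^+ i, xreg a' x_geo_pow = y ^+ (2 ^ t) &
  nreg a' n_geo_exp = (M %/ 2 ^ t)%N].
suff : Inv (nreg a0 n_bits) (denote (For n_geo_step n_bits GeoBody) a0).
  by rewrite bitsE => - [-> _ _ _]; rewrite modn_small.
apply: denote_for_ind => //.
  by split; rewrite /= ?modn1 ?big_ord0 ?big_ord1 ?expr0 ?expr1 ?divn1.
move=> t a' _ _ _ [geoE blockE powE expE].
have [geoE' blockE' powE' expE'] := geo_body a'.
have pow2S : (2 ^ t.+1 = 2 ^ t + 2 ^ t)%N by rewrite expnS mul2n addnn.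
split.
- rewrite [LHS]geoE' geoE blockE powE expE modn_pow2S.
  by case: odd; rewrite ?mul1n ?mul0n ?addn0 // addnC sum_expD.
- by rewrite [LHS]blockE' blockE powE pow2S sum_expD mulrC.
- by rewrite [LHS]powE' powE pow2S exprD.
- by rewrite [LHS]expE' expE expnSr divnMA divn2.
Qed.

Lemma power_of_geoE (e : rexpr) k a : xreg a x_geo = \sum_(i < k) eval_rexpr e a ^+ i ->
  eval_rexpr (power_of_geo e) a = eval_rexpr e a ^+ k.
Proof. by move=> /= ->; rewrite -subrX1 addrC subrK. Qed.

Lemma matvec_row a (a' := denote MatVecRow a) :
  nreg a' n_pos = (nreg a n_pos + nreg a n_nodes)%N /\
  arr a' a_img = upd (arr a a_img) (nreg a n_i)
    (\sum_(b < nreg a n_nodes) arr a a_kernel (nreg a n_pos + b) * arr a a_vec b).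
Proof.
rewrite {}/a' 3!denote_then !denoteE /= updE; split; first by rewrite !frameE.
rewrite (denote_for_sum (f := fun b => arr a a_kernel (nreg a n_pos + b) * arr a a_vec b)) //.
  by rewrite !frameE //= add0r.
by move=> t a' _ jt [frN _ frA]; rewrite denoteE /= updE jt frN // !frA.
Qed.

Lemma matvec a i : (i < nreg a n_nodes)%N ->
  arr (denote MatVec a) a_img i =
  \sum_(b < nreg a n_nodes) arr a a_kernel (i * nreg a n_nodes + b) * arr a a_vec b.
Proof.
set r := nreg a n_nodes => ir; rewrite denote_then denoteE.
set a0 := set_nreg _ _ _.
pose Inv t (a' : env) := nreg a' n_pos = (t * r)%N /\ forall i, (i < t)%N ->
  arr a' a_img i = \sum_(b < r) arr a a_kernel (i * r + b) * arr a a_vec b.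
suff [_ -> //] : Inv (nreg a0 n_nodes) (denote (For n_i n_nodes MatVecRow) a0).
apply: denote_for_ind => // t a' _ it [frN _ frA] [posE imgE].
have [posE' imgE'] := matvec_row a'.
split; first by rewrite /= updNE // posE' posE frN // mulSnr.
move=> j; rewrite ltnS leq_eqVlt [arr _]/= imgE' it /upd.
by case: eqP => [->|_ /= /imgE -> //]; rewrite frN // posE !frA.
Qed.

Lemma gram_column a i : (nreg a n_dim < 2 ^ nreg a n_bits)%N -> (i < nreg a n_nodes)%N ->
  arr (denote GramColumn a) a_vec i = exp_gram (nreg a n_dim) (arr a a_node) i (nreg a n_l).
Proof.
move=> dim_lt ir.
rewrite (denote_for_fill (o := 0)
  (f := fun i => exp_gram (nreg a n_dim) (arr a a_node) i (nreg a n_l))) ?ir ?subn0 //.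
move=> t a' _ it [frN _ frA] _; rewrite denote_then denoteE /= geo_sum /=; last by rewrite !frN.
by rewrite updE denote_nreg // denote_arr // it !frN // (frA a_node).
Qed.

Lemma gs_coef_spec a (K : nat -> nat -> R) (G : nat -> nat -> R) (l : nat) (r := nreg a n_nodes) :
  nreg a n_l = l -> (l < r)%N ->
  (forall i, (i < r)%N -> arr a a_img i = \sum_(b < r) K i b * G b l) ->
  forall i, (i < r)%N -> arr (denote GsCoef a) a_img i = gs_coef r G K l i.
Proof.
move=> lE lr imgE i ir; rewrite denote_then denoteE.
set a' := denote (For _ _ _) a.
have negE j : (j < r)%N -> arr a' a_img j = - \sum_(b < r) K j b * G b l.
  move=> jr; rewrite (denote_for_fill (o := 0) (f := fun j => - arr a a_img j)) ?jr ?subn0 ?imgE //.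
  by move=> t a1 _ it [frN _ frA] imgt; rewrite denoteE /= updE it sub0r imgt.
have lE' : nreg a' n_l = l by rewrite frameE.
rewrite /= lE' updE /upd /gs_coef; case: eqP => [->|_]; rewrite negE // ?add0r //.
by rewrite addrC.
Qed.

Lemma gs_sqnorm_spec a : xreg (denote GsSqnorm a) x_sqnorm =
  \sum_(i < nreg a n_nodes) arr a a_img i * arr a a_vec i.
Proof.
rewrite denote_then denoteE.
rewrite (denote_for_sum (f := fun i => arr a a_img i * arr a a_vec i)) /= ?add0r //.
by move=> t a' _ it [_ _ frA]; rewrite denoteE /= updE it !frA.
Qed.

Lemma kernel_update a i j (r := nreg a n_nodes) : (i < r)%N -> (j < r)%N ->
  arr (denote KernelUpdate a) a_kernel (i * r + j)%N =
  arr a a_kernel (i * r + j)%N + arr a a_img i * arr a a_img j / xreg a x_sqnorm.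
Proof.
move=> ir jr; rewrite denote_then denoteE; set a0 := set_nreg _ _ _.
pose new k := arr a a_kernel k + arr a a_img (k %/ r) * arr a a_img (k %% r) / xreg a x_sqnorm.
have newE i' j' : (j' < r)%N -> new (i' * r + j')%N =
    arr a a_kernel (i' * r + j')%N + arr a a_img i' * arr a a_img j' / xreg a x_sqnorm.
  move=> j'r; rewrite /new divnMDl ?modnMDl ?(leq_ltn_trans _ j'r) //.
  by rewrite modn_small // divn_small // addn0.
pose Inv t (a' : env) := nreg a' n_pos = (t * r)%N /\
  forall k, arr a' a_kernel k = if (k < t * r)%N then new k else arr a a_kernel k.
suff [_ ->] : Inv (nreg a0 n_nodes) (denote (For n_i n_nodes KernelRow) a0).
  by rewrite newE // ifT // -[nreg a0 n_nodes]/r; nia.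
apply: denote_for_ind => // t a' _ it [frN frX frA] [posE kernE].
have nodesE : nreg a' n_nodes = r by rewrite frN.
rewrite denote_then denoteE; set a1 := denote (For _ _ _) a'.
have a1E k : arr a1 a_kernel k = if (k < t.+1 * r)%N then new k else arr a a_kernel k.
  rewrite (denote_for_fill (o := (t * r)%N) (f := fun j => new (t * r + j)%N)) ?kernE //.
    rewrite nodesE mulSnr; case: (leqP (t * r) k) => [ge|lt] /=.
      by rewrite subnKC.
    by rewrite (leq_trans lt) // leq_addr.
  move=> t' a2 t'r jt' [frN' frX' frA'] kernt'.
  rewrite denoteE /= jt' frN' // posE kernt' kernE ltnNge leq_addr /=.
  rewrite updE newE -?nodesE // frN' // it.
  by rewrite (frA' a_img) // (frA a_img) // frX' // frX.
split=> [|k]; last exact: a1E.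
by rewrite /= updNE // updE !frameE // posE nodesE mulSnr.
Qed.

Lemma kernel_step a (K : nat -> nat -> R) (r := nreg a n_nodes) (l := nreg a n_l)
    (G := exp_gram (nreg a n_dim) (arr a a_node)) :
  (nreg a n_dim < 2 ^ nreg a n_bits)%N -> (l < r)%N ->
  (forall i j, (i < r)%N -> (j < r)%N -> arr a a_kernel (i * r + j)%N = K i j) ->
  forall i j, (i < r)%N -> (j < r)%N -> arr (denote KernelStep a) a_kernel (i * r + j)%N =
    K i j + gs_coef r G K l i * gs_coef r G K l j / gs_sqnorm r G K l.
Proof.
move=> dim_lt lr kernE i j ir jr; rewrite 4!denote_then.
set a1 := denote GramColumn a; set a2 := denote MatVec a1; set a3 := denote GsCoef a2.
have vecE k : (k < r)%N -> arr a1 a_vec k = G k l by move=> kr; rewrite gram_column.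
have imgE k : (k < r)%N -> arr a2 a_img k = \sum_(b < r) K k b * G b l.
  move=> kr; rewrite /a2 matvec frameE //.
  by apply: eq_bigr => b _; rewrite frameE // kernE // vecE.
have coefE k : (k < r)%N -> arr a3 a_img k = gs_coef r G K l k.
  by move=> kr; have := @gs_coef_spec a2 K G l; rewrite !denote_nreg // => ->.
have nodes3 : nreg a3 n_nodes = r by rewrite !frameE.
have vec3 : arr a3 a_vec = arr a1 a_vec by rewrite /a3 denote_arr // /a2 denote_arr.
have img4 : arr (denote GsSqnorm a3) a_img = arr a3 a_img by rewrite frameE.
have kern4 : arr (denote GsSqnorm a3) a_kernel = arr a a_kernel by rewrite !frameE.
have := @kernel_update (denote GsSqnorm a3) i j; rewrite denote_nreg // nodes3 => -> //.
rewrite img4 kern4 kernE // !coefE // gs_sqnorm_spec nodes3 vec3.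
by congr (_ + _ / _); apply: eq_bigr => b _; rewrite coefE // vecE.
Qed.

Lemma kernel_spec a (r := nreg a n_nodes) (G := exp_gram (nreg a n_dim) (arr a a_node)) :
  (nreg a n_dim < 2 ^ nreg a n_bits)%N -> (forall k, arr a a_kernel k = 0) ->
  forall i j, (i < r)%N -> (j < r)%N ->
  arr (denote Kernel a) a_kernel (i * r + j)%N = gram_kernel r G r i j.
Proof.
move=> dim_lt kern0.
pose Inv t (a' : env) := forall i j, (i < r)%N -> (j < r)%N ->
  arr a' a_kernel (i * r + j)%N = gram_kernel r G t i j.
apply: (denote_for_ind (Inv := Inv)) => [//|i j _ _|t a' tr lt [frN _ frA] IH i j ir jr].
  by rewrite /= kern0.
have := @kernel_step a' (gram_kernel r G t); rewrite lt !frN // frA //.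
by move=> step; rewrite [LHS]step.
Qed.

Lemma read_bits dst cnt a (a' := denote (ReadBits dst cnt) a) :
  dst \notin [:: n_bits; n_coin; n_bit; n_unused] -> cnt \notin [:: dst; n_coin; n_bit; n_unused] ->
  nreg a' dst = draw (nreg a n_bits) (nreg a cnt) (skip (tossed a) w) /\
  tossed a' = (tossed a + nreg a n_bits)%N.
Proof.
rewrite !inE !negb_or => /and4P[dst_bits dst_coin dst_bit dst_unused].
move=> /and4P[cnt_dst cnt_coin cnt_bit cnt_unused].
rewrite {}/a' denote_then denoteE; set a0 := set_nreg _ _ _; set body := Toss _ ;; _.
have -> : nreg a n_bits = nreg a0 n_bits by rewrite /= updNE // eq_sym.
apply: (denote_for_ind (Inv := fun t a' =>
  nreg a' dst = bits_val (minn (nreg a cnt) t) (skip (tossed a) w) /\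
  tossed a' = (tossed a + t)%N)).
- by rewrite !inE !negb_or /= eq_sym dst_bit.
- by split; rewrite ?minn0 ?addn0 //= updNE ?updE.
move=> t a' _ bitE [frN _ _] [dstE tossE].
have cntE : nreg a' cnt = nreg a cnt.
  by rewrite frN /= ?updNE // !inE !negb_or cnt_bit cnt_coin cnt_dst.
rewrite /body denote_then !denoteE /= updE !updNE // cntE bitE.
case: ltnP => [t_lt|cnt_le]; split; rewrite /= ?tossE ?addnS //.
  by rewrite updE dstE (minn_idPr t_lt) (minn_idPr (ltnW t_lt)).
by rewrite !updNE // dstE (minn_idPl cnt_le) (minn_idPl (leqW cnt_le)).
Qed.

Lemma pow2_spec a : nreg (denote Pow2 a) n_pow = (2 ^ minn (nreg a n_scale) (nreg a n_bits))%N.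
Proof.
rewrite denote_then denoteE; set a0 := set_nreg _ _ _.
apply: (denote_for_ind (Inv := fun t a' => nreg a' n_pow = (2 ^ minn (nreg a n_scale) t)%N)) => //.
move=> t a' _ bitE [frN _ _] powE; rewrite denoteE /= bitE frN // -[nreg a0 _]/(nreg a n_scale).
case: ltnP => [t_lt|le_t]; rewrite denoteE /= /upd /= powE.
  by rewrite (minn_idPr t_lt) (minn_idPr (ltnW t_lt)) expnS mul2n addnn.
by rewrite (minn_idPl le_t) (minn_idPl (leqW le_t)).
Qed.

Lemma draw_spec a (a' := denote Draw a) (g := skip (tossed a) w) (L := nreg a n_bits)
    (m := draw_scale L (nreg a n_scale_bits) g) :
  [/\ nreg a' n_scale = m, nreg a' n_row = draw_row L m g, nreg a' n_col = draw_col L m g &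
   [/\ nreg a' n_side = draw_side L g, nreg a' n_pow = (2 ^ minn m L)%N &
       tossed a' = (tossed a + sample_bits L)%N]].
Proof.
rewrite {}/a' 4!denote_then.
have [scaleE toss1] := @read_bits n_scale n_scale_bits a isT isT.
set a1 := denote (ReadBits n_scale n_scale_bits) a in scaleE toss1 *.
have [rowE toss2] := @read_bits n_row n_scale a1 isT isT.
set a2 := denote (ReadBits n_row n_scale) a1 in rowE toss2 *.
have [colE toss3] := @read_bits n_col n_scale a2 isT isT.
set a3 := denote (ReadBits n_col n_scale) a2 in colE toss3 *.
have bits1 : nreg a1 n_bits = L by rewrite frameE.
have bits2 : nreg a2 n_bits = L by rewrite frameE.
have bits3 : nreg a3 n_bits = L by rewrite !frameE.
have scale2 : nreg a2 n_scale = m by rewrite frameE.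
have scale3 : nreg a3 n_scale = m by rewrite /a3 denote_nreg.
rewrite toss1 skipD bits1 scaleE in rowE; rewrite toss2 toss1 bits1 scale2 bits2 in colE.
rewrite toss2 bits1 bits2 toss1 in toss3.
have row3 : nreg a3 n_row = draw_row L m g by rewrite frameE.
rewrite denoteE; split.
- by rewrite denote_nreg //= updNE.
- by rewrite denote_nreg //= updNE.
- by rewrite denote_nreg //= updNE // colE -addnA skipD.
split.
- by rewrite denote_nreg //= updE toss3 /draw_side /skip addn0; congr (nat_of_bool (w _)); lia.
- by rewrite pow2_spec /= !updNE // scale3 bits3.
- by rewrite denote_tossed //= toss3 /sample_bits; lia.
Qed.

End Correctness.

Section SgdCorrectness.
Variables (R : realType) (B : nat -> nat -> R) (w : nat -> bool).
Local Notation env := (env R).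
Local Notation denote := (denote B w).
Implicit Types (a : env) (i j k m t : nat).

Lemma entry_powers a i (k := (nreg a n_row + nreg a n_col)%N) :
  (k < 2 ^ nreg a n_bits)%N -> (i < nreg a n_nodes)%N ->
  arr (denote EntryPowers a) a_vec i = arr a a_node i ^+ k.
Proof.
move=> k_lt ir.
rewrite (denote_for_fill (o := 0) (f := fun i => arr a a_node i ^+ k)) ?ir ?subn0 //.
move=> t a' _ it [frN _ frA] _; rewrite denote_then denoteE.
have rowE : nreg a' n_row = nreg a n_row by rewrite frN.
have colE : nreg a' n_col = nreg a n_col by rewrite frN.
have bitsE : nreg a' n_bits = nreg a n_bits by rewrite frN.
have nodeE : arr a' a_node = arr a a_node by rewrite frA.
set a1 := denote (Geo _ _) a'; have i1 : nreg a1 n_i = t by rewrite denote_nreg.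
have node1 : arr a1 a_node = arr a a_node by rewrite denote_arr.
have vec1 : arr a1 a_vec = arr a' a_vec by rewrite denote_arr.
rewrite (@power_of_geoE _ _ k) /= ?i1 ?node1 ?vec1 ?updE //.
by rewrite geo_sum /= rowE colE ?bitsE // it nodeE.
Qed.

Lemma entry_error a : xreg (denote EntryError a) x_step =
  B (nreg a n_row) (nreg a n_col) - \sum_(i < nreg a n_nodes) arr a a_coef i * arr a a_vec i.
Proof.
rewrite denote_then denoteE.
rewrite (denote_for_sum (f := fun i => - (arr a a_coef i * arr a a_vec i))) /= ?sumrN //.
by move=> t a' _ it [_ _ frA]; rewrite denoteE /= updE it !frA.
Qed.

Lemma add_step a i : (i < nreg a n_nodes)%N ->
  arr (denote AddStep a) a_coef i = arr a a_coef i + xreg a x_step * arr a a_img i.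
Proof.
move=> ir; rewrite (denote_for_fill (o := 0)
  (f := fun i => arr a a_coef i + xreg a x_step * arr a a_img i)) ?ir ?subn0 //.
by move=> t a' _ it [_ frX frA] coeft; rewrite denoteE /= it coeft frX // (frA a_img).
Qed.

Lemma mirror_spec a (side : bool) : nreg a n_side = side ->
  nreg (denote Mirror a) n_row = mirror (nreg a n_dim) side (nreg a n_row) /\
  nreg (denote Mirror a) n_col = mirror (nreg a n_dim) side (nreg a n_col).
Proof. by rewrite denoteE => /= ->; case: side; rewrite ?denote_then !denoteE. Qed.

Lemma when_accepted p a : denote (WhenAccepted p) a =
  if [&& (nreg a n_scale < nreg a n_bits + 1)%N, (nreg a n_row + nreg a n_col < nreg a n_pow)%N,
         (nreg a n_pow < nreg a n_row + nreg a n_col + 1 + (nreg a n_row + nreg a n_col + 1))%N &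
         (nreg a n_row + nreg a n_col + 1 + nreg a n_side < nreg a n_dim + 1)%N]
  then denote p a else denote Idle a.
Proof. by rewrite !denoteE /=; do 4?case: ifP => _. Qed.

Variables (n r L Lam : nat) (x : nat -> R).

(* The part of the state that the iteration only reads. *)
Definition sgd_env a : Prop :=
  [/\ nreg a n_dim = n, nreg a n_bits = L, nreg a n_nodes = r, nreg a n_scale_bits = Lam &
   (forall i, (i < r)%N -> arr a a_node i = x i) /\
   (forall i j, (i < r)%N -> (j < r)%N ->
      arr a a_kernel (i * r + j)%N = gram_kernel r (exp_gram n x) r i j)].

Lemma sgd_env_frame p a a' : sgd_env a -> frame p a a' ->
  all (fun k => k \notin writesN p) [:: n_dim; n_bits; n_nodes; n_scale_bits] ->
  all (fun q => q \notin writesA p) [:: a_node; a_kernel] -> sgd_env a'.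
Proof.
move=> [dimE bitsE nodesE lamE [nodeE kernE]] [frN _ frA].
by move=> /and5P[? ? ? ? _] /and3P[? ? _]; split; rewrite ?frN ?frA.
Qed.

Lemma denote_frame p a : frame p a (denote p a).
Proof. by split=> k out; rewrite frameE. Qed.

Lemma sgd_update_spec a m : sgd_env a ->
  (nreg a n_row + nreg a n_col < 2 ^ L)%N -> nreg a n_pow = (2 ^ m)%N ->
  forall i, (i < r)%N -> arr (denote SgdUpdate a) a_coef i =
    sgd_update n r x B (arr a a_coef) m (nreg a n_row) (nreg a n_col) i.
Proof.
move=> [dimE bitsE nodesE _ [nodeE kernE]].
set k := (nreg a n_row + nreg a n_col)%N => k_lt powE i ir.
rewrite 4!denote_then; set a1 := denote EntryPowers a.
have vecE j : (j < r)%N -> arr a1 a_vec j = x j ^+ k.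
  by move=> jr; rewrite entry_powers ?bitsE ?nodesE // nodeE.
have nodes1 : nreg a1 n_nodes = r by rewrite frameE.
set a2 := denote EntryError a1; set a3 := denote ScaleStep a2; set a4 := denote MatVec a3.
have nodes2 : nreg a2 n_nodes = r by rewrite frameE.
have pow2 : nreg a2 n_pow = (2 ^ m)%N by rewrite !frameE.
have vec2 : arr a2 a_vec = arr a1 a_vec by rewrite frameE.
have errorE : xreg a2 x_step = B (nreg a n_row) (nreg a n_col) - expsum r x (arr a a_coef) k.
  rewrite entry_error nodes1 !denote_nreg // [arr a1 a_coef]denote_arr //.
  by congr (_ - _); apply: eq_bigr => j _; rewrite vecE.
have stepE : xreg a4 x_step =
    weight R r m * (B (nreg a n_row) (nreg a n_col) - expsum r x (arr a a_coef) k).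
  rewrite denote_xreg // /a3 denoteE /= updE errorE pow2 nodes2 /weight natrX.
  by rewrite (_ : 4 = 2 * 2) -?exprMn -?exprMn_comm; [ring|ring].
have imgE j : (j < r)%N -> arr a4 a_img j =
    \sum_(b < r) gram_kernel r (exp_gram n x) r j b * x b ^+ k.
  move=> jr; rewrite matvec [nreg a3 _]denote_nreg // nodes2 //.
  apply: eq_bigr => b _; rewrite [arr a3 _]denote_arr // [arr a3 _]denote_arr //.
  by rewrite vec2 vecE // !frameE // kernE.
have nodes4 : nreg a4 n_nodes = r by rewrite !frameE.
rewrite add_step ?nodes4 //.
by rewrite imgE // stepE !frameE.
Qed.

Lemma sgd_step_spec a : sgd_env a -> (0 < n)%N -> (n + n <= 2 ^ L)%N ->
  tossed (denote SgdStep a) = (tossed a + sample_bits L)%N /\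
  forall i, (i < r)%N ->
    arr (denote SgdStep a) a_coef i = sgd_step n r L Lam x B (arr a a_coef) (skip (tossed a) w) i.
Proof.
move=> ready n_gt0 n_le; have [dimE bitsE nodesE lamE _] := ready.
rewrite denote_then; have [] := draw_spec B w a; rewrite bitsE lamE.
set g := skip _ w; set m := draw_scale _ _ _ => scaleE rowE colE [sideE powE tossE].
split; first by rewrite denote_tossed.
have ready1 : sgd_env (denote Draw a) by exact: sgd_env_frame ready (denote_frame _ _) _ _.
have coef1 : arr (denote Draw a) a_coef = arr a a_coef by rewrite frameE.
move: (denote Draw a) ready1 coef1 scaleE rowE colE sideE powE {tossE}.
move=> a1 ready1 coef1 scaleE rowE colE sideE powE i ir; have [dim1 bits1 _ _ _] := ready1.
rewrite when_accepted scaleE rowE colE sideE powE dim1 bits1 /sgd_step /sampled -/m.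
set side := draw_side L g; set row := draw_row L m g; set col := draw_col L m g.
have -> : [&& (m < L + 1)%N, (row + col < 2 ^ minn m L)%N,
    (2 ^ minn m L < row + col + 1 + (row + col + 1))%N & (row + col + 1 + side < n + 1)%N] =
    accept n L m row col side.
  rewrite /accept /near_corner addn1 ltnS; have [mL|//] := leqP m L.
  by congr [&& _, _ & _]; lia.
case: ifP => [/and4P[mL _ _ near]|_]; last by rewrite frameE // coef1.
rewrite denote_then; have [rowE' colE'] := mirror_spec sideE.
rewrite dim1 rowE -/row in rowE'; rewrite dim1 colE -/col in colE'.
have ready2 : sgd_env (denote Mirror a1) by exact: sgd_env_frame ready1 (denote_frame _ _) _ _.
have [row_lt col_lt] := mirror_lt near.
rewrite (sgd_update_spec (m := m) ready2) ?rowE' ?colE' //.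
- by rewrite frameE // coef1.
- by lia.
- by rewrite frameE // powE (minn_idPl mL).
Qed.

Lemma eq_sgd_step c c' g i : (forall j, (j < r)%N -> c j = c' j) -> (i < r)%N ->
  sgd_step n r L Lam x B c g i = sgd_step n r L Lam x B c' g i.
Proof.
move=> eqc ir; rewrite /sgd_step /sampled; case: ifP => _; last exact: eqc.
rewrite /sgd_update eqc //; congr (_ + _ * (_ - _) * _).
by apply: eq_bigr => j _; rewrite eqc.
Qed.

Lemma sgd_spec a : sgd_env a -> (0 < n)%N -> (n + n <= 2 ^ L)%N ->
  tossed a = 0%N -> (forall i, arr a a_coef i = 0) ->
  forall i, (i < r)%N ->
    arr (denote Sgd a) a_coef i = sgd_run n r L Lam x B (nreg a n_rounds) w i.
Proof.
move=> ready n_gt0 n_le toss0 coef0.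
pose Inv t a' := tossed a' = (t * sample_bits L)%N /\
  forall i, (i < r)%N -> arr a' a_coef i = sgd_run n r L Lam x B t w i.
suff [] : Inv (nreg a n_rounds) (denote Sgd a) by [].
apply: denote_for_ind => //; first by split=> [|i _]; [exact: toss0|exact: coef0].
move=> t a' _ _ fr [tossE coefE].
have [tossE' coefE'] := sgd_step_spec (sgd_env_frame ready fr isT isT) n_gt0 n_le.
split; first by rewrite [LHS]tossE' tossE mulSnr.
by move=> i ir; rewrite [LHS]coefE' // tossE; exact: eq_sgd_step.
Qed.

End SgdCorrectness.

Section NodeCorrectness.
Variables (R : realType) (B : nat -> nat -> R) (w : nat -> bool).
Local Notation env := (env R).
Local Notation denote := (denote B w).
Implicit Types (a : env) (d i j k m t : nat).

Definition nodes_upto d m a : Prop :=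
  nreg a n_pos = (4 * m)%N /\ forall k, (k < 4 * m)%N -> arr a a_node k = node R d k.

Lemma node_group a d j t : nreg a n_per_shell = d -> (t < d)%N -> nreg a n_j = t ->
  xreg a x_shell = shell R j -> nodes_upto d (j * d + t) a ->
  nodes_upto d (j * d + t).+1 (denote NodeGroup a).
Proof.
move=> dE td jE shellE; set m := (j * d + t)%N => - [posE nodeE_old].
rewrite /NodeGroup 5!denote_then !denoteE; split; first by rewrite /= updE posE; lia.
move=> k k_lt; rewrite /= /upd /= posE jE dE shellE addn1 -/(shell_node R d j t).
have [km|mk] := ltnP k (4 * m).
  by rewrite !ifF ?nodeE_old //; lia.
have [e e4 ->] : exists2 e, (e < 4)%N & k = (4 * m + e)%N by exists (k - 4 * m)%N; lia.
have base_eq v : (4 * m + v == 4 * m)%N = (v == 0)%N by lia.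
rewrite nodeE // !eqn_add2l base_eq.
by case: e e4 => [|[|[|[|]]]] //= _; rewrite ?sub0r ?div1r.
Qed.

Lemma nodes_spec a :
  nodes_upto (nreg a n_per_shell) (nreg a n_per_shell * nreg a n_shells) (denote Nodes a).
Proof.
set d := nreg a n_per_shell.
rewrite /Nodes 2!denote_then !denoteE; set a0 := set_xreg _ _ _.
pose Inv j a' := xreg a' x_shell = shell R j /\ nodes_upto d (j * d) a'.
suff : Inv (nreg a0 n_shells) (denote (For n_i n_shells NodeShell) a0).
  by rewrite mulnC => - [_].
apply: denote_for_ind => // j a' _ _ [frN _ _] [shellE nodesE].
have dE : nreg a' n_per_shell = d by rewrite frN.
rewrite denote_then denoteE; set a1 := denote (For _ _ _) a'.
have shell1 : xreg a1 x_shell = shell R j by rewrite frameE.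
suff nodes1 : nodes_upto d (j.+1 * d) a1.
  by split=> //=; rewrite updE shell1 shellS mulrC.
rewrite mulSnr -{3}dE.
apply: (denote_for_ind (Inv := fun t a' => nodes_upto d (j * d + t) a')) => //.
  by rewrite addn0.
move=> t a2 td tE [frN2 frX2 _] nodes2; rewrite addnS.
by apply: node_group => //; rewrite ?frN2 ?frX2 // -dE.
Qed.

Lemma count_rounds a : nreg (denote CountRounds a) n_rounds =
  (nreg a n_per_shell * (nreg a n_nodes * (nreg a n_bits * 64)))%N.
Proof.
rewrite denote_then denoteE; set a0 := set_nreg _ _ _.
rewrite (denote_for_count (c := (nreg a n_nodes * (nreg a n_bits * 64))%N)) //.
move=> a1 [fr1 _ _].
rewrite (denote_for_count (c := (nreg a n_bits * 64)%N)) => [|//|//|a2 [fr2 _ _]].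
  by rewrite (fr1 n_nodes).
rewrite (denote_for_count (c := 64)) => [|//|//|a3 _].
  by rewrite (fr2 n_bits) // (fr1 n_bits).
by rewrite denoteE /= updE.
Qed.

Section Entries.
Variables (a : env) (i l : nat).
Hypotheses (iE : nreg a n_row_arg = i) (lE : nreg a n_col_arg = l).
Hypothesis (i_lt : (i < 2 ^ nreg a n_bits)%N).

Let power_arg : eval_rexpr (power_of_geo (XArr a_node n_col_arg))
  (denote (Geo (XArr a_node n_col_arg) n_row_arg) a) = arr a a_node l ^+ i.
Proof.
have argE : eval_rexpr (XArr a_node n_col_arg) (denote (Geo (XArr a_node n_col_arg) n_row_arg) a) =
    arr a a_node l by rewrite /= denote_nreg // denote_arr // lE.
by rewrite (@power_of_geoE _ _ i) argE // geo_sum /= iE // lE.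
Qed.

Lemma entryU_spec : xreg (denote EntryU a) x_out = arr a a_coef l * arr a a_node l ^+ i.
Proof.
rewrite denote_then denoteE [LHS]updE -power_arg.
have -> : arr a a_coef l = eval_rexpr (XArr a_coef n_col_arg)
    (denote (Geo (XArr a_node n_col_arg) n_row_arg) a).
  by rewrite /= denote_nreg // denote_arr // lE.
by [].
Qed.

Lemma entryV_spec : xreg (denote EntryV a) x_out = arr a a_node l ^+ i.
Proof. by rewrite denote_then denoteE [LHS]updE power_arg. Qed.

End Entries.

End NodeCorrectness.

Definition bitlen (n : nat) : nat := up_log 2 n.+1.

Lemma bitlen_gt n : (n < 2 ^ bitlen n)%N.
Proof. exact: up_logP. Qed.

Lemma bitlen_min n m : (m < bitlen n)%N -> (2 ^ m <= n)%N.
Proof. by rewrite ltnNge; apply: contraNleq => n_lt; exact: up_log_min. Qed.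

Lemma bitlen_le n : (bitlen n <= n)%N.
Proof. by rewrite up_log_min // ltn_expl. Qed.

Definition HalveAndCount (c : nat) : stmt :=
  SetN n_halved (n_halved./2) ;; SetN c (c + NLit 1).
Definition StartCount (src c start : nat) : stmt := SetN n_halved src ;; SetN c (NLit start).

Definition bit_length_cmd (src c start : nat) : cmd :=
  Seq (compile (StartCount src c start)) (While (NLt n_zero n_halved) (compile (HalveAndCount c))).

Definition StartDegree : stmt :=
  SetN n_per_shell (NLit 1) ;; SetX x_rate (XLit 5 / XLit 6) ;; SetX x_target (x_eps / XLit 1000).
Definition RaiseDegree : stmt :=
  SetX x_rate (x_rate * (XLit 5 / XLit 6)) ;; SetN n_per_shell (n_per_shell + NLit 1).

Definition degree_cmd : cmd :=
  Seq (compile StartDegree) (While (RLt x_target x_rate) (compile RaiseDegree)).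

Definition CountShells : stmt :=
  SetN n_shells (n_bits + n_bits + (n_bits + n_bits) + NLit 13).
Definition Setup : stmt := Nodes ;; SetN n_nodes n_pos.
Definition Main : stmt := Kernel ;; Sgd ;; SetN n_dim n_nodes.

Definition init_cmd : cmd :=
  Seq (bit_length_cmd n_dim n_bits 1) (Seq (bit_length_cmd n_bits n_scale_bits 0)
    (Seq degree_cmd (compile CountShells))).

Definition prepare_cmd : cmd := Seq (compile Setup) (compile CountRounds).

Definition alg_cmd : cmd :=
  Seq init_cmd (Seq prepare_cmd (compile Main)).

Definition bit_length_cost (k : nat) : nat :=
  (cost 0 (StartCount 0 0 0) + (k * (cost 0 (HalveAndCount 0)).+1 + 1))%N.
Definition degree_cost (k : nat) : nat :=
  (cost 0 StartDegree + (k * (cost 0 RaiseDegree).+1 + 1))%N.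

Definition dim_bits (n : nat) : nat := (bitlen n).+1.
Definition last_shell (n : nat) : nat := (4 * dim_bits n + 12)%N.
Definition alg_rank (n k : nat) : nat := node_count k.+1 (last_shell n).
Definition alg_rounds (n k : nat) : nat := (k.+1 * (alg_rank n k * (dim_bits n * 64)))%N.

Lemma alg_rounds_ge (n k m : nat) :
  m \in [:: k.+1; dim_bits n; (last_shell n).+1; alg_rank n k] -> (m <= alg_rounds n k)%N.
Proof.
move=> m_in; apply: dvdn_leq; first by rewrite !muln_gt0.
move: m_in; rewrite /alg_rounds !inE => /or4P[] /eqP ->.
- exact: dvdn_mulr.
- by rewrite dvdn_mull // dvdn_mull // dvdn_mulr.
- by rewrite dvdn_mull // dvdn_mulr // !dvdn_mull.
- by rewrite dvdn_mull // dvdn_mulr.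
Qed.

Definition init_cost (n k : nat) : nat :=
  (bit_length_cost (bitlen n) + (bit_length_cost (bitlen (dim_bits n)) +
    (degree_cost k + cost 0 CountShells)))%N.

Section Initialization.
Variables (R : realType) (B : nat -> nat -> R) (w : nat -> bool).
Local Notation env := (env R).
Local Notation denote := (denote B w).
Implicit Types (a : env) (k m n c src start : nat).

Lemma runs_loop_free p a : wf [::] p -> runs B w (cost 0 p) (compile p) a (denote p a).
Proof. by move=> wf_p; exact: runs_compile wf_p _. Qed.

Lemma iter_halve_and_count c m a : c != n_halved ->
  iter m (denote (HalveAndCount c)) a =
  set_nreg (set_nreg a n_halved (nreg a n_halved %/ 2 ^ m)) c (nreg a c + m).
Proof.
move=> c_neq; have halved_neq : n_halved != c by rewrite eq_sym.
elim: m => [|m /= ->].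
  case: a => N X A t; rewrite /set_nreg /= divn1 addn0; congr Env; apply/funext => j.
  by rewrite /upd; case: eqP => [->|_] //; case: eqP => [->|].
rewrite denote_then !denoteE /set_nreg /=; congr Env; apply/funext => j.
rewrite /upd (negPf c_neq) (negPf halved_neq) !eqxx expnSr divnMA divn2 addn1 addnS.
by do 2?case: eqP.
Qed.

Lemma runs_bit_length src c start a : (src < 32)%N -> (c < 32)%N ->
  c \notin [:: n_halved; n_zero] ->
  nreg a n_zero = 0%N ->
  runs B w (bit_length_cost (bitlen (nreg a src))) (bit_length_cmd src c start) a
    (set_nreg (set_nreg a n_halved 0) c (start + bitlen (nreg a src))).
Proof.
rewrite !inE negb_or => src_lt c_lt /andP[c_halved c_zero] zeroE; set v := nreg a src.
have zero_c : n_zero != c by rewrite eq_sym.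
have halved_c : n_halved != c by rewrite eq_sym.
have wf_start : wf [::] (StartCount src c start) by rewrite /= src_lt c_lt.
apply: runs_seq (runs_loop_free wf_start) _.
rewrite denote_then !denoteE; set a0 := set_nreg _ _ _.
have iterE m : iter m (denote (HalveAndCount c)) a0 =
    set_nreg (set_nreg a n_halved (v %/ 2 ^ m)) c (start + m).
  rewrite iter_halve_and_count // /a0 /set_nreg /= updE updNE // updE; congr Env.
  by apply/funext => j; rewrite /upd; case: eqP => // _; case: eqP.
have zeroE' m : nreg (iter m (denote (HalveAndCount c)) a0) n_zero = 0%N by rewrite iterE /= !updNE.
have halvedE m : nreg (iter m (denote (HalveAndCount c)) a0) n_halved = (v %/ 2 ^ m)%N.
  by rewrite iterE /= updNE // updE.
have <- : iter (bitlen v) (denote (HalveAndCount c)) a0 =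
    set_nreg (set_nreg a n_halved 0) c (start + bitlen v).
  by rewrite iterE divn_small // bitlen_gt.
apply: runs_while => // [m m_lt|]; rewrite /env_holds zeroE' halvedE.
  have wf_body : wf [::] (HalveAndCount c) by rewrite /= c_lt.
  by rewrite divn_gt0 ?expn_gt0 // bitlen_min //; split=> //; exact: (runs_loop_free wf_body).
by rewrite divn_small // bitlen_gt.
Qed.

Definition degree_env a (eps : R) k : env :=
  set_nreg (set_xreg (set_xreg a x_target (eps / 1000)) x_rate ((5 / 6) ^+ k.+1)) n_per_shell k.+1.

Lemma runs_degree a eps k : xreg a x_eps = eps ->
  (forall m, (m < k)%N -> eps / 1000 < (5 / 6) ^+ m.+1) -> (5 / 6) ^+ k.+1 <= eps / 1000 ->
  runs B w (degree_cost k) degree_cmd a (degree_env a eps k).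
Proof.
move=> epsE large small.
have wf_start : wf [::] StartDegree by [].
apply: runs_seq (runs_loop_free wf_start) _.
have -> : denote StartDegree a = degree_env a eps 0.
  rewrite 2!denote_then !denoteE /degree_env /set_nreg /set_xreg /=; congr Env.
  apply/funext => j; rewrite /upd /= epsE expr1. by do 2?case: eqP => // ->.
have iterE m : iter m (denote RaiseDegree) (degree_env a eps 0) = degree_env a eps m.
  elim: m => //= m ->; rewrite denote_then !denoteE /degree_env /set_nreg /set_xreg /=.
  by rewrite !updE addn1 [in RHS]exprSr; congr Env; apply/funext => j; rewrite /upd; case: eqP.
rewrite -(iterE k); apply: runs_while => // [m m_lt|].
  by split; [rewrite iterE; exact: large|exact: (runs_loop_free (p := RaiseDegree))].
by rewrite iterE /env_holds /= -leNgt.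
Qed.

Definition env_init n (eps : R) : env :=
  Env (upd (fun=> 0%N) n_dim n) (upd (fun=> 0) x_eps eps) (fun _ _ => 0) 0.

Lemma sim_init n eps : sim (init n eps) (env_init n eps).
Proof. by split=> // q i _; rewrite /= /upd /arr_addr. Qed.

Definition initialized n k a : Prop :=
  [/\ nreg a n_dim = n, nreg a n_bits = dim_bits n, nreg a n_scale_bits = bitlen (dim_bits n),
      nreg a n_per_shell = k.+1 /\ nreg a n_shells = (last_shell n).+1 &
      (forall q i, arr a q i = 0) /\ tossed a = 0%N].

Lemma runs_init n eps k :
  (forall m, (m < k)%N -> eps / 1000 < (5 / 6) ^+ m.+1) -> (5 / 6) ^+ k.+1 <= eps / 1000 ->
  exists2 a, runs B w (init_cost n k) init_cmd (env_init n eps) a & initialized n k a.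
Proof.
move=> large small; set a0 := env_init n eps.
have run1 := @runs_bit_length n_dim n_bits 1 a0 isT isT isT erefl.
set a1 := set_nreg _ _ _ in run1.
have run2 := @runs_bit_length n_bits n_scale_bits 0 a1 isT isT isT erefl.
set a2 := set_nreg _ _ _ in run2.
have run3 := @runs_degree a2 eps k erefl large small.
set a3 := degree_env a2 eps k in run3.
exists (denote CountShells a3).
  exact: runs_seq run1 (runs_seq run2 (runs_seq run3 (runs_loop_free (p := CountShells) _))).
rewrite denoteE; split=> //; split=> //.
by rewrite /= updE /upd /= /last_shell /dim_bits; lia.
Qed.

Definition prepared n k a : Prop :=
  [/\ nreg a n_dim = n, nreg a n_bits = dim_bits n, nreg a n_scale_bits = bitlen (dim_bits n),
      nreg a n_nodes = alg_rank n k /\ nreg a n_rounds = alg_rounds n k &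
      [/\ forall i, (i < alg_rank n k)%N -> arr a a_node i = node R k.+1 i,
          forall i, arr a a_kernel i = 0, forall i, arr a a_coef i = 0 & tossed a = 0%N]].

Lemma runs_prepare n k a (b := alg_rounds n k) : initialized n k a ->
  exists2 a', runs B w (cost b Setup + cost b CountRounds) prepare_cmd a a' & prepared n k a'.
Proof.
move=> [dimE bitsE scaleE [perE shellsE] [arr0 toss0]].
have [posE nodeE] := nodes_spec B w a; rewrite perE shellsE in posE nodeE.
set a1 := denote Setup a.
have nodes1 : nreg a1 n_nodes = alg_rank n k by rewrite /a1 denote_then denoteE /= updE.
have node1 i : (i < alg_rank n k)%N -> arr a1 a_node i = node R k.+1 i.
  by rewrite /a1 denote_then denoteE; exact: nodeE.
have bits1 : nreg a1 n_bits = dim_bits n by rewrite frameE.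
have per1 : nreg a1 n_per_shell = k.+1 by rewrite frameE.
exists (denote CountRounds a1).
  apply: runs_seq.
    apply: (@runs_compile R B w [:: n_per_shell; n_shells]) => // q.
    by rewrite !inE => /orP[] /eqP->; rewrite ?perE ?shellsE alg_rounds_ge ?inE ?eqxx ?orbT.
  apply: (@runs_compile R B w [:: n_bits; n_per_shell; n_nodes]) => // q.
  by rewrite !inE => /or3P[] /eqP->; rewrite ?bits1 ?per1 ?nodes1 alg_rounds_ge ?inE ?eqxx ?orbT.
split; first by rewrite !frameE.
- by rewrite frameE.
- by rewrite !frameE.
- by rewrite frameE // count_rounds per1 nodes1 bits1.
- split=> [i ir|i|i|]; first by rewrite denote_arr // node1.
  all: by rewrite !frameE.
Qed.


Definition alg_coef n k : nat -> R :=
  sgd_run n (alg_rank n k) (dim_bits n) (bitlen (dim_bits n)) (node R k.+1) B (alg_rounds n k) w.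

Definition finished n k a : Prop :=
  [/\ nreg a n_dim = alg_rank n k, nreg a n_bits = dim_bits n,
      forall i, (i < alg_rank n k)%N -> arr a a_node i = node R k.+1 i &
      forall i, (i < alg_rank n k)%N -> arr a a_coef i = alg_coef n k i].

Lemma double_dim_le n : (n + n <= 2 ^ dim_bits n)%N.
Proof. by rewrite expnS mul2n addnn leq_double ltnW // bitlen_gt. Qed.

Lemma main_spec n k a : (0 < n)%N -> prepared n k a -> finished n k (denote Main a).
Proof.
move=> n_gt0 [dimE bitsE scaleE [nodesE roundsE] [nodeE kern0 coef0 toss0]].
rewrite 2!denote_then denoteE; set a1 := denote Kernel a.
have env1 : sgd_env n (alg_rank n k) (dim_bits n) (bitlen (dim_bits n)) (node R k.+1) a1.
  split; rewrite ?denote_nreg //; split=> [i ir|i j ir jr]; first by rewrite denote_arr // nodeE.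
  have := @kernel_spec R B w a; rewrite dimE bitsE nodesE => -> //; last first.
    by have := double_dim_le n; lia.
  by apply: eq_gram_kernel => // i' j' i'r j'r; rewrite /exp_gram !nodeE.
split.
- by rewrite /= updE !frameE.
- by rewrite /= updNE // !frameE.
- by move=> i ir; rewrite /= !frameE // nodeE.
- move=> i ir; rewrite [LHS](sgd_spec B w env1 n_gt0 (double_dim_le n)) //.
  + by rewrite frameE // roundsE.
  + by rewrite frameE.
  + by move=> j; rewrite frameE.
Qed.

Definition alg_cost n k (b := alg_rounds n k) : nat :=
  (init_cost n k + (cost b Setup + cost b CountRounds + cost b Main))%N.

Lemma alg_runs n eps k : (0 < n)%N ->
  (forall m, (m < k)%N -> eps / 1000 < (5 / 6) ^+ m.+1) -> (5 / 6) ^+ k.+1 <= eps / 1000 ->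
  exists2 a, runs B w (alg_cost n k) alg_cmd (env_init n eps) a & finished n k a.
Proof.
move=> n_gt0 large small.
have [a1 run1 init1] := runs_init n large small.
have [a2 run2 prep2] := runs_prepare init1.
exists (denote Main a2); last exact: main_spec.
apply: runs_seq run1 (runs_seq run2 _).
apply: (@runs_compile R B w [:: n_bits; n_nodes; n_rounds]) => // q.
have [_ bitsE _ [nodesE roundsE] _] := prep2.
rewrite !inE => /or3P[] /eqP->; rewrite ?bitsE ?nodesE ?roundsE //.
all: by rewrite alg_rounds_ge ?inE ?eqxx ?orbT.
Qed.

End Initialization.

(** * Complexity *)

Definition alg_size : nat := (500 + size_stmt (Setup ;; CountRounds ;; Main ;; EntryU ;; EntryV))%N.

Definition alg_time (n k : nat) : nat := (alg_size * (alg_rounds n k).+1 ^ 3)%N.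

Lemma init_cost_le (n k : nat) : (init_cost n k <= 400 * (alg_rounds n k).+1)%N.
Proof.
have kb : (k.+1 <= alg_rounds n k)%N by rewrite alg_rounds_ge ?inE ?eqxx.
have Lb : (dim_bits n <= alg_rounds n k)%N by rewrite alg_rounds_ge ?inE ?eqxx ?orbT.
have := bitlen_le (dim_bits n); move: Lb kb.
rewrite /init_cost /bit_length_cost /degree_cost /dim_bits.
by move: (bitlen n) (bitlen _.+1) (alg_rounds n k) => l l' b /=; lia.
Qed.

Section AlgTime.
Variables n k : nat.
Let b := alg_rounds n k.

Let alg_time_split : alg_time n k = (500 * b.+1 ^ 3 +
  size_stmt (Setup ;; CountRounds ;; Main ;; EntryU ;; EntryV) * b.+1 ^ 3)%N.
Proof. exact: mulnDl. Qed.

Let programs_cost :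
  (cost b Setup + (cost b CountRounds + (cost b Main + (cost b EntryU + cost b EntryV))) <=
  size_stmt (Setup ;; CountRounds ;; Main ;; EntryU ;; EntryV) * b.+1 ^ 3)%N.
Proof. exact: (@cost_le b 3 (Setup ;; CountRounds ;; Main ;; EntryU ;; EntryV)). Qed.

Lemma alg_cost_le : (alg_cost n k <= alg_time n k)%N.
Proof.
have := init_cost_le n k; rewrite -/b => init_le.
have : (b.+1 <= b.+1 ^ 3)%N by rewrite -{1}[b.+1]expn1 leq_pexp2l.
by have := programs_cost; rewrite /alg_cost alg_time_split -/b; lia.
Qed.

Lemma cost_entryU_le : (cost b EntryU <= alg_time n k)%N.
Proof. by have := programs_cost; rewrite alg_time_split; lia. Qed.

Lemma cost_entryV_le : (cost b EntryV <= alg_time n k)%N.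
Proof. by have := programs_cost; rewrite alg_time_split; lia. Qed.

Lemma alg_bits_le : (b * sample_bits (dim_bits n) <= alg_time n k)%N.
Proof.
have Lb : (dim_bits n <= b)%N by rewrite alg_rounds_ge ?inE ?eqxx ?orbT.
have : (b.+1 * b.+1 <= b.+1 ^ 3)%N by rewrite mulnn leq_pexp2l.
have : (b * sample_bits (dim_bits n) <= b.+1 * (4 * b.+1))%N.
  by apply: leq_mul => //; rewrite /sample_bits; lia.
by rewrite alg_time_split; lia.
Qed.

End AlgTime.

Section PolylogTime.
Variable R : realType.
Implicit Types (n : nat) (eps : R).

Definition steps_suffice eps k : bool := (5 / 6) ^+ k.+1 <= eps / 1000.

Lemma steps_suffice_exists eps : 0 < eps -> exists k, steps_suffice eps k.
Proof.
move=> eps_gt0; have bound_ge0 : 0 <= 5000 / eps by rewrite divr_ge0 // ltW.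
exists (Num.bound (5000 / eps)); set k := Num.bound _.
have k_gt : 5000 / eps < k%:R by have := archi_boundP bound_ge0.
rewrite /steps_suffice (_ : 5 / 6 = (6 / 5)^-1); last by field.
rewrite exprVn -[eps / 1000]invf_div lef_pV2 ?posrE ?divr_gt0 ?exprn_gt0 ?divr_gt0 //.
have : 1 + k.+1%:R * (1 / 5) <= (1 + 1 / 5 : R) ^+ k.+1 by apply: Bernoulli_le; lra.
rewrite (_ : 1 + 1 / 5 = 6 / 5); last by field.
apply: le_trans; have -> : 1000 / eps = 5000 / eps / 5 by field; rewrite gt_eqF.
by rewrite -natr1; lra.
Qed.

Definition eps_steps eps : nat :=
  if pselect (exists k, steps_suffice eps k) is left ex then ex_minn ex else 0%N.

Lemma eps_stepsP eps : 0 < eps -> steps_suffice eps (eps_steps eps) /\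
  forall m, (m < eps_steps eps)%N -> eps / 1000 < (5 / 6) ^+ m.+1.
Proof.
move=> eps_gt0; rewrite /eps_steps.
case: pselect => [ex|]; last by case; exact: steps_suffice_exists.
case: ex_minnP => k suff_k min_k; split=> // m mk.
by rewrite ltNge; apply/negP => /min_k; rewrite leqNgt mk.
Qed.

Lemma ln2_ge : 1 / 2 <= ln 2 :> R.
Proof.
have := @le_ln1Dx R (- (1 / 2)); rewrite (_ : 1 + - (1 / 2) = 2^-1); last by field.
by rewrite lnV ?posrE //; lra.
Qed.

Lemma log_n_ge1 n : (0 < n)%N -> 1 <= log_n R n.
Proof. by move=> n_gt0; rewrite /log_n lerDl ln_ge0 // ler1n. Qed.

Lemma log_eps_ge1 eps : 1 <= log_eps eps.
Proof. by rewrite /log_eps lerDl le_max lexx. Qed.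

Lemma dim_bits_log n : (0 < n)%N -> (dim_bits n)%:R <= 2 * log_n R n.
Proof.
move=> n_gt0; rewrite /dim_bits; case lenE: (bitlen n) => [|l].
  by have := log_n_ge1 n_gt0; lra.
have pow_le : (2 ^ l <= n)%N by rewrite bitlen_min // lenE.
have : ln ((2 : R) ^+ l) <= ln n%:R by rewrite ler_ln ?posrE ?exprn_gt0 ?ltr0n // -natrX ler_nat.
rewrite lnXn // -[leLHS]mulr_natl /log_n; have := ln2_ge; have l_ge0 : 0 <= l%:R :> R by [].
have -> : l.+2%:R = l%:R + 2 :> R by rewrite -addn2 natrD.
nra.
Qed.

Lemma ln1000_le : ln (1000 : R) <= 27.
Proof.
have : ln (10 : R) <= 9 by have := @le_ln1Dx R 9; rewrite (_ : 1 + 9 = 10); [apply; lra|ring].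
by rewrite (_ : 1000 = 10 ^+ 3) ?lnXn // -?natrX // -[ln _ *+ 3]mulr_natl; lra.
Qed.

Lemma eps_steps_log eps : 0 < eps -> (eps_steps eps).+1%:R <= 200 * log_eps eps.
Proof.
move=> eps_gt0; have [_ large] := eps_stepsP eps_gt0; have log_ge1 := log_eps_ge1 eps.
case stepsE: (eps_steps eps) => [|k]; first by lra.
have := large k; rewrite stepsE ltnS leqnn => /(_ isT).
rewrite -ltr_ln ?posrE ?exprn_gt0 ?divr_gt0 // lnXn ?divr_gt0 // -[X in _ < X]mulr_natl.
rewrite ln_div ?posrE // => ln_lt.
have ln_rate : ln (5 / 6 : R) <= - (1 / 6).
  by have := @le_ln1Dx R (- (1 / 6)); rewrite (_ : 1 + - (1 / 6) = 5 / 6); [apply; lra|field].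
have := ln1000_le.
have : - ln eps <= Num.max 0 (ln eps^-1) by rewrite lnV ?posrE // le_max lexx orbT.
move: log_ge1 ln_lt; rewrite /log_eps -[k.+2%:R]natr1 -[k.+1%:R]natr1.
nra.
Qed.

Lemma alg_rank_log n eps : (0 < n)%N -> 0 < eps ->
  (alg_rank n (eps_steps eps))%:R <= 68 * 400 * (log_n R n * log_eps eps).
Proof.
move=> n_gt0 eps_gt0; have bits_le := dim_bits_log n_gt0; have steps_le := eps_steps_log eps_gt0.
have : (alg_rank n (eps_steps eps) <= 68 * ((eps_steps eps).+1 * dim_bits n))%N.
  by rewrite /alg_rank /node_count /last_shell; have : (0 < dim_bits n)%N by []; nia.
rewrite -(ler_nat R) natrM [((eps_steps eps).+1 * _)%:R]natrM => /le_trans; apply.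
by have := ler_pM (ler0n R _) (ler0n R _) steps_le bits_le; lra.
Qed.

Lemma alg_rounds_le n k : ((alg_rounds n k).+1 <= 4353 * (k.+1 * dim_bits n) ^ 2)%N.
Proof.
rewrite /alg_rounds /alg_rank /node_count /last_shell.
have : (0 < dim_bits n)%N by [].
move: (dim_bits n) (k.+1) (ltn0Sn k) => L d d_gt0 L_gt0.
have : (d * (4 * (d * (4 * L + 12).+1) * (L * 64)) <= d * (4 * (d * (17 * L)) * (L * 64)))%N.
  by rewrite !leq_mul //; lia.
have -> : (d * (4 * (d * (17 * L)) * (L * 64)) = 4352 * (d * L) ^ 2)%N by rewrite -mulnn; ring.
have : (0 < (d * L) ^ 2)%N by rewrite expn_gt0 muln_gt0 d_gt0 L_gt0.
by lia.
Qed.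

Lemma alg_time_polylog : polylog (fun n eps => alg_time n (eps_steps eps)).
Proof.
exists (alg_size%:R * (4353 * 400 ^+ 2) ^+ 3), 6%N => n eps n_gt0 eps_gt0.
have bits_le := dim_bits_log n_gt0; have steps_le := eps_steps_log eps_gt0.
set q := log_n R n * log_eps eps.
have dL_le : ((eps_steps eps).+1 * dim_bits n)%:R <= 400 * q.
  by rewrite natrM /q; have := ler_pM (ler0n R _) (ler0n R _) steps_le bits_le; lra.
have rounds_le : (alg_rounds n (eps_steps eps)).+1%:R <= 4353 * (400 * q) ^+ 2 :> R.
  apply: le_trans (_ : (4353 * ((eps_steps eps).+1 * dim_bits n) ^ 2)%N%:R <= _).
    by rewrite ler_nat alg_rounds_le.
  by rewrite natrM natrX ler_wpM2l // lerXn2r ?nnegrE // (le_trans _ dL_le).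
rewrite /alg_time natrM natrX -mulrA ler_wpM2l //.
have -> : (4353 * 400 ^+ 2) ^+ 3 * q ^+ 6 = (4353 * (400 * q) ^+ 2) ^+ 3 by ring.
by rewrite lerXn2r ?nnegrE // (le_trans _ rounds_le).
Qed.

End PolylogTime.

(** * Error analysis *)

Section Norm.
Variables (R : rcfType) (I : finType).
Implicit Types f g : I -> R.

Definition l2norm f : R := Num.sqrt (sqnorm f).

Lemma l2norm_ge0 f : 0 <= l2norm f. Proof. exact: sqrtr_ge0. Qed.

Lemma sqr_l2norm f : l2norm f ^+ 2 = sqnorm f. Proof. by rewrite sqr_sqrtr ?sqnorm_ge0. Qed.

Lemma l2norm_le f c : 0 <= c -> sqnorm f <= c ^+ 2 -> l2norm f <= c.
Proof.
by move=> c_ge0; rewrite -sqr_l2norm => le_sqr; rewrite -(@ler_pXn2r _ 2) ?nnegrE ?l2norm_ge0.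
Qed.

Lemma ler_l2norm f g : sqnorm f <= sqnorm g -> l2norm f <= l2norm g.
Proof. by move=> le_fg; rewrite l2norm_le ?l2norm_ge0 // sqr_l2norm. Qed.

Lemma ler_l2normD f g : l2norm (f + g) <= l2norm f + l2norm g.
Proof.
apply: l2norm_le; first by rewrite addr_ge0 ?l2norm_ge0.
rewrite sqnormD sqrrD !sqr_l2norm lerD2r lerD2l mulr_natl lerMn2r /=.
apply: le_trans (ler_norm _) _.
rewrite -(@ler_pXn2r _ 2) ?nnegrE ?mulr_ge0 ?l2norm_ge0 // real_normK ?num_real //.
by rewrite exprMn !sqr_l2norm dot_CauchySchwarz.
Qed.

Lemma l2normN f : l2norm (- f) = l2norm f.
Proof. by rewrite /l2norm sqnormN. Qed.

Lemma ler_l2normB f g : l2norm (f - g) <= l2norm f + l2norm g.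
Proof. by rewrite -(l2normN g) ler_l2normD. Qed.

Lemma projection_recovery r (u : nat -> I -> R) (h e dev : I -> R) (delta rho : R) :
  0 <= delta -> 0 <= rho -> l2norm (h - proj r u h) <= delta * l2norm h ->
  sqnorm dev <= 10 * (rho ^+ 2 * sqnorm (proj r u (h + e)) + sqnorm (h + e - proj r u (h + e))) ->
  l2norm (h - (proj r u (h + e) + dev)) <=
    (5 * delta + 4 * rho) * l2norm h + (5 + 4 * rho) * l2norm e.
Proof.
move=> delta_ge0 rho_ge0 approx; rewrite -!sqr_l2norm => dev_le.
have h_ge0 := l2norm_ge0 h; have e_ge0 := l2norm_ge0 e.
have input_le : l2norm (proj r u (h + e)) <= l2norm h + l2norm e.
  by apply: le_trans (ler_l2normD _ _); rewrite ler_l2norm ?sqnorm_proj_le.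
have residual_le : l2norm (h + e - proj r u (h + e)) <= delta * l2norm h + l2norm e.
  rewrite projD opprD addrACA; apply: le_trans (ler_l2normD _ _) _.
  by rewrite lerD // ler_l2norm ?sqnorm_projB_le.
have {}dev_le : l2norm dev <= 4 * (rho * (l2norm h + l2norm e) + (delta * l2norm h + l2norm e)).
  have main_ge0 : 0 <= rho * (l2norm h + l2norm e) by rewrite mulr_ge0 ?addr_ge0.
  have tail_ge0 : 0 <= delta * l2norm h + l2norm e by rewrite addr_ge0 ?mulr_ge0.
  have sqr_sum_le (s t : R) : 0 <= s -> 0 <= t -> 10 * (s ^+ 2 + t ^+ 2) <= (4 * (s + t)) ^+ 2.
    by move=> s_ge0 t_ge0; have := mulr_ge0 s_ge0 t_ge0; nra.
  apply: l2norm_le; first by rewrite mulr_ge0 //; exact: addr_ge0.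
  rewrite -sqr_l2norm; apply: le_trans dev_le (le_trans _ (sqr_sum_le _ _ main_ge0 tail_ge0)).
  rewrite ler_wpM2l // -exprMn lerD //; apply: lerXn2r; rewrite ?nnegrE ?l2norm_ge0 //.
    by rewrite mulr_ge0 ?l2norm_ge0.
  by rewrite ler_wpM2l.
have -> : h - (proj r u (h + e) + dev) = (h - proj r u h) - (proj r u e + dev).
  by rewrite projD !opprD !addrA.
apply: le_trans (ler_l2normB _ _) _; apply: le_trans (lerD approx (ler_l2normD _ _)) _.
have : l2norm (proj r u e) <= l2norm e by rewrite ler_l2norm ?sqnorm_proj_le.
lra.
Qed.

End Norm.

Section Recovery.
Variable R : realType.

Lemma geometric_contraction (eta : R) (M d : nat) : 0 <= eta <= 1 -> 1 <= M%:R * eta ->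
  (1 - eta) ^+ (d * M) <= ((5 / 6) ^+ d) ^+ 2.
Proof.
move=> /andP[eta_ge0 eta_le1] rate.
have pow_ge0 : 0 <= (1 - eta) ^+ M by rewrite exprn_ge0 ?subr_ge0.
have pow_ge2 : 2 <= (1 + eta) ^+ M by apply: le_trans (Bernoulli_le _ _); lra.
have prod_le1 : (1 - eta) ^+ M * (1 + eta) ^+ M <= 1 by rewrite -exprMn exprn_ile1 //; nra.
rewrite -[leRHS]exprM mulnC [(d * 2)%N]mulnC 2!exprM lerXn2r ?nnegrE ?sqr_ge0 //.
by rewrite expr2; nra.
Qed.

Lemma shell_last_shell n : 8 * n%:R * shell R (last_shell n) <= 1.
Proof.
have -> : shell R (last_shell n) = ((4 / 5) ^+ 4) ^+ (dim_bits n + 3).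
  by rewrite /shell -exprM /last_shell; congr (_ ^+ _); lia.
have decay : ((4 / 5) ^+ 4) ^+ (dim_bits n + 3) <= 2^-1 ^+ (dim_bits n + 3) :> R.
  by rewrite lerXn2r ?nnegrE ?exprn_ge0 //; lra.
have n_le : n%:R <= 2 ^+ dim_bits n :> R by rewrite -natrX ler_nat; have := double_dim_le n; lia.
have pow_gt0 : 0 < 2 ^+ dim_bits n :> R by rewrite exprn_gt0.
apply: le_trans (_ : 8 * 2 ^+ dim_bits n * 2^-1 ^+ (dim_bits n + 3) <= _).
  by apply: ler_pM; rewrite ?mulr_ge0 ?ler_wpM2l // !exprn_ge0 //; lra.
by rewrite exprD !exprVn (_ : _ * _ = 1) //; field; rewrite gt_eqF.
Qed.

Lemma alg_rank_gt0 n k : (0 < alg_rank n k)%N.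
Proof. by rewrite !muln_gt0. Qed.

Lemma bitlen_double n : (0 < n)%N -> (2 ^ bitlen n <= 2 * n)%N.
Proof.
case lenE: (bitlen n) => [|l] n_gt0; first by rewrite muln_gt0.
by rewrite expnS leq_mul2l bitlen_min // lenE.
Qed.

Lemma sgd_contraction n k :
  (1 - sgd_rate R (alg_rank n k) (bitlen (dim_bits n))) ^+ alg_rounds n k <= ((5 / 6) ^+ k.+1) ^+ 2.
Proof.
rewrite /alg_rounds; apply: geometric_contraction; first by rewrite ltW ?sgd_rate_gt0 ?sgd_rate_le1.
rewrite /sgd_rate ler_pdivlMr ?mul1r ?mulr_gt0 ?exprn_gt0 ?ltr0n // -natrX -!natrM ler_nat.
have -> : (alg_rank n k * (dim_bits n * 64) = 32 * alg_rank n k * (2 * dim_bits n))%N by ring.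
by rewrite leq_mul2l bitlen_double ?orbT.
Qed.

Definition expsum_mx n r (x c : nat -> R) : 'M[R]_n := \matrix_(i, j) expsum r x c (i + j).

Lemma hankel_expsum_mx n r x c : hankel (expsum_mx n r x c).
Proof. by move=> i j k l eq_deg; rewrite !mxE eq_deg. Qed.

Lemma matfun_expsum_mx n r x c : matfun (expsum_mx n r x c) = lincomb r (@expfun R n x) c.
Proof. by apply/funext => p; rewrite /matfun mxE lincomb_expfun. Qed.

Lemma input_fun_oracle n (A : 'M[R]_n) : input_fun (oracle A) = matfun A.
Proof. by apply/funext => p; exact: oracleE. Qed.

Lemma recovery_error N (H E : 'M[R]_N.+1) eps k (c : nat -> R)
    (r := alg_rank N.+1 k) (x := node R k.+1) (B := oracle (H + E))
    (f : 'I_N.+1 * 'I_N.+1 -> R := input_fun B) :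
  hankel H -> psd H -> (5 / 6) ^+ k.+1 <= eps / 1000 ->
  sqnorm (deviation r x B c : 'I_N.+1 * 'I_N.+1 -> R) <=
    10 * ((1 - sgd_rate R r (bitlen (dim_bits N.+1))) ^+ alg_rounds N.+1 k *
      sqnorm (proj r (@expfun R N.+1 x) f) + sqnorm (residual r x B : 'I_N.+1 * 'I_N.+1 -> R)) ->
  frob (H - expsum_mx N.+1 r x c) <= 9 * frob E + eps * frob H.
Proof.
move=> hankel_H psd_H rho_le dev_le; set rho : R := (5 / 6) ^+ k.+1.
have rho_ge0 : 0 <= rho by rewrite exprn_ge0 //; lra.
have approx :
    l2norm (matfun H - proj r (@expfun R N.+1 x) (matfun H)) <= 92 * rho * l2norm (matfun H).
  apply: l2norm_le; first by rewrite !mulr_ge0 ?l2norm_ge0.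
  apply: le_trans (psd_hankel_residual k.+1 (shell_last_shell N.+1) hankel_H psd_H) _.
  rewrite exprMn sqr_l2norm ler_wpM2r ?sqnorm_ge0 // /approx_rate -/rho !exprMn.
  by have := sqr_ge0 rho; lra.
have inputE : f = matfun H + matfun E by rewrite /f input_fun_oracle; apply/funext => p; exact: mxE.
have devE : matfun (H - expsum_mx N.+1 r x c) =
    matfun H - (proj r (@expfun R N.+1 x) f + deviation r x B c).
  rewrite /deviation -/f addrCA subrr addr0 -matfun_expsum_mx.
  by apply/funext => p; rewrite [LHS]mxE [in LHS]mxE.
rewrite !frobE -!/(l2norm _) devE inputE.
apply: le_trans (projection_recovery (delta := 92 * rho) (rho := rho) _ rho_ge0 approx _) _.
- by rewrite mulr_ge0.
- rewrite -inputE; apply: le_trans dev_le _.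
  by rewrite ler_wpM2l // lerD2r ler_wpM2r ?sqnorm_ge0 ?sgd_contraction.
- have rho_le1 : rho <= 1 by rewrite exprn_ile1 //; lra.
  have H_ge0 := l2norm_ge0 (matfun H); have E_ge0 := l2norm_ge0 (matfun E).
  have := ler_wpM2r H_ge0 rho_le; have := ler_wpM2r E_ge0 rho_le1.
  have := mulr_ge0 rho_ge0 H_ge0; rewrite -/rho; lra.
Qed.

End Recovery.

(** * The output of the algorithm *)

Section Output.
Variable R : realType.
Implicit Types (s : state R) (a : env R) (x c : nat -> R).

Definition with_args a i l : env R := set_nreg (set_nreg a n_row_arg i) n_col_arg l.

Lemma sim_with_args s a i l : sim s a -> sim (setN (setN s 1 i) 2 l) (with_args a i l).
Proof. by move=> [simN simX simA simC]; split=> //= j j_lt; rewrite /upd simN. Qed.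

Lemma compile_computes_entries bounds b T p s a n r (U : 'M[R]_(n, r)) :
  sim s a -> wf bounds p -> (cost b p <= T)%N ->
  (forall i l q, q \in bounds -> (nreg (with_args a i l) q <= b)%N) ->
  (forall (i : 'I_n) (l : 'I_r),
     xreg (denote (fun _ _ => 0) (fun=> false) p (with_args a i l)) x_out = U i l) ->
  computes_entries (compile p) T s U.
Proof.
move=> sim_s wf_p cost_le_T le_b valE i l.
have [s' halt [_ simX _ _]] :=
  runs_compile (fun _ _ => 0) (fun=> false) wf_p (le_b i l) (sim_with_args i l sim_s).
exists s'; first exact: halts_le cost_le_T halt.
by rewrite simX.
Qed.

Lemma expsum_mx_factor n r x c : expsum_mx n r x c =
  (\matrix_(i < n, l < r) (c l * x l ^+ i)) *m (\matrix_(i < n, l < r) x l ^+ i)^T.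
Proof.
apply/matrixP => i j; rewrite !mxE; apply: eq_bigr => l _.
by rewrite !mxE exprD mulrA.
Qed.

Lemma rank_factored_rep cU cV T s n (A : 'M[R]_n) :
  factored_rep cU cV T s A -> (\rank A <= width s)%N.
Proof.
move=> [U [V [-> _ _]]].
exact: leq_trans (mxrankM_maxl _ _) (rank_leq_col _).
Qed.

Definition recovered (B : nat -> nat -> R) (w : nat -> bool) n k : 'M[R]_n :=
  expsum_mx n (alg_rank n k) (node R k.+1) (alg_coef B w n k).

Lemma finished_factored_rep B w n k s a :
  sim s a -> finished B w n k a -> factored_rep (compile EntryU) (compile EntryV) (alg_time n k) s
    (recovered B w n k).
Proof.
move=> sim_s [dimE bitsE nodeE coefE].
have widthE : width s = alg_rank n k by have [simN _ _ _] := sim_s; rewrite /width simN.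
move: nodeE coefE; rewrite /factored_rep widthE /recovered expsum_mx_factor.
set r := alg_rank n k => nodeE coefE.
have bits_le i l q : q \in [:: n_bits] -> (nreg (with_args a i l) q <= alg_rounds n k)%N.
  by rewrite inE => /eqP ->; rewrite /= !updNE // bitsE alg_rounds_ge ?inE ?eqxx ?orbT.
have args_lt (i : 'I_n) l : (i < 2 ^ nreg (with_args a i l) n_bits)%N.
  by rewrite /= !updNE // bitsE; have := double_dim_le n; have := ltn_ord i; lia.
eexists; eexists; split; first by [].
- apply: compile_computes_entries sim_s _ (cost_entryU_le n k) bits_le _ => // i l.
  by rewrite (entryU_spec _ _ (i := i) (l := l)) // mxE -nodeE // -coefE.
- apply: compile_computes_entries sim_s _ (cost_entryV_le n k) bits_le _ => // i l.
  by rewrite (entryV_spec _ _ (i := i) (l := l)) // mxE -nodeE.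
Qed.

Lemma alg_outputs B w n k eps : (0 < n)%N ->
  (forall m, (m < k)%N -> eps / 1000 < (5 / 6) ^+ m.+1) -> (5 / 6) ^+ k.+1 <= eps / 1000 ->
  exists s, [/\ halts_within B w (alg_time n k) alg_cmd (init n eps) s, width s = alg_rank n k &
    factored_rep (compile EntryU) (compile EntryV) (alg_time n k) s (recovered B w n k)].
Proof.
move=> n_gt0 large small; have [a run done] := alg_runs B w n_gt0 large small.
have [s halt sim_s] := run _ (sim_init n eps); exists s; split.
- exact: halts_le (alg_cost_le n k) halt.
- by have [dimE _ _ _] := done; have [simN _ _ _] := sim_s; rewrite /width simN.
- exact: finished_factored_rep sim_s done.
Qed.

Lemma recovered_prob N k (H E : 'M[R]_N.+1) eps :
  hankel H -> psd H -> (5 / 6) ^+ k.+1 <= eps / 1000 ->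
  9 / 10 <= coin_prob R (fun w : (alg_time N.+1 k).-tuple bool =>
    frob (H - recovered (oracle (H + E)) (nth false w) N.+1 k) <= 9 * frob E + eps * frob H).
Proof.
move=> hankel_H psd_H small.
have n_le : (N.+1 <= 2 ^ dim_bits N.+1)%N by have := double_dim_le N.+1; lia.
have := sgd_run_prob (node R k.+1) (oracle (H + E)) (alg_rank_gt0 N.+1 k)
  (bitlen_le (dim_bits N.+1)) (bitlen_gt (dim_bits N.+1)) n_le (alg_bits_le N.+1 k).
move=> /le_trans; apply; apply: coin_prob_le => w.
exact: recovery_error.
Qed.

End Output.

Theorem theorem1p1 (R : realType) :
  exists C : R, 0 < C /\
  exists (alg cU cV : cmd) (T : nat -> R -> nat) (K : R), polylog T /\
  forall (n : nat) (H E : 'M[R]_n) (eps : R),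
    (0 < n)%N -> hankel H -> psd H -> 0 < eps ->
    exists (out : (T n eps).-tuple bool -> state R)
           (Hhat : (T n eps).-tuple bool -> 'M[R]_n),
      (forall w : (T n eps).-tuple bool,
        [/\ halts_within (oracle (H + E)) (nth false w) (T n eps) alg
              (init n eps) (out w),
            factored_rep cU cV (T n eps) (out w) (Hhat w),
            hankel (Hhat w),
            (width (out w))%:R <= K * (log_n R n * log_eps eps) &
            (\rank (Hhat w))%:R <= K * (log_n R n * log_eps eps)]) /\
      9 / 10 <= coin_prob R
        (fun w => frob (H - Hhat w) <= C * frob E + eps * frob H).
Proof.
exists 9; split=> //; exists alg_cmd, (compile EntryU), (compile EntryV).
exists (fun n eps => alg_time n (eps_steps eps)), (68 * 400); split; first exact: alg_time_polylog.
move=> [//|N] H E eps _ hankel_H psd_H eps_gt0; have [small large] := eps_stepsP eps_gt0.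
have /choice[out outP] (w : (alg_time N.+1 (eps_steps eps)).-tuple bool) :=
  alg_outputs (oracle (H + E)) (nth false w) (ltn0Sn N) large small.
have rank_le := alg_rank_log (ltn0Sn N) eps_gt0.
exists out, (fun w => recovered (oracle (H + E)) (nth false w) N.+1 (eps_steps eps)).
split=> [w|]; last exact: recovered_prob.
have [halt widthE factored] := outP w; split=> //.
- exact: hankel_expsum_mx.
- by rewrite widthE.
- by apply: le_trans rank_le; rewrite ler_nat -widthE; exact: rank_factored_rep factored.
Qed.
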